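(* For a generic $n$-tuple of positive lengths $(l_1,\dots,l_n)$, every cyclic polygon $P\in\mathbf L(l_1,\dots,l_n)$ is a nondegenerate critical point of $\mathcal A$, and $$\mu_P(\mathcal A)=e(P)-1-2\omega_P-\begin{cases}0,&\sum_{i=1}^n\varepsilon_i\tan\alpha_i>0,\\1,&\text{otherwise}.\end{cases}$$
   Context: $\mathbf L(l_1,\dots,l_n)$ is the space of planar polygons (closed broken lines with cyclically numbered vertices $v_1,\dots,v_n$) with $|v_iv_{i+1}|=l_i$, modulo translations and rotations; for generic lengths it is a smooth closed manifold. The oriented area is $\mathcal A=\frac12\sum_i(x_iy_{i+1}-x_{i+1}y_i)$ for $v_i=(x_i,y_i)$. A polygon is cyclic if all its vertices lie on a circle, with center $O$. $\omega_P$ is the winding number of $P$ around $O$. $\alpha_i$ is half of the unoriented positive angle between $\overrightarrow{Ov_i}$ and $\overrightarrow{Ov_{i+1}}$. $\varepsilon_i=1$ if $O$ lies to the left of $\overrightarrow{v_iv_{i+1}}$, and $-1$ if to the right. $e(P)$ is the number of $i$ with $\varepsilon_i=1$. $\mu_P(\mathcal A)$ is the number of negative eigenvalues of the Hessian of $\mathcal A$ at $P$. *)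

(* Defs.v *)
From Stdlib Require Import Reals Lra Lia Arith.
Open Scope R_scope.

Fixpoint rsum (k : nat) (f : nat -> R) : R :=
  match k with O => 0 | S k' => rsum k' f + f k' end.

Fixpoint ncount (k : nat) (p : nat -> bool) : nat :=
  match k with O => O | S k' => (ncount k' p + (if p k' then 1 else 0))%nat end.

Definition pt := (R * R)%type.
Definition psub (a b : pt) : pt := (fst a - fst b, snd a - snd b).
Definition dot (a b : pt) : R := fst a * fst b + snd a * snd b.
Definition cross (a b : pt) : R := fst a * snd b - snd a * fst b.
Definition norm (a : pt) : R := sqrt (dot a a).
Definition dist (a b : pt) : R := norm (psub a b).

(* A polygon with n vertices: v : nat -> pt, vertices v 0, ..., v (n-1),
   indices taken cyclically (vertex n = vertex 0).  Edge i goes from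
   v i to v (i+1 mod n) and has length l i. *)
Definition nxt (n i : nat) : nat := ((i + 1) mod n)%nat.

Definition area (n : nat) (v : nat -> pt) : R :=
  / 2 * rsum n (fun i => fst (v i) * snd (v (nxt n i)) - fst (v (nxt n i)) * snd (v i)).

(* The polygon space L(l_1..l_n) = {closed polygons with |v_i v_{i+1}| = l_i}
   modulo translations and rotations.  Since l_0 > 0, every class has a unique
   normalized representative with v 0 = (0,0) and v 1 = (l 0, 0); we identify
   L(l) with the set of these representatives (a global slice of the free
   action of orientation-preserving isometries). *)
Definition InL (n : nat) (l : nat -> R) (v : nat -> pt) : Prop :=
  v 0%nat = (0, 0) /\ v 1%nat = (l 0%nat, 0) /\
  forall i, (i < n)%nat -> dist (v i) (v (nxt n i)) = l i.

(* ---------- calculus in R^k (vectors x : nat -> R supported on 0..k-1) ---------- *)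
Definition zerov : nat -> R := fun _ => 0.
Definition shiftk (x : nat -> R) (j : nat) (t : R) : nat -> R :=
  fun m => if Nat.eqb m j then x m + t else x m.

Definition has_partial (g : (nat -> R) -> R) (j : nat) (x : nat -> R) (d : R) : Prop :=
  derivable_pt_lim (fun t => g (shiftk x j t)) 0 d.

Definition InBox (k : nat) (r : R) (x : nat -> R) : Prop :=
  (forall m, (k <= m)%nat -> x m = 0) /\ (forall m, (m < k)%nat -> Rabs (x m) < r).

Definition cont_on (k : nat) (r : R) (g : (nat -> R) -> R) : Prop :=
  forall x, InBox k r x -> forall eps, 0 < eps -> exists delta, 0 < delta /\
    forall y, InBox k r y -> (forall m, (m < k)%nat -> Rabs (y m - x m) < delta) ->
      Rabs (g y - g x) < eps.

Definition C2data (k : nat) (r : R) (g : (nat -> R) -> R)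
    (D1 : nat -> (nat -> R) -> R) (D2 : nat -> nat -> (nat -> R) -> R) : Prop :=
  cont_on k r g /\
  (forall i x, (i < k)%nat -> InBox k r x -> has_partial g i x (D1 i x)) /\
  (forall i, (i < k)%nat -> cont_on k r (D1 i)) /\
  (forall i j x, (i < k)%nat -> (j < k)%nat -> InBox k r x ->
      has_partial (D1 i) j x (D2 i j x)) /\
  (forall i j, (i < k)%nat -> (j < k)%nat -> cont_on k r (D2 i j)).

Definition IsC2 (k : nat) (r : R) (g : (nat -> R) -> R) : Prop :=
  exists D1 D2, C2data k r g D1 D2.

Definition GradHessAt0 (k : nat) (g : (nat -> R) -> R) (Gr : nat -> R) (H : nat -> nat -> R) : Prop :=
  exists r D1 D2, 0 < r /\ C2data k r g D1 D2 /\
    (forall i, (i < k)%nat -> D1 i zerov = Gr i) /\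
    (forall i j, (i < k)%nat -> (j < k)%nat -> D2 i j zerov = H i j).

Definition SymEigenvalues (k : nat) (H : nat -> nat -> R) (lam : nat -> R) : Prop :=
  exists Q : nat -> nat -> R,
    (forall i j, (i < k)%nat -> (j < k)%nat ->
        rsum k (fun m => Q m i * Q m j) = if Nat.eqb i j then 1 else 0) /\
    (forall i j, (i < k)%nat -> (j < k)%nat ->
        H i j = rsum k (fun m => Q i m * lam m * Q j m)).

Definition num_neg (k : nat) (lam : nat -> R) : nat :=
  ncount k (fun m => if Rlt_dec (lam m) 0 then true else false).

Definition ChartAt (n : nat) (l : nat -> R) (P : nat -> pt)
    (r : R) (phi : (nat -> R) -> nat -> pt) : Prop :=
  let k := (n - 3)%nat in
  0 < r /\
  (forall i, (i < n)%nat -> phi zerov i = P i) /\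
  (forall x, InBox k r x -> InL n l (phi x)) /\
  (forall i, (i < n)%nat ->
     IsC2 k r (fun x => fst (phi x i)) /\ IsC2 k r (fun x => snd (phi x i))) /\
  (exists Dphi : nat -> nat -> pt,
     (forall j i, (j < k)%nat -> (i < n)%nat ->
        has_partial (fun x => fst (phi x i)) j zerov (fst (Dphi j i)) /\
        has_partial (fun x => snd (phi x i)) j zerov (snd (Dphi j i))) /\
     (forall c : nat -> R,
        (forall i, (i < n)%nat ->
           rsum k (fun j => c j * fst (Dphi j i)) = 0 /\
           rsum k (fun j => c j * snd (Dphi j i)) = 0) ->
        forall j, (j < k)%nat -> c j = 0)) /\
  (exists eps, 0 < eps /\ forall Q, InL n l Q ->
     (forall i, (i < n)%nat -> dist (Q i) (P i) < eps) ->
     exists x, InBox k r x /\ forall i, (i < n)%nat -> phi x i = Q i).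

Definition NondegCritIndex (n : nat) (l : nat -> R) (P : nat -> pt) (mu : nat) : Prop :=
  exists r phi Gr H lam,
    ChartAt n l P r phi /\
    GradHessAt0 (n - 3) (fun x => area n (phi x)) Gr H /\
    (forall i, (i < n - 3)%nat -> Gr i = 0) /\
    SymEigenvalues (n - 3) H lam /\
    (forall m, (m < n - 3)%nat -> lam m <> 0) /\
    num_neg (n - 3) lam = mu.

Definition OnCircle (n : nat) (v : nat -> pt) (O : pt) (Rad : R) : Prop :=
  0 < Rad /\ forall i, (i < n)%nat -> dist (v i) O = Rad.

Definition epsi (n : nat) (v : nat -> pt) (O : pt) (i : nat) : R :=
  if Rlt_dec 0 (cross (psub (v (nxt n i)) (v i)) (psub O (v i))) then 1 else -1.

Definition alphai (n : nat) (v : nat -> pt) (O : pt) (i : nat) : R :=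
  / 2 * acos (dot (psub (v i) O) (psub (v (nxt n i)) O) /
              (norm (psub (v i) O) * norm (psub (v (nxt n i)) O))).

Definition eP (n : nat) (v : nat -> pt) (O : pt) : nat :=
  ncount n (fun i => if Rlt_dec 0 (cross (psub (v (nxt n i)) (v i)) (psub O (v i)))
                     then true else false).

(* winding number of P around O: (1/2pi) * sum of the oriented angles
   from O v_i to O v_{i+1}; the oriented angle is eps_i * 2 alpha_i. *)
Definition windingP (n : nat) (v : nat -> pt) (O : pt) : R :=
  rsum n (fun i => epsi n v O i * (2 * alphai n v O i)) / (2 * PI).

Definition tanSum (n : nat) (v : nat -> pt) (O : pt) : R :=
  rsum n (fun i => epsi n v O i * tan (alphai n v O i)).

Definition OpenDensePos (n : nat) (U : (nat -> R) -> Prop) : Prop :=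
  (forall l, U l -> exists delta, 0 < delta /\
     forall l', (forall i, (i < n)%nat -> Rabs (l' i - l i) < delta) -> U l') /\
  (forall l, (forall i, (i < n)%nat -> 0 < l i) -> forall eps, 0 < eps ->
     exists l', U l' /\ forall i, (i < n)%nat -> Rabs (l' i - l i) < eps).

(* Main.v *)
(** Write [a_k] for vertex [k] relative to the centre, [b_k] for the signed half central angle of
    edge [k] and [t_k = tan b_k].  On polygons with the given edge lengths the area is, up to a
    constant, [1/2 sum_k (cross (w_k, w_{k+1}) - 1/2 cot b_k |w_{k+1} - w_k|^2)] in the displacement
    [w], because the linear part telescopes to zero; this form is the Hessian.  For tangent vectors
    [w_k = p_k J a_k - q_k a_k] with [p_{k+1} - p_k = t_k (q_k + q_{k+1})] it becomes
    [1/2 sum_k (t_k (q_k + q_{k+1})^2 - (q_{k+1} - q_k)^2 / t_k)], up to the factor [|a_k|^2].  Its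
    kernel contains [s_k = sin (f + 2 sum_{i<k} b_i)] for every phase [f], so for a generic [f] the
    substitution [q_k = s_k h_k] makes it diagonal in [d_k = h_{k+1} - h_k], with coefficients
    [c_k = - s_k s_{k+1} / sin (2 b_k)].  Counting half turns, [e(P) - 2 w] of the [c_k] are
    negative.  The tangent space consists of the [d] orthogonal to the isotropic vector [1/c_k] and
    to a vector of square [2 sum_k t_k], modulo the former, and Sylvester's law of inertia gives the
    index.

    Genericity must exclude edges through the centre and [sum_k t_k = 0].  In terms of the inverse
    diameter [s], the cyclic polygons with given lengths are the zeros modulo [pi] of
    [sum_k (+-) asin (s l_k)], and [sum_k t_k = 0] says that such a zero is critical in [s].  When
    one length varies, its bad values are therefore critical values of a smooth function of [s];
    they do not fill an interval, by the one-dimensional case of Sard's theorem.  Compactness in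
    [s] makes the good lengths an open set. *)
From Stdlib Require Import Reals Lra Lia ZArith List ClassicalEpsilon.
From Stdlib Require Import FunctionalExtensionality.
From Coquelicot Require Import Coquelicot.
Require Import Defs.
Import ListNotations.
Open Scope R_scope.

(** * Finite sums and counting *)

Lemma rsum_ext (m : nat) (f g : nat -> R) :
  (forall i, (i < m)%nat -> f i = g i) -> rsum m f = rsum m g.
Proof.
  induction m as [|m IH]; simpl; intros Hfg; auto.
  rewrite IH, Hfg by (intros; auto with arith). reflexivity.
Qed.

Lemma rsum_plus (m : nat) (f g : nat -> R) :
  rsum m (fun i => f i + g i) = rsum m f + rsum m g.
Proof. induction m as [|m IH]; simpl; [lra|rewrite IH; lra]. Qed.

Lemma rsum_minus (m : nat) (f g : nat -> R) :
  rsum m (fun i => f i - g i) = rsum m f - rsum m g.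
Proof. induction m as [|m IH]; simpl; [lra|rewrite IH; lra]. Qed.

Lemma rsum_scal (m : nat) (c : R) (f : nat -> R) :
  rsum m (fun i => c * f i) = c * rsum m f.
Proof. induction m as [|m IH]; simpl; [lra|rewrite IH; lra]. Qed.

Lemma rsum_scal_r (m : nat) (c : R) (f : nat -> R) :
  rsum m (fun i => f i * c) = rsum m f * c.
Proof. induction m as [|m IH]; simpl; [lra|rewrite IH; lra]. Qed.

Lemma rsum_zero (m : nat) (f : nat -> R) :
  (forall i, (i < m)%nat -> f i = 0) -> rsum m f = 0.
Proof.
  induction m as [|m IH]; simpl; intros Hf; auto.
  rewrite IH, Hf by (intros; auto with arith). lra.
Qed.

Lemma rsum_swap (m k : nat) (f : nat -> nat -> R) :
  rsum m (fun i => rsum k (fun j => f i j)) = rsum k (fun j => rsum m (fun i => f i j)).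
Proof.
  induction m as [|m IH]; simpl.
  - symmetry; apply rsum_zero; auto.
  - rewrite IH, <- rsum_plus. reflexivity.
Qed.

Lemma rsum_const (m : nat) (c : R) : rsum m (fun _ => c) = INR m * c.
Proof. induction m as [|m IH]; [simpl; lra|rewrite S_INR; simpl; rewrite IH; lra]. Qed.

Lemma rsum_le (m : nat) (f g : nat -> R) :
  (forall i, (i < m)%nat -> f i <= g i) -> rsum m f <= rsum m g.
Proof.
  induction m as [|m IH]; simpl; intros Hfg; [lra|].
  apply Rplus_le_compat; auto with arith.
Qed.

Lemma rsum_nonneg (m : nat) (f : nat -> R) :
  (forall i, (i < m)%nat -> 0 <= f i) -> 0 <= rsum m f.
Proof.
  intros Hf. rewrite <- (rsum_zero m (fun _ => 0)) by auto. now apply rsum_le.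
Qed.

Lemma rsum_term_le (m j : nat) (f : nat -> R) :
  (j < m)%nat -> (forall i, (i < m)%nat -> 0 <= f i) -> f j <= rsum m f.
Proof.
  induction m as [|m IH]; simpl; intros Hj Hf; [lia|].
  destruct (Nat.eq_dec j m) as [->|Hne].
  - assert (0 <= rsum m f) by (apply rsum_nonneg; auto with arith). lra.
  - assert (f j <= rsum m f) by (apply IH; [lia|auto with arith]).
    specialize (Hf m (Nat.lt_succ_diag_r m)). lra.
Qed.

Lemma rsum_pos (m j : nat) (f : nat -> R) :
  (j < m)%nat -> 0 < f j -> (forall i, (i < m)%nat -> 0 <= f i) -> 0 < rsum m f.
Proof. intros Hj Hfj Hf. pose proof (rsum_term_le m j f Hj Hf). lra. Qed.

Lemma Rabs_rsum_le (m : nat) (f : nat -> R) (c : R) :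
  (forall i, (i < m)%nat -> Rabs (f i) <= c) -> Rabs (rsum m f) <= INR m * c.
Proof.
  intros Hf. rewrite <- rsum_const.
  induction m as [|m IH]; simpl; [rewrite Rabs_R0; lra|].
  eapply Rle_trans; [apply Rabs_triang|]. apply Rplus_le_compat; auto with arith.
Qed.

Lemma rsum_telescope (m : nat) (f : nat -> R) :
  rsum m (fun i => f (S i) - f i) = f m - f 0%nat.
Proof. induction m as [|m IH]; simpl; [lra|rewrite IH; lra]. Qed.

Lemma rsum_app (a b : nat) (f : nat -> R) :
  rsum (a + b) f = rsum a f + rsum b (fun i => f (a + i)%nat).
Proof.
  induction b as [|b IH]; simpl; [rewrite Nat.add_0_r; lra|].
  rewrite Nat.add_succ_r; simpl. rewrite IH. lra.
Qed.

Definition unitv (k : nat) : nat -> R := fun i => if Nat.eqb i k then 1 else 0.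

Lemma unitv_same (k : nat) : unitv k k = 1.
Proof. unfold unitv. now rewrite Nat.eqb_refl. Qed.

Lemma unitv_diff (k i : nat) : i <> k -> unitv k i = 0.
Proof. intros Hik. unfold unitv. destruct (Nat.eqb_spec i k); [contradiction|reflexivity]. Qed.

Lemma unitv_sym (k i : nat) : unitv k i = unitv i k.
Proof. unfold unitv. now rewrite Nat.eqb_sym. Qed.

Lemma rsum_unitv (m k : nat) (f : nat -> R) :
  (k < m)%nat -> rsum m (fun i => f i * unitv k i) = f k.
Proof.
  induction m as [|m IH]; simpl; intros Hk; [lia|].
  destruct (Nat.eq_dec m k) as [->|Hne].
  - rewrite rsum_zero, unitv_same; [lra|]. intros i Hi. rewrite unitv_diff by lia. ring.
  - rewrite IH, unitv_diff by lia. ring.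
Qed.

Lemma ncount_ext (m : nat) (p q : nat -> bool) :
  (forall i, (i < m)%nat -> p i = q i) -> ncount m p = ncount m q.
Proof.
  induction m as [|m IH]; simpl; intros Hpq; auto.
  rewrite IH, Hpq by (intros; auto with arith). reflexivity.
Qed.

Lemma ncount_app (a b : nat) (p : nat -> bool) :
  ncount (a + b) p = (ncount a p + ncount b (fun i => p (a + i)%nat))%nat.
Proof.
  induction b as [|b IH]; simpl; [rewrite Nat.add_0_r; lia|].
  rewrite Nat.add_succ_r; simpl. rewrite IH. lia.
Qed.

Lemma INR_ncount (m : nat) (p : nat -> bool) :
  INR (ncount m p) = rsum m (fun i => if p i then 1 else 0).
Proof.
  induction m as [|m IH]; simpl; auto.
  rewrite plus_INR, IH. destruct (p m); simpl; lra.
Qed.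

Lemma ncount_negb (m : nat) (p : nat -> bool) :
  (ncount m p + ncount m (fun i => negb (p i)) = m)%nat.
Proof. induction m as [|m IH]; simpl; auto. destruct (p m); simpl; lia. Qed.

Lemma length_filter_seq (m : nat) (p : nat -> bool) :
  length (filter p (seq 0 m)) = ncount m p.
Proof.
  induction m as [|m IH]; auto.
  rewrite seq_S, filter_app, length_app, IH. simpl. destruct (p m); simpl; lia.
Qed.

Definition is_neg (x : R) : bool := if Rlt_dec x 0 then true else false.

Lemma is_neg_true (x : R) : x < 0 -> is_neg x = true.
Proof. unfold is_neg. destruct (Rlt_dec x 0); [auto|contradiction]. Qed.

Lemma is_neg_false (x : R) : 0 <= x -> is_neg x = false.
Proof. unfold is_neg. destruct (Rlt_dec x 0); [lra|auto]. Qed.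

Lemma is_neg_opp (x : R) : x <> 0 -> is_neg (- x) = negb (is_neg x).
Proof.
  intros Hx. destruct (Rlt_dec x 0).
  - rewrite (is_neg_true x), is_neg_false by lra. reflexivity.
  - rewrite (is_neg_false x), is_neg_true by lra. reflexivity.
Qed.

Lemma is_neg_scal (r x : R) : 0 < r -> is_neg (r * x) = is_neg x.
Proof.
  intros Hr. destruct (Rlt_dec x 0).
  - rewrite !is_neg_true by nra. reflexivity.
  - rewrite !is_neg_false by nra. reflexivity.
Qed.

(** * Linear systems *)

Lemma homogeneous_system (m : nat) (E : list (nat -> R)) : (length E < m)%nat ->
  exists x, (exists i, (i < m)%nat /\ x i <> 0) /\
    forall e, In e E -> rsum m (fun i => e i * x i) = 0.
Proof.
  revert E. induction m as [|m IH]; intros E HE; [lia|].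
  destruct (Forall_Exists_dec (fun e : nat -> R => e m = 0)
              (fun e => Req_EM_T (e m) 0) E) as [Hzero|Hpivot].
  { exists (unitv m). split.
    - exists m. split; [lia|]. rewrite unitv_same. lra.
    - intros e He. rewrite rsum_unitv by lia. rewrite Forall_forall in Hzero; auto. }
  apply Exists_exists in Hpivot. destruct Hpivot as [pivot [Hin Hm]].
  apply in_split in Hin. destruct Hin as [E1 [E2 ->]].
  set (reduce := fun (e : nat -> R) i => e i - e m / pivot m * pivot i).
  destruct (IH (map reduce (E1 ++ E2))) as [x [[i [Hi Hxi]] Hx]].
  { rewrite length_map. rewrite length_app in *. simpl in HE. lia. }
  set (xm := - rsum m (fun i => pivot i * x i) / pivot m).
  exists (fun i => if Nat.eqb i m then xm else x i). split.
  { exists i. split; [lia|]. destruct (Nat.eqb_spec i m); [lia|auto]. }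
  intros e He. simpl. rewrite Nat.eqb_refl.
  rewrite (rsum_ext m _ (fun i => e i * x i))
    by (intros j Hj; destruct (Nat.eqb_spec j m); [lia|auto]).
  assert (Hcases : e = pivot \/ In e (E1 ++ E2)).
  { apply in_elt_inv in He. destruct He; auto. }
  destruct Hcases as [->|He']; [unfold xm; field; auto|].
  specialize (Hx (reduce e) (in_map reduce _ _ He')). unfold reduce in Hx.
  rewrite (rsum_ext m _ (fun i => e i * x i - e m / pivot m * (pivot i * x i))) in Hx
    by (intros; ring).
  rewrite rsum_minus, rsum_scal in Hx.
  replace (rsum m (fun i => e i * x i)) with
    (e m / pivot m * rsum m (fun i => pivot i * x i)) by lra.
  unfold xm. field. auto.
Qed.

Lemma injective_system_solvable (k : nat) (M : nat -> nat -> R) :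
  (forall c, (forall i, (i < k)%nat -> rsum k (fun j => c j * M j i) = 0) ->
     forall j, (j < k)%nat -> c j = 0) ->
  forall y : nat -> R, exists x, forall i, (i < k)%nat -> rsum k (fun j => x j * M j i) = y i.
Proof.
  intros Hinj y.
  set (row := fun i j => if Nat.eqb j k then - y i else M j i).
  destruct (homogeneous_system (S k) (map row (seq 0 k))) as [x [[i0 [Hi0 Hx0]] Hx]].
  { rewrite length_map, length_seq; auto. }
  assert (Hrow : forall i, (i < k)%nat -> rsum k (fun j => x j * M j i) = x k * y i).
  { intros i Hi. specialize (Hx (row i) (in_map row (seq 0 k) i ltac:(apply in_seq; lia))).
    simpl in Hx. unfold row at 2 in Hx. rewrite Nat.eqb_refl in Hx.
    rewrite (rsum_ext k _ (fun j => x j * M j i)) in Hx; [lra|].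
    intros j Hj. unfold row. destruct (Nat.eqb_spec j k); [lia|ring]. }
  assert (Hxk : x k <> 0).
  { intros Hxk. apply Hx0. destruct (Nat.eq_dec i0 k) as [->|]; auto.
    apply Hinj; [|lia]. intros i Hi. rewrite Hrow, Hxk by auto. ring. }
  exists (fun j => / x k * x j). intros i Hi.
  rewrite (rsum_ext k _ (fun j => / x k * (x j * M j i))) by (intros; ring).
  rewrite rsum_scal, Hrow by auto. field; auto.
Qed.

Lemma finite_choice {A : Type} (default : A) (m : nat) (P : nat -> A -> Prop) :
  (forall i, (i < m)%nat -> exists y, P i y) ->
  exists Y : nat -> A, forall i, (i < m)%nat -> P i (Y i).
Proof.
  induction m as [|m IH]; intros HP.
  - exists (fun _ => default). intros; lia.
  - destruct IH as [Y HY]; [auto with arith|]. destruct (HP m) as [y Hy]; [auto|].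
    exists (fun i => if Nat.eqb i m then y else Y i). intros i Hi.
    destruct (Nat.eqb_spec i m) as [->|]; auto. apply HY; lia.
Qed.

(* The bound comes from the columns of the inverse matrix. *)
Lemma injective_system_bounded (k : nat) (M : nat -> nat -> R) :
  (forall c, (forall i, (i < k)%nat -> rsum k (fun j => c j * M j i) = 0) ->
     forall j, (j < k)%nat -> c j = 0) ->
  exists B, 0 < B /\ forall (y : nat -> R) (rho : R),
    (forall i, (i < k)%nat -> Rabs (y i) <= rho) ->
    exists x, (forall j, (j < k)%nat -> Rabs (x j) <= B * rho) /\
      forall i, (i < k)%nat -> rsum k (fun j => x j * M j i) = y i.
Proof.
  intros Hinj.
  destruct (finite_choice zerov k (fun i col => forall i', (i' < k)%nat ->
              rsum k (fun j => col j * M j i') = unitv i i')) as [col Hcol].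
  { intros i _. apply (injective_system_solvable k M Hinj (unitv i)). }
  set (entries := rsum k (fun i => rsum k (fun j => Rabs (col i j)))).
  assert (Hentry : forall i j, (i < k)%nat -> (j < k)%nat -> Rabs (col i j) <= entries).
  { intros i j Hi Hj. apply (Rle_trans _ (rsum k (fun j => Rabs (col i j)))).
    - apply (rsum_term_le k j (fun j => Rabs (col i j)) Hj). intros; apply Rabs_pos.
    - apply (rsum_term_le k i (fun i => rsum k (fun j => Rabs (col i j))) Hi).
      intros; apply rsum_nonneg; intros; apply Rabs_pos. }
  assert (Hentries : 0 <= entries)
    by (apply rsum_nonneg; intros; apply rsum_nonneg; intros; apply Rabs_pos).
  pose proof (pos_INR k) as Hk.
  exists (INR k * entries + 1). split; [nra|]. intros y rho Hy.
  exists (fun j => rsum k (fun i => y i * col i j)). split.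
  - intros j Hj.
    assert (Hrho : 0 <= rho) by (eapply Rle_trans; [apply Rabs_pos|apply (Hy j Hj)]).
    apply (Rle_trans _ (INR k * (rho * entries))); [|nra].
    apply Rabs_rsum_le. intros i Hi. rewrite Rabs_mult.
    apply Rmult_le_compat; auto using Rabs_pos.
  - intros i Hi.
    rewrite (rsum_ext k _ (fun j => rsum k (fun i' => y i' * (col i' j * M j i))))
      by (intros; rewrite <- rsum_scal_r; apply rsum_ext; intros; ring).
    rewrite rsum_swap, (rsum_ext k _ (fun i' => y i' * unitv i i')); [now apply rsum_unitv|].
    intros i' Hi'. rewrite rsum_scal, Hcol, unitv_sym by auto. reflexivity.
Qed.

(** * Diagonal bilinear forms *)

Section DiagonalForm.
Variables (n : nat) (c : nat -> R).

Definition dform (x y : nat -> R) : R := rsum n (fun k => c k * x k * y k).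

Lemma dform_sym (x y : nat -> R) : dform x y = dform y x.
Proof. apply rsum_ext; intros; ring. Qed.

Lemma dform_axpy (x y z : nat -> R) (r : R) :
  dform x (fun k => y k + r * z k) = dform x y + r * dform x z.
Proof.
  unfold dform. rewrite <- rsum_scal, <- rsum_plus. apply rsum_ext; intros; ring.
Qed.

Lemma dform_scal (x y : nat -> R) (r : R) : dform x (fun k => r * y k) = r * dform x y.
Proof. unfold dform. rewrite <- rsum_scal. apply rsum_ext; intros; ring. Qed.

Lemma dform_square_add (x y : nat -> R) :
  dform (fun k => x k + 1 * y k) (fun k => x k + 1 * y k)
  = dform x x + 2 * dform x y + dform y y.
Proof.
  rewrite dform_axpy, !(dform_sym (fun _ => _ + _)), !dform_axpy, (dform_sym y x). ring.
Qed.

Lemma dform_rsum (m : nat) (x r : nat -> R) (g : nat -> nat -> R) :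
  dform x (fun k => rsum m (fun j => r j * g j k)) = rsum m (fun j => r j * dform x (g j)).
Proof.
  unfold dform.
  rewrite (rsum_ext n _ (fun k => rsum m (fun j => c k * x k * (r j * g j k))))
    by (intros; rewrite rsum_scal; reflexivity).
  rewrite rsum_swap. apply rsum_ext. intros j _. rewrite <- rsum_scal.
  apply rsum_ext; intros; ring.
Qed.

Lemma dform_unitv (x : nat -> R) (k : nat) : (k < n)%nat -> dform x (unitv k) = c k * x k.
Proof. exact (rsum_unitv n k (fun i => c i * x i)). Qed.

Definition orthogonal_family (r : nat) (g : nat -> nat -> R) : Prop :=
  (forall i j, (i < r)%nat -> (j < r)%nat -> i <> j -> dform (g i) (g j) = 0) /\
  (forall i, (i < r)%nat -> dform (g i) (g i) <> 0).

Lemma orthogonal_coord (r : nat) (g : nat -> nat -> R) (x : nat -> R) (i : nat) :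
  orthogonal_family r g -> (i < r)%nat ->
  rsum r (fun j => x j * dform (g i) (g j)) = x i * dform (g i) (g i).
Proof.
  intros [Horth _] Hi.
  rewrite (rsum_ext r _ (fun j => x j * dform (g i) (g j) * unitv i j)).
  - apply (rsum_unitv r i (fun j => x j * dform (g i) (g j)) Hi).
  - intros j Hj. destruct (Nat.eq_dec j i) as [->|Hne].
    + rewrite unitv_same. ring.
    + rewrite Horth by auto. ring.
Qed.

Lemma orthogonal_square (r : nat) (g : nat -> nat -> R) (x : nat -> R) :
  orthogonal_family r g ->
  let z := fun k => rsum r (fun j => x j * g j k) in
  dform z z = rsum r (fun i => x i * x i * dform (g i) (g i)).
Proof.
  intros Hg z. unfold z at 2. rewrite dform_rsum. apply rsum_ext. intros i Hi.
  rewrite dform_sym. unfold z. rewrite dform_rsum, orthogonal_coord by auto. ring.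
Qed.

Lemma orthogonal_projection (r : nat) (g : nat -> nat -> R) (x : nat -> R) :
  orthogonal_family r g ->
  exists y, (forall j, (j < r)%nat -> dform (g j) y = 0) /\
    forall z, (forall j, (j < r)%nat -> dform (g j) z = 0) -> dform z y = dform z x.
Proof.
  intros Hg. pose proof Hg as [_ Hne].
  exists (fun k => x k +
    (-1) * rsum r (fun j => dform (g j) x / dform (g j) (g j) * g j k)). split.
  - intros j Hj. rewrite dform_axpy, dform_rsum, orthogonal_coord by auto. field. auto.
  - intros z Hz. rewrite dform_axpy, dform_rsum, (rsum_zero r); [ring|].
    intros j Hj. rewrite (dform_sym z), Hz by auto. ring.
Qed.

Hypothesis Hc : forall k, (k < n)%nat -> c k <> 0.

Lemma orthogonal_anisotropic (r : nat) (g : nat -> nat -> R) :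
  (r < n)%nat -> orthogonal_family r g ->
  exists z, (forall j, (j < r)%nat -> dform (g j) z = 0) /\ dform z z <> 0.
Proof.
  intros Hr Hg. set (row := fun j k => c k * g j k).
  destruct (homogeneous_system n (map row (seq 0 r))) as [z [[i [Hi Hzi]] Hz]].
  { rewrite length_map, length_seq; auto. }
  assert (Hgz : forall j, (j < r)%nat -> dform (g j) z = 0).
  { intros j Hj. apply (Hz (row j)), (in_map row), in_seq. lia. }
  destruct (orthogonal_projection r g (unitv i) Hg) as [y [Hgy Hzy]].
  specialize (Hzy z Hgz). rewrite dform_unitv in Hzy by auto.
  assert (Hne : c i * z i <> 0) by (apply Rmult_integral_contrapositive_currified; auto).
  destruct (Req_EM_T (dform z z) 0) as [Hzz|Hzz]; [|exists z; auto].
  destruct (Req_EM_T (dform y y) 0) as [Hyy|Hyy]; [|exists y; auto].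
  exists (fun k => z k + 1 * y k). split.
  - intros j Hj. rewrite dform_axpy, Hgz, Hgy by auto. ring.
  - rewrite dform_square_add, Hzz, Hyy, Hzy. lra.
Qed.

Lemma orthogonal_family_S (r : nat) (g : nat -> nat -> R) (z : nat -> R) :
  orthogonal_family r g -> (forall j, (j < r)%nat -> dform (g j) z = 0) -> dform z z <> 0 ->
  orthogonal_family (S r) (fun i => if Nat.eqb i r then z else g i).
Proof.
  intros [Horth Hne] Hgz Hzz. split.
  - intros i j Hi Hj Hij.
    destruct (Nat.eqb_spec i r), (Nat.eqb_spec j r); subst; try lia.
    + rewrite dform_sym. apply Hgz. lia.
    + apply Hgz. lia.
    + apply Horth; lia.
  - intros i Hi. destruct (Nat.eqb_spec i r); auto. apply Hne. lia.
Qed.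

Lemma orthogonal_extension (m r : nat) (g : nat -> nat -> R) :
  (r + m = n)%nat -> orthogonal_family r g ->
  exists g', (forall i, (i < r)%nat -> g' i = g i) /\ orthogonal_family n g'.
Proof.
  revert r g. induction m as [|m IH]; intros r g Hr Hg.
  - replace r with n in * by lia. exists g. auto.
  - destruct (orthogonal_anisotropic r g) as [z [Hgz Hzz]]; auto; [lia|].
    destruct (IH (S r) _ ltac:(lia) (orthogonal_family_S r g z Hg Hgz Hzz))
      as [g' [Hext Hg']].
    exists g'. split; auto. intros i Hi. rewrite Hext by lia.
    destruct (Nat.eqb_spec i r); [lia|auto].
Qed.

End DiagonalForm.

(* Otherwise some nonzero combination of the negative vectors of the family has no component
   along the negative coordinates. *)
Lemma sylvester_le (n : nat) (c : nat -> R) (g : nat -> nat -> R) :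
  orthogonal_family n c n g ->
  (ncount n (fun i => is_neg (dform n c (g i) (g i))) <= ncount n (fun k => is_neg (c k)))%nat.
Proof.
  intros Hg.
  set (neg_vec := fun i => is_neg (dform n c (g i) (g i))).
  set (neg_coord := fun k => is_neg (c k)).
  apply Nat.nlt_ge. intros Hlt.
  destruct (homogeneous_system n
    (map (fun j => unitv j) (filter (fun i => negb (neg_vec i)) (seq 0 n)) ++
     map (fun k j => g j k) (filter neg_coord (seq 0 n)))) as [x [[i [Hi Hxi]] Hx]].
  { rewrite length_app, !length_map, !length_filter_seq.
    pose proof (ncount_negb n neg_vec). lia. }
  assert (Hvec : forall j, (j < n)%nat -> x j <> 0 -> dform n c (g j) (g j) < 0).
  { intros j Hj Hxj. apply Rnot_le_lt. intros Hpos. apply Hxj.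
    rewrite <- (rsum_unitv n j x Hj), <- (Hx (unitv j)); [apply rsum_ext; intros; ring|].
    apply in_or_app; left. apply in_map, filter_In. split; [apply in_seq; lia|].
    unfold neg_vec. now rewrite is_neg_false by lra. }
  set (z := fun k => rsum n (fun j => x j * g j k)).
  assert (Hcoord : forall k, (k < n)%nat -> c k < 0 -> z k = 0).
  { intros k Hk Hck. rewrite <- (Hx (fun j => g j k)); [apply rsum_ext; intros; ring|].
    apply in_or_app; right. apply (in_map (fun k j => g j k)), filter_In.
    split; [apply in_seq; lia|]. apply is_neg_true; auto. }
  assert (Hnonneg : 0 <= dform n c z z).
  { apply rsum_nonneg. intros k Hk. destruct (Rlt_dec (c k) 0).
    - rewrite Hcoord by auto. lra.
    - nra. }
  assert (Hneg : 0 < rsum n (fun i => (-1) * (x i * x i * dform n c (g i) (g i)))).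
  { assert (Hterm : forall j, (j < n)%nat -> x j <> 0 ->
              0 < (-1) * (x j * x j * dform n c (g j) (g j))).
    { intros j Hj Hxj. pose proof (Hvec j Hj Hxj).
      assert (0 < x j * x j) by (apply Rsqr_pos_lt; auto). nra. }
    apply (rsum_pos n i); auto.
    intros j Hj. destruct (Req_EM_T (x j) 0) as [->|Hxj]; [lra|]. left; auto. }
  rewrite rsum_scal in Hneg. pose proof (orthogonal_square n c n g x Hg) as Hsq.
  fold z in Hsq. cbv zeta in Hsq. lra.
Qed.

Lemma dform_opp (n : nat) (c x y : nat -> R) :
  dform n (fun k => - c k) x y = - dform n c x y.
Proof.
  replace (- dform n c x y) with ((-1) * dform n c x y) by ring.
  unfold dform. rewrite <- rsum_scal. apply rsum_ext; intros; ring.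
Qed.

Lemma sylvester_inertia (n : nat) (c : nat -> R) (g : nat -> nat -> R) :
  (forall k, (k < n)%nat -> c k <> 0) -> orthogonal_family n c n g ->
  ncount n (fun i => is_neg (dform n c (g i) (g i))) = ncount n (fun k => is_neg (c k)).
Proof.
  intros Hc Hg. apply Nat.le_antisymm; [apply sylvester_le; auto|].
  assert (Hle : (ncount n (fun i => is_neg (dform n (fun k => - c k) (g i) (g i)))
                 <= ncount n (fun k => is_neg (- c k)))%nat).
  { apply (sylvester_le n (fun k => - c k)). destruct Hg as [Horth Hne]. split.
    - intros i j Hi Hj Hij. rewrite dform_opp, Horth by auto. ring.
    - intros i Hi. rewrite dform_opp. apply Ropp_neq_0_compat. auto. }
  rewrite (ncount_ext n _ (fun i => negb (is_neg (dform n c (g i) (g i))))) in Hle.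
  2:{ intros i Hi. rewrite dform_opp. apply is_neg_opp. apply Hg; auto. }
  rewrite (ncount_ext n (fun k => is_neg (- c k)) (fun k => negb (is_neg (c k)))) in Hle
    by (intros; apply is_neg_opp; auto).
  pose proof (ncount_negb n (fun i => is_neg (dform n c (g i) (g i)))).
  pose proof (ncount_negb n (fun k => is_neg (c k))). lia.
Qed.

Section IsotropicReduction.
Variables (n : nat) (c a u : nat -> R).
Hypothesis Hn : (3 <= n)%nat.
Hypothesis Hc : forall k, (k < n)%nat -> c k <> 0.
Hypothesis Hu0 : u 0%nat <> 0.
Hypothesis Huu : dform n c u u = 0.
Hypothesis Hau : dform n c a u = 0.
Hypothesis Haa : dform n c a a <> 0.

Lemma isotropic_dual_vector : exists y, dform n c a y = 0 /\ dform n c u y = 1.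
Proof.
  pose proof (Hc 0%nat ltac:(lia)) as Hc0.
  set (y := fun k => unitv 0 k + (- (dform n c a (unitv 0) / dform n c a a)) * a k).
  exists (fun k => / (c 0%nat * u 0%nat) * y k). unfold y.
  rewrite !dform_scal, !dform_axpy, (dform_sym n c u a), Hau, (dform_unitv n c u) by lia.
  split; field; auto.
Qed.

Lemma hyperbolic_pair : exists p m, dform n c a p = 0 /\ dform n c a m = 0 /\
  dform n c p p = 1 /\ dform n c m m = -1 /\ dform n c p m = 0 /\ forall k, u k = p k - m k.
Proof.
  destruct isotropic_dual_vector as [y [Hay Huy]]. set (yy := dform n c y y).
  exists (fun k => y k + (1 - yy) / 2 * u k), (fun k => y k + (- 1 - yy) / 2 * u k).
  assert (Hprod : forall r s, dform n c (fun k => y k + r * u k) (fun k => y k + s * u k)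
                            = yy + r + s).
  { intros r s. rewrite dform_axpy, !(dform_sym n c (fun _ => _ + _)), !dform_axpy.
    rewrite Huu, Huy, (dform_sym n c y u), Huy. fold yy. ring. }
  rewrite !Hprod, !dform_axpy, Hay, Hau.
  repeat split; intros; field.
Qed.

(* An isotropic [u] splits off a hyperbolic plane, which carries exactly one negative square. *)
Lemma isotropic_reduction :
  exists b : nat -> nat -> R, orthogonal_family n c (n - 3) b /\
    (forall i, (i < n - 3)%nat -> dform n c a (b i) = 0 /\ dform n c u (b i) = 0) /\
    ncount n (fun k => is_neg (c k)) =
      ((if is_neg (dform n c a a) then 1 else 0) + 1 +
       ncount (n - 3) (fun i => is_neg (dform n c (b i) (b i))))%nat.
Proof.
  destruct hyperbolic_pair as [p [m [Hap [Ham [Hpp [Hmm [Hpm Hu]]]]]]].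
  set (start := fun i => match i with O => a | S O => p | _ => m end).
  destruct (orthogonal_extension n c Hc (n - 3) 3 start) as [g [Hstart Hg]]; [lia| |].
  { split.
    - intros [|[|[|i]]] [|[|[|j]]] Hi Hj Hij; try lia; unfold start;
        auto; rewrite dform_sym; auto.
    - intros [|[|[|i]]] Hi; try lia; unfold start; auto; lra. }
  pose proof (Hstart 0%nat ltac:(lia)) as Hg0. pose proof (Hstart 1%nat ltac:(lia)) as Hg1.
  pose proof (Hstart 2%nat ltac:(lia)) as Hg2. unfold start in Hg0, Hg1, Hg2.
  pose proof Hg as [Horth Hne].
  exists (fun i => g (3 + i)%nat). split; [|split].
  - split; intros; [apply Horth|apply Hne]; lia.
  - intros i Hi.
    assert (Hperp : forall j, (j < 3)%nat -> dform n c (g (3 + i)%nat) (g j) = 0)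
      by (intros; apply Horth; lia).
    rewrite !(dform_sym n c _ (g _)), <- Hg0. split; [apply Hperp; lia|].
    replace u with (fun k => g 1%nat k + (-1) * g 2%nat k).
    + rewrite dform_axpy, !Hperp by lia. ring.
    + apply functional_extensionality. intros k. rewrite Hu, Hg1, Hg2. ring.
  - rewrite <- (sylvester_inertia n c g Hc Hg).
    replace n with (3 + (n - 3))%nat at 1 by lia. rewrite ncount_app.
    simpl ncount at 1. rewrite Hg0, Hg1, Hg2, Hpp, Hmm.
    rewrite (is_neg_false 1), (is_neg_true (-1)) by lra. lia.
Qed.

End IsotropicReduction.

(** * Limits along filters *)

Section FilterLimits.
Context {T : Type} {F : (T -> Prop) -> Prop} {FF : Filter F}.

Lemma filterlim_Rplus (f g : T -> R) (a b : R) :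
  filterlim f F (locally a) -> filterlim g F (locally b) ->
  filterlim (fun x => f x + g x) F (locally (a + b)).
Proof. intros Hf Hg. exact (filterlim_comp_2 _ _ Rplus Hf Hg (filterlim_plus a b)). Qed.

Lemma filterlim_Rmult (f g : T -> R) (a b : R) :
  filterlim f F (locally a) -> filterlim g F (locally b) ->
  filterlim (fun x => f x * g x) F (locally (a * b)).
Proof. intros Hf Hg. exact (filterlim_comp_2 _ _ Rmult Hf Hg (filterlim_mult a b)). Qed.

Lemma filterlim_Rcomp (h : R -> R) (f : T -> R) (a : R) :
  filterlim f F (locally a) -> continuity_pt h a ->
  filterlim (fun x => h (f x)) F (locally (h a)).
Proof.
  intros Hf Hh. apply (filterlim_comp _ _ _ f h _ (locally a)); auto.
  now apply continuity_pt_filterlim.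
Qed.

Lemma filterlim_Rminus (f g : T -> R) (a b : R) :
  filterlim f F (locally a) -> filterlim g F (locally b) ->
  filterlim (fun x => f x - g x) F (locally (a - b)).
Proof.
  intros Hf Hg. apply (filterlim_Rplus f (fun x => - g x)); auto.
  apply filterlim_Rcomp; auto. reg.
Qed.

Lemma filterlim_rsum (m : nat) (f : nat -> T -> R) (a : nat -> R) :
  (forall i, (i < m)%nat -> filterlim (f i) F (locally (a i))) ->
  filterlim (fun x => rsum m (fun i => f i x)) F (locally (rsum m a)).
Proof.
  induction m as [|m IH]; simpl; intros Hf; [apply filterlim_const|].
  apply filterlim_Rplus; auto with arith.
Qed.

Lemma filterlim_eventually_gt (f : T -> R) (a b : R) :
  filterlim f F (locally a) -> b < a -> F (fun x => b < f x).
Proof. intros Hf Hba. exact (Hf _ (open_gt b a Hba)). Qed.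

Lemma filterlim_eventually_lt (f : T -> R) (a b : R) :
  filterlim f F (locally a) -> a < b -> F (fun x => f x < b).
Proof. intros Hf Hab. exact (Hf _ (open_lt b a Hab)). Qed.

Lemma filterlim_eventually_neq (f : T -> R) (a b : R) :
  filterlim f F (locally a) -> a <> b -> F (fun x => f x <> b).
Proof. intros Hf Hab. exact (Hf _ (open_neq b a Hab)). Qed.

Lemma filter_forall_lt (m : nat) (P : nat -> T -> Prop) :
  (forall i, (i < m)%nat -> F (P i)) -> F (fun x => forall i, (i < m)%nat -> P i x).
Proof.
  induction m as [|m IH]; intros HP.
  - apply filter_forall. intros x i Hi. lia.
  - generalize (filter_and _ _ (IH (fun i Hi => HP i (Nat.lt_lt_succ_r _ _ Hi)))
                  (HP m (Nat.lt_succ_diag_r m))).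
    apply filter_imp. intros x [Hlt Hm] i Hi.
    destruct (Nat.eq_dec i m) as [->|]; auto. apply Hlt. lia.
Qed.

End FilterLimits.

Definition close (n : nat) (d : R) (y x : nat -> R) : Prop :=
  forall i, (i < n)%nat -> Rabs (y i - x i) < d.

Definition coord_nbhd (n : nat) (x : nat -> R) (A : (nat -> R) -> Prop) : Prop :=
  exists d, 0 < d /\ forall y, close n d y x -> A y.

Lemma close_le (n : nat) (d d' : R) (y x : nat -> R) :
  d <= d' -> close n d y x -> close n d' y x.
Proof. intros Hd Hyx i Hi. specialize (Hyx i Hi). lra. Qed.

Lemma close_refl (n : nat) (d : R) (x : nat -> R) : 0 < d -> close n d x x.
Proof. intros Hd i _. rewrite Rminus_diag, Rabs_R0. auto. Qed.

Lemma close_trans (n : nat) (d d' : R) (x y z : nat -> R) :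
  close n d x y -> close n d' y z -> close n (d + d') x z.
Proof.
  intros Hxy Hyz i Hi. specialize (Hxy i Hi). specialize (Hyz i Hi).
  replace (x i - z i) with ((x i - y i) + (y i - z i)) by ring.
  eapply Rle_lt_trans; [apply Rabs_triang|]. lra.
Qed.

Global Instance coord_nbhd_filter (n : nat) (x : nat -> R) : Filter (coord_nbhd n x).
Proof.
  split.
  - exists 1. split; [lra|auto].
  - intros A B [d [Hd HA]] [d' [Hd' HB]]. exists (Rmin d d').
    split; [apply Rmin_pos; auto|]. intros y Hy.
    split; [apply HA|apply HB]; apply (close_le n (Rmin d d')); auto using Rmin_l, Rmin_r.
  - intros A B HAB [d [Hd HA]]. exists d. auto.
Qed.

Lemma coord_nbhd_self (n : nat) (x : nat -> R) (A : (nat -> R) -> Prop) :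
  coord_nbhd n x A -> A x.
Proof. intros [d [Hd HA]]. apply HA, close_refl, Hd. Qed.

Lemma filterlim_coord (n i : nat) (x : nat -> R) : (i < n)%nat ->
  filterlim (fun y => y i) (coord_nbhd n x) (locally (x i)).
Proof.
  intros Hi. apply filterlim_locally. intros eps. exists eps.
  split; [apply cond_pos|]. intros y Hy. apply Hy, Hi.
Qed.

(** * Second order jets on a box *)

Lemma cont_on_filterlim (k : nat) (r : R) (g : (nat -> R) -> R) :
  cont_on k r g <-> forall x, InBox k r x ->
    filterlim g (within (InBox k r) (coord_nbhd k x)) (locally (g x)).
Proof.
  split.
  - intros Hg x Hx. apply filterlim_locally. intros eps.
    destruct (Hg x Hx eps (cond_pos eps)) as [d [Hd Hclose]].
    exists d. split; auto. intros y Hyx Hy. apply Hclose; auto.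
  - intros Hg x Hx eps Heps.
    destruct (proj1 (filterlim_locally _ _) (Hg x Hx) (mkposreal eps Heps)) as [d [Hd Hclose]].
    exists d. split; auto. intros y Hy Hyx. apply Hclose; auto.
Qed.

Lemma shiftk_0 (x : nat -> R) (j : nat) : shiftk x j 0 = x.
Proof.
  apply functional_extensionality. intros m. unfold shiftk.
  destruct (Nat.eqb m j); lra.
Qed.

Lemma InBox_zerov (k : nat) (r : R) : 0 < r -> InBox k r zerov.
Proof. intros Hr. split; intros; unfold zerov; auto. rewrite Rabs_R0; auto. Qed.

Lemma InBox_le (k : nat) (r r' : R) (x : nat -> R) : r' <= r -> InBox k r' x -> InBox k r x.
Proof. intros Hr [Hsupp Hx]. split; auto. intros m Hm. specialize (Hx m Hm). lra. Qed.

Section Box.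
Variables (k : nat) (r : R).

Lemma InBox_shiftk_near (x : nat -> R) (j : nat) : (j < k)%nat -> InBox k r x ->
  locally 0 (fun t => InBox k r (shiftk x j t)).
Proof.
  intros Hj [Hsupp Hx].
  assert (Hgap : 0 < r - Rabs (x j)) by (specialize (Hx j Hj); lra).
  exists (mkposreal _ Hgap). intros t Ht.
  change (Rabs (t - 0) < r - Rabs (x j)) in Ht. rewrite Rminus_0_r in Ht.
  unfold shiftk. split; intros m Hm; destruct (Nat.eqb_spec m j) as [->|Hne]; auto.
  - lia.
  - eapply Rle_lt_trans; [apply Rabs_triang|]. lra.
Qed.

Lemma has_partial_ext (f g : (nat -> R) -> R)(j : nat) (x : nat -> R) (d : R) :
  (j < k)%nat -> InBox k r x -> (forall y, InBox k r y -> f y = g y) ->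
  has_partial g j x d -> has_partial f j x d.
Proof.
  intros Hj Hx Hfg Hg. apply is_derive_Reals. apply is_derive_Reals in Hg.
  apply (is_derive_ext_loc (fun t => g (shiftk x j t))); auto.
  generalize (InBox_shiftk_near x j Hj Hx). apply filter_imp.
  intros t Ht. symmetry. auto.
Qed.

Lemma has_partial_plus (f g : (nat -> R) -> R)(j : nat) (x : nat -> R) (a b : R) :
  has_partial f j x a -> has_partial g j x b -> has_partial (fun y => f y + g y) j x (a + b).
Proof. exact (derivable_pt_lim_plus _ _ _ _ _). Qed.

Lemma has_partial_mult (f g : (nat -> R) -> R)(j : nat) (x : nat -> R) (a b : R) :
  has_partial f j x a -> has_partial g j x b ->
  has_partial (fun y => f y * g y) j x (a * g x + f x * b).
Proof.
  intros Hf Hg. pose proof (derivable_pt_lim_mult _ _ _ _ _ Hf Hg) as Hfg.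
  cbv beta in Hfg. rewrite shiftk_0 in Hfg. exact Hfg.
Qed.

Lemma has_partial_comp (h : R -> R) (g : (nat -> R) -> R) (j : nat) (x : nat -> R) (a b : R) :
  has_partial g j x a -> derivable_pt_lim h (g x) b ->
  has_partial (fun y => h (g y)) j x (b * a).
Proof.
  intros Hg Hh. apply (derivable_pt_lim_comp (fun t => g (shiftk x j t)) h); auto.
  rewrite shiftk_0; auto.
Qed.

Lemma has_partial_const (c : R) (j : nat) (x : nat -> R) : has_partial (fun _ => c) j x 0.
Proof. apply (derivable_pt_lim_const c). Qed.

Lemma has_partial_coord (i j : nat) (x : nat -> R) : has_partial (fun y => y i) j x (unitv j i).
Proof.
  unfold has_partial, unitv, shiftk. destruct (Nat.eqb i j).
  - replace 1 with (0 + 1) by ring.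
    apply (derivable_pt_lim_plus (fun _ => x i) id).
    + apply derivable_pt_lim_const.
    + apply derivable_pt_lim_id.
  - apply (derivable_pt_lim_const (x i)).
Qed.

Lemma cont_on_ext (f g : (nat -> R) -> R) :
  (forall y, InBox k r y -> f y = g y) -> cont_on k r g -> cont_on k r f.
Proof.
  intros Hfg Hg x Hx eps Heps. destruct (Hg x Hx eps Heps) as [d [Hd Hclose]].
  exists d. split; auto. intros y Hy Hyx. rewrite !Hfg by auto. auto.
Qed.

Lemma cont_on_const (c : R) : cont_on k r (fun _ => c).
Proof. apply cont_on_filterlim. intros x _. apply filterlim_const. Qed.

Lemma cont_on_coord (i : nat) : cont_on k r (fun y => y i).
Proof.
  destruct (Nat.lt_ge_cases i k) as [Hi|Hi].
  - apply cont_on_filterlim. intros x _.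
    apply (filterlim_filter_le_1 (F := coord_nbhd k x)); [apply filter_le_within|].
    apply filterlim_coord, Hi.
  - apply (cont_on_ext _ (fun _ => 0)); [|apply cont_on_const]. intros y [Hsupp _]. auto.
Qed.

Lemma cont_on_comp (h : R -> R) (g : (nat -> R) -> R) :
  cont_on k r g -> (forall x, InBox k r x -> continuity_pt h (g x)) ->
  cont_on k r (fun y => h (g y)).
Proof.
  rewrite !cont_on_filterlim. intros Hg Hh x Hx. apply filterlim_Rcomp; auto.
Qed.

Lemma cont_on_plus (f g : (nat -> R) -> R) :
  cont_on k r f -> cont_on k r g -> cont_on k r (fun y => f y + g y).
Proof. rewrite !cont_on_filterlim. intros Hf Hg x Hx. apply filterlim_Rplus; auto. Qed.

Lemma cont_on_mult (f g : (nat -> R) -> R) :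
  cont_on k r f -> cont_on k r g -> cont_on k r (fun y => f y * g y).
Proof. rewrite !cont_on_filterlim. intros Hf Hg x Hx. apply filterlim_Rmult; auto. Qed.

Definition Jet (f : (nat -> R) -> R) (f0 : R) (f1 : nat -> R) (f2 : nat -> nat -> R) : Prop :=
  exists D1 D2, C2data k r f D1 D2 /\ f zerov = f0 /\
    (forall i, (i < k)%nat -> D1 i zerov = f1 i) /\
    (forall i j, (i < k)%nat -> (j < k)%nat -> D2 i j zerov = f2 i j).

Definition Jet1 (f : (nat -> R) -> R) (f0 : R) (f1 : nat -> R) : Prop := exists f2, Jet f f0 f1 f2.

End Box.

Section JetCalculus.
Context {k : nat} {r : R}.

Lemma Jet_ext (f g : (nat -> R) -> R) {f0 f1 f2} :
  0 < r -> (forall y, InBox k r y -> f y = g y) -> Jet k r g f0 f1 f2 -> Jet k r f f0 f1 f2.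
Proof.
  intros Hr Hfg [D1 [D2 [[Hcont [Hpart HD]] [Hval Hders]]]].
  exists D1, D2. split; [|split; [rewrite Hfg; auto; apply InBox_zerov; auto|auto]].
  split; [|split; auto].
  - apply (cont_on_ext k r _ g); auto.
  - intros i x Hi Hx. apply (has_partial_ext k r f g); auto.
Qed.

Lemma Jet_val {f f0 f1 f2 f0' f1' f2'} :
  Jet k r f f0 f1 f2 -> f0 = f0' -> (forall i, (i < k)%nat -> f1 i = f1' i) ->
  (forall i j, (i < k)%nat -> (j < k)%nat -> f2 i j = f2' i j) -> Jet k r f f0' f1' f2'.
Proof.
  intros [D1 [D2 [HC2 [Hval [Hgrad Hhess]]]]] E0 E1 E2.
  exists D1, D2. split; [exact HC2|]. split; [congruence|]. split.
  - intros i Hi. rewrite Hgrad, E1; auto.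
  - intros i j Hi Hj. rewrite Hhess, E2; auto.
Qed.

Lemma Jet_const (c : R) : Jet k r (fun _ => c) c (fun _ => 0) (fun _ _ => 0).
Proof.
  exists (fun _ _ => 0), (fun _ _ _ => 0). repeat split; auto; intros;
    first [apply cont_on_const | apply has_partial_const].
Qed.

Lemma Jet_plus {f g f0 f1 f2 g0 g1 g2} :
  Jet k r f f0 f1 f2 -> Jet k r g g0 g1 g2 ->
  Jet k r (fun y => f y + g y) (f0 + g0) (fun i => f1 i + g1 i) (fun i j => f2 i j + g2 i j).
Proof.
  intros [D1 [D2 [[Cf [Pf [CDf [PDf CD2f]]]] [Vf [Gf Hf]]]]]
         [E1 [E2 [[Cg [Pg [CDg [PDg CD2g]]]] [Vg [Gg Hg]]]]].
  exists (fun i x => D1 i x + E1 i x), (fun i j x => D2 i j x + E2 i j x).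
  repeat split; intros; try (apply cont_on_plus; auto); try (apply has_partial_plus; auto).
  - congruence.
  - rewrite Gf, Gg; auto.
  - rewrite Hf, Hg; auto.
Qed.

Lemma Jet_mult {f g f0 f1 f2 g0 g1 g2} :
  Jet k r f f0 f1 f2 -> Jet k r g g0 g1 g2 ->
  Jet k r (fun y => f y * g y) (f0 * g0) (fun i => f1 i * g0 + f0 * g1 i)
    (fun i j => (f2 i j * g0 + f1 i * g1 j) + (f1 j * g1 i + f0 * g2 i j)).
Proof.
  intros [D1 [D2 [[Cf [Pf [CDf [PDf CD2f]]]] [Vf [Gf Hf]]]]]
         [E1 [E2 [[Cg [Pg [CDg [PDg CD2g]]]] [Vg [Gg Hg]]]]].
  exists (fun i x => D1 i x * g x + f x * E1 i x),
    (fun i j x => (D2 i j x * g x + D1 i x * E1 j x) + (D1 j x * E1 i x + f x * E2 i j x)).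
  repeat split; intros.
  - apply cont_on_mult; auto.
  - apply has_partial_mult; auto.
  - apply cont_on_plus; apply cont_on_mult; auto.
  - apply has_partial_plus; apply has_partial_mult; auto.
  - repeat apply cont_on_plus; apply cont_on_mult; auto.
  - congruence.
  - rewrite Gf, Gg, Vf, Vg; auto.
  - rewrite Hf, Hg, !Gf, !Gg, Vf, Vg; auto.
Qed.

Lemma Jet_scal (c : R) {g g0 g1 g2} :
  Jet k r g g0 g1 g2 ->
  Jet k r (fun y => c * g y) (c * g0) (fun i => c * g1 i) (fun i j => c * g2 i j).
Proof.
  intros Hg. eapply Jet_val; [apply (Jet_mult (Jet_const c) Hg)| | |]; intros; simpl; ring.
Qed.

Lemma Jet_minus {f g f0 f1 f2 g0 g1 g2} :
  Jet k r f f0 f1 f2 -> Jet k r g g0 g1 g2 ->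
  Jet k r (fun y => f y - g y) (f0 - g0) (fun i => f1 i - g1 i) (fun i j => f2 i j - g2 i j).
Proof.
  intros Hf Hg.
  replace (fun y => f y - g y) with (fun y => f y + -1 * g y)
    by (apply functional_extensionality; intros; ring).
  eapply Jet_val; [exact (Jet_plus Hf (Jet_scal (-1) Hg))| | |]; intros; simpl; ring.
Qed.

Lemma Jet_comp (h h' h'' : R -> R) {g g0 g1 g2} :
  Jet k r g g0 g1 g2 ->
  (forall x, InBox k r x -> derivable_pt_lim h (g x) (h' (g x)) /\
     derivable_pt_lim h' (g x) (h'' (g x)) /\ continuity_pt h'' (g x)) ->
  Jet k r (fun y => h (g y)) (h g0) (fun i => h' g0 * g1 i)
    (fun i j => (h'' g0 * g1 j) * g1 i + h' g0 * g2 i j).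
Proof.
  intros [E1 [E2 [[Cg [Pg [CDg [PDg CD2g]]]] [Vg [Gg Hg]]]]] Hh.
  assert (Ch : cont_on k r (fun y => h (g y))).
  { apply cont_on_comp; auto. intros x Hx. apply derivable_continuous_pt.
    exists (h' (g x)). apply Hh; auto. }
  assert (Ch' : cont_on k r (fun y => h' (g y))).
  { apply cont_on_comp; auto. intros x Hx. apply derivable_continuous_pt.
    exists (h'' (g x)). apply Hh; auto. }
  assert (Ch'' : cont_on k r (fun y => h'' (g y))).
  { apply cont_on_comp; auto. intros x Hx. apply Hh; auto. }
  exists (fun i x => h' (g x) * E1 i x),
    (fun i j x => (h'' (g x) * E1 j x) * E1 i x + h' (g x) * E2 i j x).
  repeat split; intros; auto.
  - apply (has_partial_comp h); auto. apply Hh; auto.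
  - apply cont_on_mult; auto.
  - apply (has_partial_mult (fun y => h' (g y)) (E1 i)); auto.
    apply (has_partial_comp h'); auto. apply Hh; auto.
  - apply cont_on_plus; repeat apply cont_on_mult; auto.
  - congruence.
  - rewrite Vg, Gg; auto.
  - rewrite Vg, !Gg, Hg; auto.
Qed.

Lemma Jet_rsum (m : nat) {f : nat -> (nat -> R) -> R} {f0 f1 f2} :
  (forall i, (i < m)%nat -> Jet k r (f i) (f0 i) (f1 i) (f2 i)) ->
  Jet k r (fun y => rsum m (fun i => f i y)) (rsum m f0) (fun a => rsum m (fun i => f1 i a))
    (fun a b => rsum m (fun i => f2 i a b)).
Proof.
  induction m as [|m IH]; intros Hf; simpl; [apply Jet_const|].
  exact (Jet_plus (IH (fun i Hi => Hf i (Nat.lt_lt_succ_r _ _ Hi)))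
           (Hf m (Nat.lt_succ_diag_r m))).
Qed.

Lemma Jet_IsC2 {f f0 f1 f2} : Jet k r f f0 f1 f2 -> IsC2 k r f.
Proof. intros [D1 [D2 [HC2 _]]]. exists D1, D2. exact HC2. Qed.

Lemma Jet_GradHess {f f0 f1 f2} : 0 < r -> Jet k r f f0 f1 f2 -> GradHessAt0 k f f1 f2.
Proof. intros Hr [D1 [D2 [HC2 [_ [Hgrad Hhess]]]]]. exists r, D1, D2. auto. Qed.

Lemma Jet_partial {f f0 f1 f2} {j : nat} : 0 < r -> (j < k)%nat ->
  Jet k r f f0 f1 f2 -> has_partial f j zerov (f1 j).
Proof.
  intros Hr Hj [D1 [D2 [[_ [Hpart _]] [_ [Hgrad _]]]]]. rewrite <- Hgrad by auto.
  apply Hpart; auto. apply InBox_zerov; auto.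
Qed.

Lemma Jet1_ext (f g : (nat -> R) -> R) {f0 f1} :
  0 < r -> (forall y, InBox k r y -> f y = g y) -> Jet1 k r g f0 f1 -> Jet1 k r f f0 f1.
Proof. intros Hr Hfg [f2 Hg]. exists f2. apply (Jet_ext f g); auto. Qed.

Lemma Jet1_val {f f0 f1 f0' f1'} :
  Jet1 k r f f0 f1 -> f0 = f0' -> (forall i, (i < k)%nat -> f1 i = f1' i) -> Jet1 k r f f0' f1'.
Proof. intros [f2 Hf] E0 E1. exists f2. eapply Jet_val; eauto. Qed.

Lemma Jet1_const (c : R) : Jet1 k r (fun _ => c) c (fun _ => 0).
Proof. eexists. apply Jet_const. Qed.

Lemma Jet1_coord (i : nat) : Jet1 k r (fun y => y i) 0 (fun j => unitv j i).
Proof.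
  exists (fun _ _ => 0), (fun j _ => unitv j i), (fun _ _ _ => 0). repeat split; auto; intros;
    first [apply cont_on_const | apply cont_on_coord | apply has_partial_const
          | apply has_partial_coord].
Qed.

Lemma Jet1_plus {f f0 f1 g g0 g1} : Jet1 k r f f0 f1 -> Jet1 k r g g0 g1 ->
  Jet1 k r (fun y => f y + g y) (f0 + g0) (fun i => f1 i + g1 i).
Proof. intros [f2 Hf] [g2 Hg]. eexists. exact (Jet_plus Hf Hg). Qed.

Lemma Jet1_minus {f f0 f1 g g0 g1} : Jet1 k r f f0 f1 -> Jet1 k r g g0 g1 ->
  Jet1 k r (fun y => f y - g y) (f0 - g0) (fun i => f1 i - g1 i).
Proof. intros [f2 Hf] [g2 Hg]. eexists. exact (Jet_minus Hf Hg). Qed.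

Lemma Jet1_mult {f f0 f1 g g0 g1} : Jet1 k r f f0 f1 -> Jet1 k r g g0 g1 ->
  Jet1 k r (fun y => f y * g y) (f0 * g0) (fun i => f1 i * g0 + f0 * g1 i).
Proof. intros [f2 Hf] [g2 Hg]. eexists. exact (Jet_mult Hf Hg). Qed.

Lemma Jet1_scal (c : R) {f f0 f1} :
  Jet1 k r f f0 f1 -> Jet1 k r (fun y => c * f y) (c * f0) (fun i => c * f1 i).
Proof. intros [f2 Hf]. eexists. exact (Jet_scal c Hf). Qed.

Lemma Jet1_rsum (m : nat) {f : nat -> (nat -> R) -> R} {f0 f1} :
  (forall i, (i < m)%nat -> Jet1 k r (f i) (f0 i) (f1 i)) ->
  Jet1 k r (fun y => rsum m (fun i => f i y)) (rsum m f0) (fun a => rsum m (fun i => f1 i a)).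
Proof.
  induction m as [|m IH]; intros Hf; simpl; [apply Jet1_const|].
  apply (Jet1_plus (IH (fun i Hi => Hf i (Nat.lt_lt_succ_r _ _ Hi)))
           (Hf m (Nat.lt_succ_diag_r m))).
Qed.

Lemma Jet1_comp (h h' h'' : R -> R) {g g0 g1} : Jet1 k r g g0 g1 ->
  (forall x, InBox k r x -> is_derive h (g x) (h' (g x)) /\
     is_derive h' (g x) (h'' (g x)) /\ ex_derive h'' (g x)) ->
  Jet1 k r (fun y => h (g y)) (h g0) (fun i => h' g0 * g1 i).
Proof.
  intros [g2 Hg] Hh. eexists. apply (Jet_comp h h' h'' Hg).
  intros x Hx. destruct (Hh x Hx) as [Hd [Hd' Hd'']].
  split; [|split]; [apply is_derive_Reals; auto|apply is_derive_Reals; auto|].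
  apply continuity_pt_filterlim, (ex_derive_continuous h'' _ Hd'').
Qed.

Lemma Jet1_cos {g g0 g1} : Jet1 k r g g0 g1 ->
  Jet1 k r (fun y => cos (g y)) (cos g0) (fun i => - sin g0 * g1 i).
Proof.
  intros Hg. apply (Jet1_comp (fun z => cos z) (fun z => - sin z) (fun z => - cos z) Hg).
  intros x _. split; [|split]; auto_derive; auto; ring.
Qed.

Lemma Jet1_sin {g g0 g1} : Jet1 k r g g0 g1 ->
  Jet1 k r (fun y => sin (g y)) (sin g0) (fun i => cos g0 * g1 i).
Proof.
  intros Hg. apply (Jet1_comp (fun z => sin z) (fun z => cos z) (fun z => - sin z) Hg).
  intros x _. split; [|split]; auto_derive; auto; ring.
Qed.

Lemma Jet1_inv {g g0 g1} : Jet1 k r g g0 g1 -> (forall x, InBox k r x -> g x <> 0) ->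
  Jet1 k r (fun y => / g y) (/ g0) (fun i => - / g0 ^ 2 * g1 i).
Proof.
  intros Hg Hne. apply (Jet1_comp (fun z => / z) (fun z => - / z ^ 2) (fun z => 2 / z ^ 3) Hg).
  intros x Hx. specialize (Hne x Hx).
  assert (g x ^ 2 <> 0) by (apply pow_nonzero; auto).
  split; [|split]; auto_derive; auto using pow_nonzero; field; auto.
Qed.

Lemma Jet1_sqrt {g g0 g1} : Jet1 k r g g0 g1 -> (forall x, InBox k r x -> 0 < g x) ->
  Jet1 k r (fun y => sqrt (g y)) (sqrt g0) (fun i => / (2 * sqrt g0) * g1 i).
Proof.
  intros Hg Hpos.
  apply (Jet1_comp (fun z => sqrt z) (fun z => / (2 * sqrt z)) (fun z => - / (4 * sqrt z ^ 3)) Hg).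
  intros x Hx. specialize (Hpos x Hx).
  pose proof (sqrt_lt_R0 _ Hpos) as Hs.
  assert (4 * sqrt (g x) ^ 3 <> 0) by (pose proof (pow_lt (sqrt (g x)) 3 Hs); lra).
  split; [|split]; auto_derive; repeat split; try lra; field; lra.
Qed.

Lemma Jet1_near_0 {f f0 f1} : 0 < r -> Jet1 k r f f0 f1 ->
  filterlim f (within (InBox k r) (coord_nbhd k zerov)) (locally f0).
Proof.
  intros Hr [f2 [D1 [D2 [[Hcont _] [<- _]]]]].
  apply cont_on_filterlim; auto. apply InBox_zerov, Hr.
Qed.

Lemma Jet1_value {f f0 f1} : Jet1 k r f f0 f1 -> f zerov = f0.
Proof. intros [f2 [D1 [D2 [_ [Hval _]]]]]. exact Hval. Qed.

Lemma Jet1_unique {f f0 f1 g0 g1} {j : nat} : 0 < r -> (j < k)%nat ->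
  Jet1 k r f f0 f1 -> Jet1 k r f g0 g1 -> f1 j = g1 j.
Proof.
  intros Hr Hj [f2 Hf] [g2 Hg].
  apply (uniqueness_limite (fun t => f (shiftk zerov j t)) 0).
  - exact (Jet_partial Hr Hj Hf).
  - exact (Jet_partial Hr Hj Hg).
Qed.

End JetCalculus.

Lemma Jet1_le (k : nat) (r r' : R) f f0 f1 : r' <= r -> Jet1 k r f f0 f1 -> Jet1 k r' f f0 f1.
Proof.
  intros Hr [f2 [D1 [D2 [[Cf [Pf [CD [PD CD2]]]] Hat0]]]].
  assert (Hcont : forall g, cont_on k r g -> cont_on k r' g).
  { intros g Hg x Hx eps Heps.
    destruct (Hg x (InBox_le k r r' x Hr Hx) eps Heps) as [d [Hd Hclose]].
    exists d. split; auto. intros y Hy. apply Hclose, (InBox_le k r r'); auto. }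
  exists f2, D1, D2. split; auto. repeat split; auto; intros.
  - apply Pf; auto. apply (InBox_le k r r'); auto.
  - apply PD; auto. apply (InBox_le k r r'); auto.
Qed.

Lemma InBox_near_0 (k : nat) (r : R) (P : (nat -> R) -> Prop) : 0 < r ->
  within (InBox k r) (coord_nbhd k zerov) P ->
  exists r', 0 < r' <= r /\ forall x, InBox k r' x -> P x.
Proof.
  intros Hr [d [Hd HP]]. exists (Rmin r d).
  split; [split; [apply Rmin_pos; auto|apply Rmin_l]|].
  intros x Hx. apply HP.
  - intros i Hi. destruct Hx as [_ Hx]. specialize (Hx i Hi).
    unfold zerov. rewrite Rminus_0_r. pose proof (Rmin_r r d). lra.
  - apply (InBox_le k r (Rmin r d)); auto using Rmin_l.
Qed.

(** * Points of the plane *)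

Definition padd (a b : pt) : pt := (fst a + fst b, snd a + snd b).
Definition pscal (c : R) (a : pt) : pt := (c * fst a, c * snd a).
Definition rot90 (a : pt) : pt := (- snd a, fst a).
Definition rot (t : R) (a : pt) : pt := padd (pscal (cos t) a) (pscal (sin t) (rot90 a)).
Definition psum (m : nat) (f : nat -> pt) : pt :=
  (rsum m (fun i => fst (f i)), rsum m (fun i => snd (f i))).

Ltac pt_simpl := unfold rot, dot, cross, padd, pscal, rot90, psub in *; cbn [fst snd] in *.
Ltac pt_ring := intros; try apply injective_projections; pt_simpl; ring.

Lemma psum_ext (m : nat) (f g : nat -> pt) :
  (forall i, (i < m)%nat -> f i = g i) -> psum m f = psum m g.
Proof.
  intros Hfg. unfold psum. f_equal; apply rsum_ext; intros i Hi; rewrite Hfg by auto; auto.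
Qed.

Lemma psum_S (m : nat) (f : nat -> pt) : psum (S m) f = padd (psum m f) (f m).
Proof. reflexivity. Qed.

Lemma psum_app (a b : nat) (f : nat -> pt) :
  psum (a + b) f = padd (psum a f) (psum b (fun i => f (a + i)%nat)).
Proof. unfold psum, padd. cbn [fst snd]. now rewrite !rsum_app. Qed.

Lemma dot_self_pos (a b : pt) : cross a b <> 0 -> 0 < dot a a.
Proof.
  intros Hab. destruct (Req_dec (dot a a) 0) as [Ha|Ha]; [|unfold dot in *; nra].
  exfalso. apply Hab. unfold dot, cross in *.
  assert (fst a = 0) by nra. assert (snd a = 0) by nra. nra.
Qed.

Lemma cross_antisym (a b : pt) : cross a b = - cross b a.
Proof. pt_ring. Qed.

Lemma dot_sqr_add_cross_sqr (a b : pt) :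
  dot a b * dot a b + cross a b * cross a b = dot a a * dot b b.
Proof. pt_ring. Qed.

Lemma dot_psub_sym (a b : pt) : dot (psub a b) (psub a b) = dot (psub b a) (psub b a).
Proof. pt_ring. Qed.

Lemma dist_eq_sqr (a b : pt) (l : R) : 0 < l ->
  (dist a b = l <-> dot (psub a b) (psub a b) = l * l).
Proof.
  intros Hl. unfold dist, norm.
  assert (Hnonneg : 0 <= dot (psub a b) (psub a b)) by (unfold dot; nra).
  split; intros Hdist.
  - rewrite <- Hdist. symmetry. apply sqrt_sqrt; auto.
  - rewrite Hdist. apply sqrt_square; lra.
Qed.

Lemma dist_coords (a b : pt) (eps : R) : dist a b < eps ->
  Rabs (fst a - fst b) < eps /\ Rabs (snd a - snd b) < eps.
Proof.
  unfold dist, norm, dot, psub; simpl. set (x := fst a - fst b). set (y := snd a - snd b).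
  intros Hdist. split; eapply Rle_lt_trans; try exact Hdist.
  - rewrite <- (sqrt_Rsqr_abs x). apply sqrt_le_1_alt. unfold Rsqr. nra.
  - rewrite <- (sqrt_Rsqr_abs y). apply sqrt_le_1_alt. unfold Rsqr. nra.
Qed.

Lemma dot_cross_decomposition (a b : pt) : dot a a <> 0 ->
  b = padd (pscal (dot a b / dot a a) a) (pscal (cross a b / dot a a) (rot90 a)).
Proof. intros Ha. apply injective_projections; pt_simpl; field; auto. Qed.

Lemma orthogonal_rot90 (a b : pt) : dot a a <> 0 -> dot a b = 0 ->
  b = pscal (cross a b / dot a a) (rot90 a).
Proof.
  intros Ha Hab. rewrite (dot_cross_decomposition a b) at 1 by auto.
  rewrite Hab. apply injective_projections; pt_simpl; field; auto.
Qed.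

Lemma orthogonal_to_basis (a b v : pt) :
  cross a b <> 0 -> dot a v = 0 -> dot b v = 0 -> v = (0, 0).
Proof.
  intros Hab Hav Hbv.
  apply injective_projections; cbn [fst snd]; apply (Rmult_eq_reg_l (cross a b)); auto.
  - transitivity (snd b * dot a v - snd a * dot b v); [pt_ring|]. rewrite Hav, Hbv. ring.
  - transitivity (fst a * dot b v - fst b * dot a v); [pt_ring|]. rewrite Hav, Hbv. ring.
Qed.

Lemma rot_0 (a : pt) : rot 0 a = a.
Proof. unfold rot. rewrite cos_0, sin_0. pt_ring. Qed.

Lemma rot_add (s t : R) (a : pt) : rot s (rot t a) = rot (s + t) a.
Proof. unfold rot. rewrite cos_plus, sin_plus. pt_ring. Qed.

Lemma dot_rot (t : R) (a : pt) : dot (rot t a) (rot t a) = dot a a.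
Proof.
  pose proof (sin2_cos2 t) as Htrig. unfold Rsqr in Htrig.
  transitivity ((sin t * sin t + cos t * cos t) * dot a a); [pt_ring|]. rewrite Htrig. ring.
Qed.

Lemma rot_unique (a b : pt) (q t : R) : q <> 0 ->
  dot a a = q -> cos t * q = dot a b -> sin t * q = cross a b -> b = rot t a.
Proof.
  intros Hq Ha Hcos Hsin. rewrite (dot_cross_decomposition a b) by (rewrite Ha; auto).
  rewrite Ha, <- Hcos, <- Hsin. unfold rot. f_equal; f_equal; field; auto.
Qed.

Lemma rot_asin (a b : pt) (q : R) :
  0 < q -> dot a a = q -> dot b b = q -> 0 < dot a b -> b = rot (asin (cross a b / q)) a.
Proof.
  intros Hq Ha Hb Hab.
  pose proof (dot_sqr_add_cross_sqr a b) as Hlagrange. rewrite Ha, Hb in Hlagrange.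
  set (s := cross a b / q). set (c := dot a b / q).
  assert (Hc : 0 < c) by (apply Rdiv_lt_0_compat; auto).
  assert (Hsc : s * s + c * c = 1).
  { unfold s, c. transitivity ((dot a b * dot a b + cross a b * cross a b) / (q * q)).
    - field; lra.
    - rewrite Hlagrange. field; lra. }
  assert (Hs : -1 <= s <= 1) by nra.
  apply (rot_unique a b q); auto; [lra| |].
  - rewrite cos_asin by auto. replace (1 - s²) with (c * c) by (unfold Rsqr; lra).
    rewrite sqrt_square by lra. unfold c. field. lra.
  - rewrite sin_asin by auto. unfold s. field. lra.
Qed.

Lemma rot_fixed (t : R) (a : pt) : 0 < dot a a -> rot t a = a -> cos t = 1.
Proof.
  intros Ha Hrot. apply (Rmult_eq_reg_r (dot a a)); [|lra].
  transitivity (dot a (rot t a)); [pt_ring|]. rewrite Hrot. ring.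
Qed.

(** * Cyclic sequences of points *)

Lemma nxt_lt (n i : nat) : (0 < n)%nat -> (nxt n i < n)%nat.
Proof. intros Hn. apply Nat.mod_upper_bound. lia. Qed.

Lemma nxt_mod (n i : nat) : nxt n i = (S i mod n)%nat.
Proof. unfold nxt. now rewrite Nat.add_1_r. Qed.

Lemma nxt_small (n i : nat) : (S i < n)%nat -> nxt n i = S i.
Proof. intros Hi. rewrite nxt_mod. now apply Nat.mod_small. Qed.

Lemma rsum_differences (n i : nat) (f : nat -> R) : (i <= n)%nat ->
  rsum i (fun m => f (nxt n m) - f m) = f (i mod n)%nat - f 0%nat.
Proof.
  induction i as [|i IH]; intros Hi; simpl rsum.
  - rewrite Nat.Div0.mod_0_l. lra.
  - rewrite IH, nxt_mod, (Nat.mod_small i n) by lia. lra.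
Qed.

Lemma rsum_coboundary (n : nat) (g f : nat -> R) :
  (forall k, (k < n)%nat -> f k = g (nxt n k) - g k) -> rsum n f = 0.
Proof.
  intros Hf. rewrite (rsum_ext n f _ Hf), rsum_differences, Nat.Div0.mod_same by lia. ring.
Qed.

Lemma rsum_nxt (n : nat) (d : nat -> R) : rsum n d = 0 ->
  forall k, (k < n)%nat -> rsum (nxt n k) d = rsum k d + d k.
Proof.
  intros Hd k Hk. destruct (Nat.eq_dec (S k) n) as [<-|Hne].
  - rewrite nxt_mod, Nat.Div0.mod_same. exact (eq_sym Hd).
  - rewrite nxt_small by lia. reflexivity.
Qed.

Definition edge (n : nat) (V : nat -> pt) (m : nat) : pt := psub (V (nxt n m)) (V m).

Lemma edge_psub_const (n : nat) (V : nat -> pt) (z : pt) (m : nat) :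
  edge n (fun i => psub (V i) z) m = edge n V m.
Proof. unfold edge. pt_ring. Qed.

Lemma psum_edges (n i : nat) (V : nat -> pt) : (i <= n)%nat ->
  psum i (edge n V) = psub (V (i mod n)%nat) (V 0%nat).
Proof.
  intros Hi. unfold psum, psub. f_equal.
  - exact (rsum_differences n i (fun m => fst (V m)) Hi).
  - exact (rsum_differences n i (fun m => snd (V m)) Hi).
Qed.

Lemma vertices_of_partial_edges (n p : nat) (V E : nat -> pt) : (p + 2 <= n)%nat ->
  V 0%nat = (0, 0) ->
  (forall m, (m < n)%nat -> m <> p -> m <> S p -> E m = edge n V m) ->
  (forall i, (i <= p)%nat -> psum i E = V i) /\
  (forall i, (p + 2 <= i <= n)%nat -> psub (psum i E) (psum n E) = V (i mod n)%nat).
Proof.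
  intros Hp HV0 HE. split.
  - intros i Hi. rewrite (psum_ext i E (edge n V)) by (intros; apply HE; lia).
    rewrite psum_edges, HV0, Nat.mod_small by lia. pt_ring.
  - intros i Hi.
    pose proof (psum_edges n i V ltac:(lia)) as Hhead.
    pose proof (psum_edges n n V (le_n n)) as Htotal.
    rewrite Nat.Div0.mod_same, HV0 in Htotal. rewrite HV0 in Hhead.
    replace n with (i + (n - i))%nat in Htotal at 1 by lia.
    replace n with (i + (n - i))%nat at 1 by lia.
    rewrite psum_app in Htotal |- *.
    rewrite (psum_ext (n - i) (fun m => E (i + m)%nat) (fun m => edge n V (i + m)%nat))
      by (intros; apply HE; lia).
    rewrite Hhead in Htotal. revert Htotal.
    generalize (psum (n - i) (fun m => edge n V (i + m)%nat)) (psum i E) (V (i mod n)%nat).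
    intros tail head v Htotal. pt_simpl. injection Htotal as Hfst Hsnd.
    apply injective_projections; cbn [fst snd]; lra.
Qed.

(** * The third vertex of a triangle *)

Definition foot (p q : R) (d : pt) : R := / 2 + (p * p - q * q) / 2 * / dot d d.
Definition height_sqr (p q : R) (d : pt) : R := p * p * / dot d d - foot p q d * foot p q d.

(* The point at distance [p] from [0] and [q] from [d], on the side of [d] given by the sign. *)
Definition apex (sg p q : R) (d : pt) : pt :=
  padd (pscal (foot p q d) d) (pscal (sg * sqrt (height_sqr p q d)) (rot90 d)).

Lemma apex_sides (sg p q : R) (d : pt) :
  sg * sg = 1 -> 0 < dot d d -> 0 <= height_sqr p q d ->
  dot (apex sg p q d) (apex sg p q d) = p * p /\
  dot (psub d (apex sg p q d)) (psub d (apex sg p q d)) = q * q.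
Proof.
  intros Hsg Hd Hh. unfold apex.
  assert (Hheight : sg * sqrt (height_sqr p q d) * (sg * sqrt (height_sqr p q d))
                    = height_sqr p q d).
  { transitivity ((sg * sg) * (sqrt (height_sqr p q d) * sqrt (height_sqr p q d))); [ring|].
    rewrite Hsg, sqrt_sqrt by auto. ring. }
  set (h := sg * sqrt (height_sqr p q d)) in *. set (f := foot p q d) in *.
  assert (Hp : (f * f + h * h) * dot d d = p * p).
  { rewrite Hheight. unfold height_sqr. fold f. field. lra. }
  split.
  - rewrite <- Hp. pt_ring.
  - transitivity ((f * f + h * h) * dot d d + (1 - 2 * f) * dot d d); [pt_ring|].
    rewrite Hp. unfold f, foot. field. lra.
Qed.

Lemma apex_unique (sg p q : R) (d v : pt) :
  sg * sg = 1 -> dot v v = p * p -> dot (psub d v) (psub d v) = q * q -> 0 < sg * cross d v ->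
  0 < dot d d /\ 0 < height_sqr p q d /\ v = apex sg p q d.
Proof.
  intros Hsg Hp Hq Hside.
  assert (Hd : 0 < dot d d) by (apply (dot_self_pos d v); intros E; rewrite E in Hside; lra).
  assert (Hfoot : foot p q d = dot d v / dot d d).
  { unfold foot. rewrite <- Hp, <- Hq.
    replace (dot (psub d v) (psub d v)) with (dot d d - 2 * dot d v + dot v v) by pt_ring.
    field. lra. }
  set (h := sg * cross d v / dot d d).
  assert (Hh : 0 < h) by (apply Rdiv_lt_0_compat; auto).
  assert (Hheight : height_sqr p q d = h * h).
  { unfold height_sqr. rewrite Hfoot, <- Hp. unfold h.
    transitivity ((dot d d * dot v v - dot d v * dot d v) / (dot d d * dot d d)); [field; lra|].
    rewrite <- dot_sqr_add_cross_sqr.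
    transitivity (sg * sg * (cross d v * cross d v) / (dot d d * dot d d)); [|field; lra].
    rewrite Hsg. field. lra. }
  rewrite Hheight. split; [auto|split; [nra|]].
  unfold apex. rewrite Hheight, sqrt_square, Hfoot by lra.
  rewrite (dot_cross_decomposition d v) at 1 by lra. f_equal. f_equal.
  unfold h. transitivity (sg * sg * cross d v / dot d d); [rewrite Hsg|]; field; lra.
Qed.

(** * Jets of plane curves *)

Definition PtJet1 (k : nat) (r : R) (f : (nat -> R) -> pt) (f0 : pt) (f1 : nat -> pt) : Prop :=
  Jet1 k r (fun x => fst (f x)) (fst f0) (fun j => fst (f1 j)) /\
  Jet1 k r (fun x => snd (f x)) (snd f0) (fun j => snd (f1 j)).

Section PtJetCalculus.
Context {k : nat} {r : R}.

Lemma PtJet1_ext (f g : (nat -> R) -> pt) {f0 f1} : 0 < r ->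
  (forall x, InBox k r x -> f x = g x) -> PtJet1 k r g f0 f1 -> PtJet1 k r f f0 f1.
Proof.
  intros Hr Hfg [Hfst Hsnd]. split.
  - eapply Jet1_ext; [auto| |exact Hfst]. intros x Hx. cbv beta. now rewrite Hfg.
  - eapply Jet1_ext; [auto| |exact Hsnd]. intros x Hx. cbv beta. now rewrite Hfg.
Qed.

Lemma PtJet1_val {f f0 f1 f0' f1'} : PtJet1 k r f f0 f1 -> f0 = f0' ->
  (forall j, (j < k)%nat -> f1 j = f1' j) -> PtJet1 k r f f0' f1'.
Proof.
  intros [Hfst Hsnd] E0 E1.
  split; (eapply Jet1_val; [eassumption|congruence|]); intros j Hj; cbv beta; now rewrite E1.
Qed.

Lemma PtJet1_const (a : pt) : PtJet1 k r (fun _ => a) a (fun _ => (0, 0)).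
Proof. split; apply Jet1_const. Qed.

Lemma PtJet1_padd {f f0 f1 g g0 g1} : PtJet1 k r f f0 f1 -> PtJet1 k r g g0 g1 ->
  PtJet1 k r (fun x => padd (f x) (g x)) (padd f0 g0) (fun j => padd (f1 j) (g1 j)).
Proof. intros [Hf Hf'] [Hg Hg']. split; [exact (Jet1_plus Hf Hg)|exact (Jet1_plus Hf' Hg')]. Qed.

Lemma PtJet1_psub {f f0 f1 g g0 g1} : PtJet1 k r f f0 f1 -> PtJet1 k r g g0 g1 ->
  PtJet1 k r (fun x => psub (f x) (g x)) (psub f0 g0) (fun j => psub (f1 j) (g1 j)).
Proof. intros [Hf Hf'] [Hg Hg']. split; [exact (Jet1_minus Hf Hg)|exact (Jet1_minus Hf' Hg')]. Qed.

Lemma PtJet1_rot90 {f f0 f1} : PtJet1 k r f f0 f1 ->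
  PtJet1 k r (fun x => rot90 (f x)) (rot90 f0) (fun j => rot90 (f1 j)).
Proof.
  intros [Hfst Hsnd]. split; [|exact Hfst]. unfold rot90; cbn [fst].
  replace (fun x => - snd (f x)) with (fun x => -1 * snd (f x))
    by (apply functional_extensionality; intros; ring).
  apply (Jet1_val (Jet1_scal (-1) Hsnd)); intros; ring.
Qed.

Lemma PtJet1_pscal {c c0 c1 f f0 f1} : Jet1 k r c c0 c1 -> PtJet1 k r f f0 f1 ->
  PtJet1 k r (fun x => pscal (c x) (f x)) (pscal c0 f0)
    (fun j => padd (pscal (c1 j) f0) (pscal c0 (f1 j))).
Proof. intros Hc [Hf Hf']. split; [exact (Jet1_mult Hc Hf)|exact (Jet1_mult Hc Hf')]. Qed.

Lemma Jet1_dot {f f0 f1 g g0 g1} : PtJet1 k r f f0 f1 -> PtJet1 k r g g0 g1 ->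
  Jet1 k r (fun x => dot (f x) (g x)) (dot f0 g0) (fun j => dot (f1 j) g0 + dot f0 (g1 j)).
Proof.
  intros [Hf Hf'] [Hg Hg'].
  apply (Jet1_val (Jet1_plus (Jet1_mult Hf Hg) (Jet1_mult Hf' Hg'))); pt_ring.
Qed.

Lemma PtJet1_psum (m : nat) {f : nat -> (nat -> R) -> pt} {f0 f1} :
  (forall i, (i < m)%nat -> PtJet1 k r (f i) (f0 i) (f1 i)) ->
  PtJet1 k r (fun x => psum m (fun i => f i x)) (psum m f0) (fun j => psum m (fun i => f1 i j)).
Proof.
  intros Hf. split; apply (Jet1_rsum m); intros i Hi; apply (Hf i Hi).
Qed.

Lemma PtJet1_rot {t t1} (a : pt) : Jet1 k r t 0 t1 ->
  PtJet1 k r (fun x => rot (t x) a) a (fun j => pscal (t1 j) (rot90 a)).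
Proof.
  intros Ht.
  apply (PtJet1_val (PtJet1_padd (PtJet1_pscal (Jet1_cos Ht) (PtJet1_const a))
                       (PtJet1_pscal (Jet1_sin Ht) (PtJet1_const (rot90 a))))).
  - apply rot_0.
  - intros j Hj. rewrite cos_0, sin_0. pt_ring.
Qed.

Lemma PtJet1_value {f f0 f1} : PtJet1 k r f f0 f1 -> f zerov = f0.
Proof.
  intros [Hfst Hsnd]. apply Jet1_value in Hfst, Hsnd. now apply injective_projections.
Qed.

Lemma PtJet1_constant_length {f f0 f1} (q : R) (j : nat) : 0 < r -> (j < k)%nat ->
  PtJet1 k r f f0 f1 -> (forall x, InBox k r x -> dot (f x) (f x) = q) -> dot f0 (f1 j) = 0.
Proof.
  intros Hr Hj Hf Hconst.
  pose proof (Jet1_unique Hr Hj (Jet1_dot Hf Hf)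
                (Jet1_ext _ (fun _ => q) Hr Hconst (Jet1_const q))) as Hgrad.
  cbv beta in Hgrad. pt_simpl. lra.
Qed.

End PtJetCalculus.

Lemma PtJet1_le {k : nat} {r r' : R} {f f0 f1} : r' <= r ->
  PtJet1 k r f f0 f1 -> PtJet1 k r' f f0 f1.
Proof. intros Hr [Hfst Hsnd]. split; apply (Jet1_le k r r'); auto. Qed.

Lemma Jet1_height_sqr {k : nat} {r : R} (p q : R) {d d0 d1} : PtJet1 k r d d0 d1 ->
  (forall x, InBox k r x -> 0 < dot (d x) (d x)) ->
  exists f1 h1, Jet1 k r (fun x => foot p q (d x)) (foot p q d0) f1 /\
    Jet1 k r (fun x => height_sqr p q (d x)) (height_sqr p q d0) h1.
Proof.
  intros Hd Hpos.
  assert (Hinv := Jet1_inv (Jet1_dot Hd Hd) (fun x Hx => Rgt_not_eq _ _ (Hpos x Hx))).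
  assert (Hfoot := Jet1_plus (Jet1_const (/ 2)) (Jet1_scal ((p * p - q * q) / 2) Hinv)).
  do 2 eexists. split; [exact Hfoot|].
  exact (Jet1_minus (Jet1_scal (p * p) Hinv) (Jet1_mult Hfoot Hfoot)).
Qed.

Lemma PtJet1_apex {k : nat} {r : R} (sg p q : R) {d d0 d1} : 0 < r -> PtJet1 k r d d0 d1 ->
  0 < dot d0 d0 -> 0 < height_sqr p q d0 ->
  exists r' a1, 0 < r' <= r /\
    (forall x, InBox k r' x -> 0 < dot (d x) (d x) /\ 0 < height_sqr p q (d x)) /\
    PtJet1 k r' (fun x => apex sg p q (d x)) (apex sg p q d0) a1.
Proof.
  intros Hr Hd Hd0 Hh0.
  destruct (InBox_near_0 k r (fun x => 0 < dot (d x) (d x)) Hr) as [r1 [Hr1 Hpos]].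
  { exact (filterlim_eventually_gt _ _ _ (Jet1_near_0 Hr (Jet1_dot Hd Hd)) Hd0). }
  destruct (Jet1_height_sqr p q (PtJet1_le (proj2 Hr1) Hd) Hpos) as [f1 [h1 [_ Hheight]]].
  destruct (InBox_near_0 k r1 (fun x => 0 < height_sqr p q (d x)) (proj1 Hr1))
    as [r2 [Hr2 Hheight_pos]].
  { exact (filterlim_eventually_gt _ _ _ (Jet1_near_0 (proj1 Hr1) Hheight) Hh0). }
  assert (Hpos2 : forall x, InBox k r2 x -> 0 < dot (d x) (d x))
    by (intros x Hx; apply Hpos, (InBox_le k r1 r2); tauto).
  apply (PtJet1_le (r' := r2)) in Hd; [|lra].
  destruct (Jet1_height_sqr p q Hd Hpos2) as [f2 [h2 [Hfoot2 Hheight2]]].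
  exists r2. eexists. split; [lra|]. split; [auto|].
  exact (PtJet1_padd (PtJet1_pscal Hfoot2 Hd)
           (PtJet1_pscal (Jet1_scal sg (Jet1_sqrt Hheight2 Hheight_pos)) (PtJet1_rot90 Hd))).
Qed.

(** * A chart of the polygon space *)

Definition positive_lengths (n : nat) (l : nat -> R) : Prop := forall i, (i < n)%nat -> 0 < l i.

Definition normalized_tangent (n : nat) (P V : nat -> pt) : Prop :=
  V 0%nat = (0, 0) /\ V 1%nat = (0, 0) /\
  forall m, (m < n)%nat -> dot (edge n P m) (edge n V m) = 0.

Definition independent (n k : nat) (T : nat -> nat -> pt) : Prop :=
  forall c : nat -> R,
    (forall i, (i < n)%nat -> psum k (fun j => pscal (c j) (T j i)) = (0, 0)) ->
    forall j, (j < k)%nat -> c j = 0.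

Lemma InL_edge_sqr (n : nat) (l : nat -> R) (P : nat -> pt) :
  positive_lengths n l -> InL n l P ->
  forall m, (m < n)%nat -> dot (edge n P m) (edge n P m) = l m * l m.
Proof.
  intros Hl [_ [_ Hdist]] m Hm. unfold edge. rewrite dot_psub_sym. apply dist_eq_sqr; auto.
Qed.

Section Chart.
Variables (n : nat) (l : nat -> R) (P : nat -> pt) (p : nat) (T : nat -> nat -> pt).
Let k := (n - 3)%nat.
Let e := edge n P.

Hypothesis Hl : positive_lengths n l.
Hypothesis HP : InL n l P.
Hypothesis Hp : (1 <= p)%nat /\ (p + 2 <= n)%nat.
Hypothesis Hcross : cross (e p) (e (S p)) <> 0.
Hypothesis HT : forall j, (j < k)%nat -> normalized_tangent n P (T j).
Hypothesis Hindep : independent n k T.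

(* All edges but [p] and [S p] are rotated by angles linear in [x]; these two close the polygon. *)
Let rate (j m : nat) : R := cross (e m) (edge n (T j) m) / dot (e m) (e m).
Let turn (m : nat) (x : nat -> R) : R := rsum k (fun j => x j * rate j m).
Let turned (x : nat -> R) (m : nat) : pt := rot (turn m x) (e m).
Let vertex (i : nat) (x : nat -> R) : pt := psum i (turned x).
Let base (x : nat -> R) : pt := psub (psub (vertex (p + 2) x) (vertex n x)) (vertex p x).
Let sg : R := if Rlt_dec 0 (cross (e (S p)) (e p)) then 1 else -1.

Definition chart_map (x : nat -> R) (i : nat) : pt :=
  if Nat.leb i p then vertex i x
  else if Nat.eqb i (S p) then padd (vertex p x) (apex sg (l p) (l (S p)) (base x))
  else psub (vertex i x) (vertex n x).

Lemma chart_edge_pos (m : nat) : (m < n)%nat -> 0 < dot (e m) (e m).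
Proof.
  intros Hm. unfold e. rewrite (InL_edge_sqr n l P) by auto. specialize (Hl m Hm). nra.
Qed.

Lemma tangent_edge (j m : nat) : (j < k)%nat -> (m < n)%nat ->
  edge n (T j) m = pscal (rate j m) (rot90 (e m)).
Proof.
  intros Hj Hm. apply orthogonal_rot90.
  - pose proof (chart_edge_pos m Hm). lra.
  - apply HT; auto.
Qed.

Lemma turn_0 (x : nat -> R) : turn 0 x = 0.
Proof.
  apply rsum_zero. intros j Hj. destruct (HT j Hj) as [HT0 [HT1 _]].
  unfold rate, edge. rewrite (nxt_small n 0), HT0, HT1 by lia.
  unfold cross, psub, Rdiv; simpl. ring.
Qed.

Lemma chart_sign_sqr : sg * sg = 1.
Proof. unfold sg. destruct (Rlt_dec 0 _); ring. Qed.

Lemma chart_sign_cross : 0 < sg * cross (e (S p)) (e p).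
Proof.
  pose proof (cross_antisym (e (S p)) (e p)).
  unfold sg. destruct (Rlt_dec 0 (cross (e (S p)) (e p))); lra.
Qed.

Lemma third_vertex (Q : nat -> pt) : InL n l Q ->
  0 < sg * cross (edge n Q (S p)) (edge n Q p) ->
  let d := psub (Q (nxt n (S p))) (Q p) in
  0 < dot d d /\ 0 < height_sqr (l p) (l (S p)) d /\
  edge n Q p = apex sg (l p) (l (S p)) d.
Proof.
  intros HQ Hside d.
  assert (Hsum : psub d (edge n Q p) = edge n Q (S p)).
  { unfold d, edge. rewrite (nxt_small n p) by lia. pt_ring. }
  apply apex_unique; [apply chart_sign_sqr| | |].
  - apply InL_edge_sqr; auto; lia.
  - rewrite Hsum. apply InL_edge_sqr; auto; lia.
  - replace (cross d (edge n Q p)) with (cross (edge n Q (S p)) (edge n Q p)); auto.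
    rewrite <- Hsum. pt_ring.
Qed.

Lemma Jet1_turn (r : R) (m : nat) : Jet1 k r (turn m) 0 (fun j => rate j m).
Proof.
  apply (Jet1_val (Jet1_rsum k (fun j _ => Jet1_mult (Jet1_coord j) (Jet1_const (rate j m))))).
  - apply rsum_zero; intros; ring.
  - intros i Hi. cbv beta. rewrite <- (rsum_unitv k i (fun j => rate j m) Hi).
    apply rsum_ext; intros; ring.
Qed.

Lemma PtJet1_vertex (r : R) (i : nat) : (i <= n)%nat ->
  PtJet1 k r (vertex i) (P (i mod n)%nat) (fun j => T j (i mod n)%nat).
Proof.
  intros Hi.
  apply (PtJet1_val (PtJet1_psum i (fun m _ => PtJet1_rot (e m) (Jet1_turn r m)))).
  - transitivity (psum i e); [reflexivity|].
    unfold e. rewrite psum_edges by auto. destruct HP as [-> _]. pt_ring.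
  - intros j Hj. cbv beta.
    rewrite (psum_ext i _ (edge n (T j))) by (intros; symmetry; apply tangent_edge; auto; lia).
    rewrite psum_edges by auto. destruct (HT j Hj) as [-> _]. pt_ring.
Qed.

Lemma PtJet1_vertex_n (r : R) : PtJet1 k r (vertex n) (0, 0) (fun _ => (0, 0)).
Proof.
  apply (PtJet1_val (PtJet1_vertex r n (le_n n))); intros; rewrite Nat.Div0.mod_same.
  - apply HP.
  - apply HT; auto.
Qed.

Lemma PtJet1_base_end (r : R) :
  PtJet1 k r (fun x => psub (vertex (p + 2) x) (vertex n x)) (P (nxt n (S p)))
    (fun j => T j (nxt n (S p))).
Proof.
  pose proof (PtJet1_vertex r (p + 2) ltac:(lia)) as Hend.
  replace ((p + 2) mod n)%nat with (nxt n (S p)) in Hend by (rewrite nxt_mod; f_equal; lia).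
  apply (PtJet1_val (PtJet1_psub Hend (PtJet1_vertex_n r))); pt_ring.
Qed.

Lemma PtJet1_vertex_p (r : R) : PtJet1 k r (vertex p) (P p) (fun j => T j p).
Proof.
  pose proof (PtJet1_vertex r p ltac:(lia)) as Hstart.
  rewrite Nat.mod_small in Hstart by lia. exact Hstart.
Qed.

Lemma PtJet1_third_vertex : exists r A1, 0 < r /\
  (forall x, InBox k r x ->
     0 < dot (base x) (base x) /\ 0 < height_sqr (l p) (l (S p)) (base x)) /\
  PtJet1 k r (fun x => apex sg (l p) (l (S p)) (base x)) (e p) A1.
Proof.
  pose proof (PtJet1_psub (PtJet1_base_end 1) (PtJet1_vertex_p 1)) as Hbase.
  destruct (third_vertex P HP chart_sign_cross) as [Hd [Hh Hapex]].
  destruct (PtJet1_apex sg (l p) (l (S p)) Rlt_0_1 Hbase Hd Hh) as [r [A1 [Hr [Hpos Hjet]]]].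
  exists r, A1. split; [lra|]. split; [exact Hpos|].
  apply (PtJet1_val Hjet); auto.
Qed.

Lemma chart_map_le (x : nat -> R) (i : nat) : (i <= p)%nat -> chart_map x i = vertex i x.
Proof. intros Hi. unfold chart_map. now rewrite (proj2 (Nat.leb_le i p) Hi). Qed.

Lemma chart_map_third (x : nat -> R) :
  chart_map x (S p) = padd (vertex p x) (apex sg (l p) (l (S p)) (base x)).
Proof.
  unfold chart_map. rewrite Nat.eqb_refl. destruct (Nat.leb_spec (S p) p); [lia|auto].
Qed.

Lemma chart_map_ge (x : nat -> R) (i : nat) : (p + 2 <= i)%nat ->
  chart_map x i = psub (vertex i x) (vertex n x).
Proof.
  intros Hi. unfold chart_map. destruct (Nat.leb_spec i p); [lia|].
  destruct (Nat.eqb_spec i (S p)); [lia|auto].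
Qed.

Lemma chart_map_nxt (x : nat -> R) (i : nat) : (i < n)%nat ->
  chart_map x (nxt n i) = chart_map x (S i).
Proof.
  intros Hi. destruct (Nat.eq_dec (S i) n) as [Hlast|Hne].
  - rewrite nxt_mod, Hlast, Nat.Div0.mod_same, chart_map_le, chart_map_ge by lia.
    change (vertex 0 x) with (0, 0). pt_ring.
  - now rewrite nxt_small by lia.
Qed.

Lemma chart_map_edge (x : nat -> R) (i : nat) : (i < n)%nat -> i <> p -> i <> S p ->
  edge n (chart_map x) i = turned x i.
Proof.
  intros Hi Hip HiSp. unfold edge. rewrite chart_map_nxt by auto.
  destruct (Nat.lt_ge_cases i p).
  - rewrite !chart_map_le by lia. unfold vertex. rewrite psum_S. pt_ring.
  - rewrite !chart_map_ge by lia. unfold vertex. rewrite psum_S. pt_ring.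
Qed.

Lemma chart_map_InL (x : nat -> R) :
  0 < dot (base x) (base x) -> 0 < height_sqr (l p) (l (S p)) (base x) ->
  InL n l (chart_map x).
Proof.
  intros Hd Hh. destruct HP as [HP0 [HP1 _]]. split; [|split].
  - rewrite chart_map_le by lia. reflexivity.
  - rewrite chart_map_le by lia. unfold vertex. rewrite psum_S. unfold turned.
    rewrite turn_0, rot_0. unfold e, edge. rewrite nxt_small, HP0, HP1 by lia.
    apply injective_projections; unfold padd, psub; simpl; ring.
  - intros i Hi. apply dist_eq_sqr; auto. rewrite dot_psub_sym. fold (edge n (chart_map x) i).
    destruct (apex_sides sg (l p) (l (S p)) (base x) chart_sign_sqr Hd ltac:(lra))
      as [Hside Hside'].
    destruct (Nat.eq_dec i p) as [->|Hip]; [|destruct (Nat.eq_dec i (S p)) as [->|HiSp]].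
    + rewrite <- Hside. unfold edge.
      rewrite nxt_small, chart_map_third, chart_map_le by lia. pt_ring.
    + rewrite <- Hside'. unfold edge.
      rewrite chart_map_nxt, chart_map_third, chart_map_ge by lia.
      replace (S (S p)) with (p + 2)%nat by lia. unfold base. pt_ring.
    + rewrite chart_map_edge by auto. unfold turned. rewrite dot_rot.
      apply InL_edge_sqr; auto.
Qed.

(* The gradient of the third vertex is not computed: the lengths of both adjacent edges being
   constant, it is determined by the gradients of their other end points. *)
Lemma third_vertex_gradient (r : R) (A1 : nat -> pt) : 0 < r ->
  (forall x, InBox k r x ->
     0 < dot (base x) (base x) /\ 0 < height_sqr (l p) (l (S p)) (base x)) ->
  PtJet1 k r (fun x => apex sg (l p) (l (S p)) (base x)) (e p) A1 ->
  forall j, (j < k)%nat -> A1 j = psub (T j (S p)) (T j p).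
Proof.
  intros Hr Hpos Hapex j Hj.
  assert (Hside : forall x, InBox k r x ->
    let a := apex sg (l p) (l (S p)) (base x) in
    dot a a = l p * l p /\ dot (psub (base x) a) (psub (base x) a) = l (S p) * l (S p)).
  { intros x Hx. destruct (Hpos x Hx). apply apex_sides; auto using chart_sign_sqr. lra. }
  pose proof (PtJet1_constant_length _ j Hr Hj Hapex (fun x Hx => proj1 (Hside x Hx))) as Horth.
  pose proof (PtJet1_psub (PtJet1_psub (PtJet1_base_end r) (PtJet1_vertex_p r)) Hapex) as Hrest.
  pose proof (PtJet1_constant_length _ j Hr Hj Hrest (fun x Hx => proj2 (Hside x Hx))) as Horth'.
  destruct (HT j Hj) as [_ [_ Htan]].
  pose proof (Htan p ltac:(lia)) as Htan_p. pose proof (Htan (S p) ltac:(lia)) as Htan_Sp.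
  fold e in Htan_p, Htan_Sp. unfold edge in Htan_p, Htan_Sp.
  rewrite (nxt_small n p) in Htan_p by lia.
  replace (psub (psub (P (nxt n (S p))) (P p)) (e p)) with (e (S p)) in Horth'
    by (unfold e, edge; rewrite (nxt_small n p) by lia; pt_ring).
  set (v := psub (A1 j) (psub (T j (S p)) (T j p))).
  assert (Hv : v = (0, 0)).
  { apply (orthogonal_to_basis (e p) (e (S p))); auto; unfold v; clear v; pt_simpl; lra. }
  unfold v in Hv. pt_simpl. injection Hv as Hfst Hsnd.
  apply injective_projections; cbn [fst snd]; lra.
Qed.

Lemma PtJet1_chart_map : exists r, 0 < r /\
  (forall x, InBox k r x ->
     0 < dot (base x) (base x) /\ 0 < height_sqr (l p) (l (S p)) (base x)) /\
  forall i, (i < n)%nat -> PtJet1 k r (fun x => chart_map x i) (P i) (fun j => T j i).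
Proof.
  destruct PtJet1_third_vertex as [r [A1 [Hr [Hpos Hapex]]]].
  exists r. split; auto. split; auto. intros i Hi.
  destruct (Nat.lt_trichotomy i (S p)) as [Hip|[->|Hip]].
  - apply (PtJet1_ext _ (vertex i) Hr); [intros; apply chart_map_le; lia|].
    apply (PtJet1_val (PtJet1_vertex r i ltac:(lia))); intros; now rewrite Nat.mod_small.
  - apply (PtJet1_ext _ _ Hr (fun x _ => chart_map_third x)).
    apply (PtJet1_val (PtJet1_padd (PtJet1_vertex_p r) Hapex)).
    + unfold e, edge. rewrite nxt_small by lia. pt_ring.
    + intros j Hj. rewrite (third_vertex_gradient r A1) by auto. pt_ring.
  - apply (PtJet1_ext _ (fun x => psub (vertex i x) (vertex n x)) Hr);
      [intros; apply chart_map_ge; lia|].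
    apply (PtJet1_val (PtJet1_psub (PtJet1_vertex r i ltac:(lia)) (PtJet1_vertex_n r)));
      intros; rewrite Nat.mod_small by auto; pt_ring.
Qed.

(* Enumerates the edges other than [0], [p], [S p]. *)
Let free_edge (i : nat) : nat := if Nat.ltb (S i) p then S i else (i + 3)%nat.

Lemma free_edge_surj (m : nat) : (m < n)%nat -> m <> 0%nat -> m <> p -> m <> S p ->
  exists i, (i < k)%nat /\ free_edge i = m.
Proof.
  intros Hm Hm0 Hmp HmSp. unfold free_edge, k. destruct (Nat.lt_ge_cases m p).
  - exists (m - 1)%nat. split; [lia|]. destruct (Nat.ltb_spec (S (m - 1)) p); lia.
  - exists (m - 3)%nat. split; [lia|]. destruct (Nat.ltb_spec (S (m - 3)) p); lia.
Qed.

Lemma free_edge_lt (i : nat) : (i < k)%nat -> (free_edge i < n)%nat.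
Proof. unfold free_edge, k. intros Hi. destruct (Nat.ltb_spec (S i) p); lia. Qed.

Lemma combination_edge (c : nat -> R) (m : nat) : (m < n)%nat ->
  edge n (fun i => psum k (fun j => pscal (c j) (T j i))) m = pscal (turn m c) (rot90 (e m)).
Proof.
  intros Hm. transitivity (psum k (fun j => pscal (c j) (edge n (T j) m))).
  - unfold edge, psum, psub, pscal; cbn [fst snd].
    f_equal; rewrite <- rsum_minus; apply rsum_ext; intros; ring.
  - rewrite (psum_ext k _ (fun j => pscal (c j * rate j m) (rot90 (e m)))).
    + unfold psum, pscal, turn; cbn [fst snd]. now rewrite !rsum_scal_r.
    + intros j Hj. rewrite tangent_edge by auto. pt_ring.
Qed.

Lemma free_turns_injective (c : nat -> R) :
  (forall i, (i < k)%nat -> turn (free_edge i) c = 0) -> forall j, (j < k)%nat -> c j = 0.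
Proof.
  intros Hfree. apply Hindep. set (V := fun i => psum k (fun j => pscal (c j) (T j i))).
  assert (Hturn : forall m, (m < n)%nat -> m <> p -> m <> S p -> turn m c = 0).
  { intros m Hm Hmp HmSp. destruct (Nat.eq_dec m 0) as [->|Hm0]; [apply turn_0|].
    destruct (free_edge_surj m) as [i [Hi <-]]; auto. }
  assert (HV0 : V 0%nat = (0, 0)).
  { unfold V, psum. f_equal; apply rsum_zero; intros j Hj;
      destruct (HT j Hj) as [-> _]; unfold pscal; simpl; ring. }
  destruct (vertices_of_partial_edges n p V (fun _ => (0, 0)) (proj2 Hp) HV0) as [Hlow Hhigh].
  { intros m Hm Hmp HmSp. unfold V. rewrite combination_edge, Hturn by auto. pt_ring. }
  assert (Hnull : forall i, psum i (fun _ => (0, 0)) = (0, 0))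
    by (intros i; unfold psum; f_equal; apply rsum_zero; reflexivity).
  assert (Hlow0 : forall i, (i <= p)%nat -> V i = (0, 0))
    by (intros i Hi; rewrite <- Hlow; auto).
  assert (Hhigh0 : forall i, (p + 2 <= i <= n)%nat -> V (i mod n)%nat = (0, 0))
    by (intros i Hi; rewrite <- Hhigh by auto; rewrite !Hnull; pt_ring).
  intros i Hi. change (V i = (0, 0)).
  destruct (Nat.lt_trichotomy i (S p)) as [Hip|[->|Hip]].
  - apply Hlow0. lia.
  - pose proof (combination_edge c p ltac:(lia)) as Hbefore.
    pose proof (combination_edge c (S p) ltac:(lia)) as Hafter.
    fold V in Hbefore, Hafter. unfold edge in Hbefore, Hafter.
    rewrite nxt_small, (Hlow0 p) in Hbefore by lia.
    rewrite nxt_mod, (Hhigh0 (S (S p))) in Hafter by lia.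
    apply (orthogonal_to_basis (e p) (e (S p))); auto.
    + replace (V (S p)) with (psub (V (S p)) (0, 0)) by pt_ring. rewrite Hbefore. pt_ring.
    + transitivity (- dot (e (S p)) (psub (0, 0) (V (S p)))); [pt_ring|].
      rewrite Hafter. pt_ring.
  - rewrite <- (Nat.mod_small i n Hi). apply Hhigh0. lia.
Qed.

Let near_P (A : (nat -> pt) -> Prop) : Prop :=
  exists eps, 0 < eps /\ forall Q, (forall i, (i < n)%nat -> dist (Q i) (P i) < eps) -> A Q.

Instance near_P_filter : Filter near_P.
Proof.
  split.
  - exists 1. split; [lra|auto].
  - intros A B [d [Hd HA]] [d' [Hd' HB]]. exists (Rmin d d').
    split; [apply Rmin_pos; auto|]. intros Q HQ.
    pose proof (Rmin_l d d'). pose proof (Rmin_r d d').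
    split; [apply HA|apply HB]; intros i Hi; specialize (HQ i Hi); lra.
  - intros A B HAB [d [Hd HA]]. exists d. auto.
Qed.

Lemma filterlim_edge (m : nat) : (m < n)%nat ->
  filterlim (fun Q => fst (edge n Q m)) near_P (locally (fst (e m))) /\
  filterlim (fun Q => snd (edge n Q m)) near_P (locally (snd (e m))).
Proof.
  intros Hm.
  assert (Hvertex : forall i, (i < n)%nat ->
    filterlim (fun Q : nat -> pt => fst (Q i)) near_P (locally (fst (P i))) /\
    filterlim (fun Q : nat -> pt => snd (Q i)) near_P (locally (snd (P i)))).
  { intros i Hi. split; apply filterlim_locally; intros eps; exists eps;
      (split; [apply cond_pos|]); intros Q HQ; apply (dist_coords (Q i) (P i) eps), HQ, Hi. }
  destruct (Hvertex m Hm). destruct (Hvertex _ (nxt_lt n m ltac:(lia))).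
  split; apply filterlim_Rminus; auto.
Qed.

Lemma filterlim_dot_cross (U V : (nat -> pt) -> pt) (u v : pt) :
  filterlim (fun Q => fst (U Q)) near_P (locally (fst u)) ->
  filterlim (fun Q => snd (U Q)) near_P (locally (snd u)) ->
  filterlim (fun Q => fst (V Q)) near_P (locally (fst v)) ->
  filterlim (fun Q => snd (V Q)) near_P (locally (snd v)) ->
  filterlim (fun Q => dot (U Q) (V Q)) near_P (locally (dot u v)) /\
  filterlim (fun Q => cross (U Q) (V Q)) near_P (locally (cross u v)).
Proof.
  intros HU HU' HV HV'. split.
  - apply filterlim_Rplus; apply filterlim_Rmult; auto.
  - apply filterlim_Rminus; apply filterlim_Rmult; auto.
Qed.

Let turn_to (Q : nat -> pt) (m : nat) : R := asin (cross (e m) (edge n Q m) / (l m * l m)).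

Lemma near_edges (rho : R) : 0 < rho -> near_P (fun Q =>
  (forall m, (m < n)%nat -> Rabs (turn_to Q m) < rho /\ 0 < dot (e m) (edge n Q m)) /\
  0 < sg * cross (edge n Q (S p)) (edge n Q p)).
Proof.
  intros Hrho. apply filter_and.
  - apply (filter_forall_lt n (fun m Q =>
      Rabs (turn_to Q m) < rho /\ 0 < dot (e m) (edge n Q m))).
    intros m Hm. destruct (filterlim_edge m Hm) as [Hfst Hsnd].
    destruct (filterlim_dot_cross (fun _ => e m) (fun Q => edge n Q m) (e m) (e m))
      as [Hdot Hcr]; auto; try apply filterlim_const.
    apply filter_and.
    + apply (filterlim_eventually_lt _ 0); auto. unfold turn_to.
      rewrite <- Rabs_R0, <- asin_0.
      apply (filterlim_Rcomp Rabs); [|apply Rcontinuity_abs].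
      replace (asin 0) with (asin (cross (e m) (e m) * / (l m * l m)))
        by (f_equal; pt_ring).
      apply filterlim_Rcomp; [apply filterlim_Rmult; auto; apply filterlim_const|].
      replace (cross (e m) (e m) * / (l m * l m)) with 0 by pt_ring.
      apply derivable_continuous_pt, derivable_pt_asin. lra.
    + exact (filterlim_eventually_gt _ _ _ Hdot (chart_edge_pos m Hm)).
  - destruct (filterlim_edge p ltac:(lia)). destruct (filterlim_edge (S p) ltac:(lia)).
    apply (filterlim_eventually_gt _ (sg * cross (e (S p)) (e p))); [|apply chart_sign_cross].
    apply filterlim_Rmult; [apply filterlim_const|].
    apply (filterlim_dot_cross (fun Q => edge n Q (S p)) (fun Q => edge n Q p)); auto.
Qed.

Lemma turned_eq_edge (x : nat -> R) (Q : nat -> pt) : InL n l Q ->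
  (forall m, (m < n)%nat -> 0 < dot (e m) (edge n Q m)) ->
  (forall i, (i < k)%nat -> turn (free_edge i) x = turn_to Q (free_edge i)) ->
  forall m, (m < n)%nat -> m <> p -> m <> S p -> turned x m = edge n Q m.
Proof.
  intros HQ Hacute Hturn m Hm Hmp HmSp. unfold turned.
  destruct (Nat.eq_dec m 0) as [->|Hm0].
  - rewrite turn_0, rot_0. unfold e, edge. rewrite (nxt_small n 0) by lia.
    destruct HP as [-> [-> _]]. destruct HQ as [-> [-> _]]. reflexivity.
  - destruct (free_edge_surj m) as [i [Hi <-]]; auto. rewrite Hturn by auto.
    pose proof (Hl _ Hm). symmetry.
    apply rot_asin; [nra|apply InL_edge_sqr; auto|apply InL_edge_sqr; auto|auto].
Qed.

Lemma chart_map_eq (x : nat -> R) (Q : nat -> pt) : InL n l Q ->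
  (forall m, (m < n)%nat -> m <> p -> m <> S p -> turned x m = edge n Q m) ->
  0 < sg * cross (edge n Q (S p)) (edge n Q p) ->
  forall i, (i < n)%nat -> chart_map x i = Q i.
Proof.
  intros HQ Hedges Hside i Hi.
  destruct (vertices_of_partial_edges n p Q (turned x) (proj2 Hp) (proj1 HQ) Hedges)
     as [Hlow Hhigh].
  change (forall i, (i <= p)%nat -> vertex i x = Q i) in Hlow.
  change (forall i, (p + 2 <= i <= n)%nat ->
    psub (vertex i x) (vertex n x) = Q (i mod n)%nat) in Hhigh.
  destruct (Nat.lt_trichotomy i (S p)) as [Hip|[->|Hip]].
  - rewrite chart_map_le by lia. apply Hlow. lia.
  - rewrite chart_map_third.
    assert (Hbase : base x = psub (Q (nxt n (S p))) (Q p)).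
    { unfold base. rewrite (Hlow p), (Hhigh (p + 2)%nat), nxt_mod by lia.
      replace (S (S p)) with (p + 2)%nat by lia. reflexivity. }
    destruct (third_vertex Q HQ Hside) as [_ [_ Hapex]].
    rewrite Hbase, <- Hapex, (Hlow p) by lia.
    unfold edge. rewrite nxt_small by lia. pt_ring.
  - rewrite chart_map_ge by lia. rewrite <- (Nat.mod_small i n Hi) at 2. apply Hhigh. lia.
Qed.

Lemma chart_map_surj (r : R) : 0 < r -> near_P (fun Q => InL n l Q ->
  exists x, InBox k r x /\ forall i, (i < n)%nat -> chart_map x i = Q i).
Proof.
  intros Hr.
  destruct (injective_system_bounded k (fun j i => rate j (free_edge i)) free_turns_injective)
    as [B [HB Hsolve]].
  assert (Hrho : 0 < r / (2 * B)) by (apply Rdiv_lt_0_compat; lra).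
  generalize (near_edges (r / (2 * B)) Hrho). apply filter_imp. intros Q [Hnear Hside] HQ.
  destruct (Hsolve (fun i => turn_to Q (free_edge i)) (r / (2 * B))) as [y [Hy Hturn]].
  { intros i Hi. left. apply Hnear, free_edge_lt, Hi. }
  set (x := fun j => if Nat.ltb j k then y j else 0).
  assert (Hx : forall j, (j < k)%nat -> x j = y j)
    by (intros j Hj; unfold x; now rewrite (proj2 (Nat.ltb_lt j k) Hj)).
  exists x. split.
  - split; intros j Hj.
    + unfold x. destruct (Nat.ltb_spec j k); [lia|auto].
    + rewrite Hx by auto. eapply Rle_lt_trans; [apply Hy, Hj|].
      replace (B * (r / (2 * B))) with (r / 2) by (field; lra). lra.
  - apply chart_map_eq; auto. apply turned_eq_edge; auto; [intros; apply Hnear; auto|].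
    intros i Hi. rewrite <- Hturn by auto. apply rsum_ext. intros j Hj. now rewrite Hx.
Qed.

Lemma chart_exists : exists r phi, ChartAt n l P r phi /\
  forall i, (i < n)%nat -> PtJet1 k r (fun x => phi x i) (P i) (fun j => T j i).
Proof.
  destruct PtJet1_chart_map as [r [Hr [Hpos Hjet]]].
  exists r, chart_map. split; auto.
  split; [auto|]. split; [|split; [|split; [|split]]].
  - intros i Hi. exact (PtJet1_value (Hjet i Hi)).
  - intros x Hx. destruct (Hpos x Hx). apply chart_map_InL; auto.
  - intros i Hi. destruct (Hjet i Hi) as [[f2 Hfst] [g2 Hsnd]].
    exact (conj (Jet_IsC2 Hfst) (Jet_IsC2 Hsnd)).
  - exists T. split.
    + intros j i Hj Hi. destruct (Hjet i Hi) as [[f2 Hfst] [g2 Hsnd]].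
      exact (conj (Jet_partial Hr Hj Hfst) (Jet_partial Hr Hj Hsnd)).
    + intros c Hc. apply Hindep. intros i Hi. destruct (Hc i Hi).
      now apply injective_projections.
  - destruct (chart_map_surj r Hr) as [eps [Heps Hsurj]]. exists eps. split; auto.
Qed.

End Chart.

(** * Cyclic polygons *)

Lemma epsi_cases (n : nat) (P : nat -> pt) (O : pt) (i : nat) :
  epsi n P O i = 1 \/ epsi n P O i = -1.
Proof. unfold epsi. destruct (Rlt_dec _ _); auto. Qed.

Definition hangle (n : nat) (P : nat -> pt) (O : pt) (i : nat) : R :=
  epsi n P O i * alphai n P O i.

Lemma cos_hangle (n : nat) (P : nat -> pt) (O : pt) (i : nat) (q : R) :
  cos (q * hangle n P O i) = cos (q * alphai n P O i).
Proof.
  unfold hangle. destruct (epsi_cases n P O i) as [-> | ->].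
  - f_equal. ring.
  - rewrite <- cos_neg. f_equal. ring.
Qed.

Lemma sin_hangle (n : nat) (P : nat -> pt) (O : pt) (i : nat) (q : R) :
  sin (q * hangle n P O i) = epsi n P O i * sin (q * alphai n P O i).
Proof.
  unfold hangle. destruct (epsi_cases n P O i) as [-> | ->].
  - rewrite Rmult_1_l. f_equal. ring.
  - replace (q * (-1 * alphai n P O i)) with (- (q * alphai n P O i)) by ring.
    rewrite sin_neg. ring.
Qed.

Lemma tan_hangle (n : nat) (P : nat -> pt) (O : pt) (i : nat) :
  tan (hangle n P O i) = epsi n P O i * tan (alphai n P O i).
Proof.
  rewrite <- (Rmult_1_l (hangle n P O i)). unfold tan.
  rewrite cos_hangle, sin_hangle, Rmult_1_l. unfold Rdiv. ring.
Qed.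

Section CyclicPolygon.
Variables (n : nat) (l : nat -> R) (P : nat -> pt) (O : pt) (Rad : R).
Hypothesis Hl : positive_lengths n l.
Hypothesis HP : InL n l P.
Hypothesis HC : OnCircle n P O Rad.

Let a (i : nat) : pt := psub (P i) O.

Lemma radius_pos : 0 < Rad.
Proof. apply HC. Qed.

Lemma radius_sqr (i : nat) : (i < n)%nat -> dot (a i) (a i) = Rad * Rad.
Proof. intros Hi. apply dist_eq_sqr; apply HC; auto. Qed.

Lemma radius_sqr_nxt (i : nat) : (i < n)%nat -> dot (a (nxt n i)) (a (nxt n i)) = Rad * Rad.
Proof. intros Hi. apply radius_sqr, nxt_lt. lia. Qed.

Lemma dot_radii (i : nat) : (i < n)%nat ->
  dot (a i) (a (nxt n i)) = Rad * Rad - l i * l i / 2.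
Proof.
  intros Hi. pose proof (InL_edge_sqr n l P Hl HP i Hi) as Hchord.
  rewrite <- (edge_psub_const n P O) in Hchord. fold a in Hchord.
  unfold edge in Hchord.
  replace (dot (psub (a (nxt n i)) (a i)) (psub (a (nxt n i)) (a i))) with
    (dot (a (nxt n i)) (a (nxt n i)) - 2 * dot (a i) (a (nxt n i)) + dot (a i) (a i))
    in Hchord by pt_ring.
  rewrite radius_sqr_nxt, radius_sqr in Hchord by auto. lra.
Qed.

Lemma double_alphai (i : nat) : (i < n)%nat ->
  0 <= 2 * alphai n P O i <= PI /\
  cos (2 * alphai n P O i) * (Rad * Rad) = dot (a i) (a (nxt n i)).
Proof.
  intros Hi. pose proof radius_pos as HR.
  set (z := dot (a i) (a (nxt n i)) / (Rad * Rad)).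
  assert (Hal : 2 * alphai n P O i = acos z).
  { unfold alphai, norm. fold (a i) (a (nxt n i)).
    rewrite radius_sqr, radius_sqr_nxt, sqrt_square by (auto; lra). unfold z. field. }
  assert (Hz : -1 <= z <= 1).
  { pose proof (dot_sqr_add_cross_sqr (a i) (a (nxt n i))) as Hlagrange.
    rewrite radius_sqr, radius_sqr_nxt in Hlagrange by auto.
    assert (Hdot : dot (a i) (a (nxt n i)) = z * (Rad * Rad)) by (unfold z; field; lra).
    rewrite Hdot in Hlagrange.
    assert (0 < Rad * Rad * (Rad * Rad)) by (repeat apply Rmult_lt_0_compat; lra).
    assert (z * z <= 1); [|nra]. apply (Rmult_le_reg_r (Rad * Rad * (Rad * Rad))); auto.
    pose proof (Rle_0_sqr (cross (a i) (a (nxt n i)))). unfold Rsqr in *. lra. }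
  rewrite Hal. split; [apply acos_bound|]. rewrite cos_acos by auto. unfold z. field. lra.
Qed.

Lemma sin_alphai (i : nat) : (i < n)%nat -> sin (alphai n P O i) = l i / (2 * Rad).
Proof.
  intros Hi. pose proof radius_pos as HR. pose proof (Hl i Hi).
  destruct (double_alphai i Hi) as [Hrange Hcos].
  rewrite dot_radii, cos_2a_sin in Hcos by auto.
  assert (0 <= sin (alphai n P O i)) by (apply sin_ge_0; lra).
  assert (0 < l i / (2 * Rad)) by (apply Rdiv_lt_0_compat; lra).
  apply Rsqr_inj; try lra. apply (Rmult_eq_reg_r (Rad * Rad)); [|nra].
  unfold Rsqr. transitivity (l i * l i / 4); [lra|field; lra].
Qed.

Lemma alphai_range (i : nat) : (i < n)%nat -> 0 < alphai n P O i <= PI / 2.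
Proof.
  intros Hi. destruct (double_alphai i Hi) as [Hrange _].
  destruct (Req_dec (alphai n P O i) 0) as [Hzero|]; [|lra]. exfalso.
  pose proof (sin_alphai i Hi) as Hsin. rewrite Hzero, sin_0 in Hsin.
  assert (0 < l i / (2 * Rad)); [|lra].
  apply Rdiv_lt_0_compat; auto. pose proof radius_pos. lra.
Qed.

Lemma sin_double_alphai (i : nat) : (i < n)%nat ->
  sin (2 * alphai n P O i) * (Rad * Rad) = Rabs (cross (a i) (a (nxt n i))).
Proof.
  intros Hi. destruct (double_alphai i Hi) as [Hrange Hcos].
  assert (0 <= sin (2 * alphai n P O i)) by (apply sin_ge_0; lra).
  pose proof (dot_sqr_add_cross_sqr (a i) (a (nxt n i))) as Hlagrange.
  rewrite radius_sqr, radius_sqr_nxt, <- Hcos in Hlagrange by auto.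
  apply Rsqr_inj; [nra|apply Rabs_pos|]. rewrite <- Rsqr_abs. unfold Rsqr.
  pose proof (sin2_cos2 (2 * alphai n P O i)) as Htrig. unfold Rsqr in Htrig.
  transitivity ((1 - cos (2 * alphai n P O i) * cos (2 * alphai n P O i))
                * (Rad * Rad * (Rad * Rad))); [rewrite <- Htrig; ring|lra].
Qed.

Lemma epsi_mult_Rabs_cross (i : nat) :
  epsi n P O i * Rabs (cross (a i) (a (nxt n i))) = cross (a i) (a (nxt n i)).
Proof.
  unfold epsi.
  replace (cross (psub (P (nxt n i)) (P i)) (psub O (P i))) with (cross (a i) (a (nxt n i)))
    by (unfold a; pt_ring).
  destruct (Rlt_dec 0 _); [rewrite Rabs_right by lra|rewrite Rabs_left1 by lra]; ring.
Qed.

Lemma sin_double_hangle (i : nat) : (i < n)%nat ->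
  sin (2 * hangle n P O i) * (Rad * Rad) = cross (a i) (a (nxt n i)).
Proof.
  intros Hi. rewrite sin_hangle, Rmult_assoc, sin_double_alphai by auto.
  apply epsi_mult_Rabs_cross.
Qed.

Lemma rot_hangle (i : nat) : (i < n)%nat -> a (nxt n i) = rot (2 * hangle n P O i) (a i).
Proof.
  intros Hi. pose proof radius_pos. apply (rot_unique _ _ (Rad * Rad)); [nra| | |].
  - apply radius_sqr; auto.
  - rewrite cos_hangle. apply double_alphai; auto.
  - apply sin_double_hangle; auto.
Qed.

Lemma rsum_hangle : exists w : Z, rsum n (hangle n P O) = IZR w * PI.
Proof.
  destruct (Nat.eq_dec n 0) as [Hn|Hn]; [exists 0%Z; rewrite Hn; simpl; ring|].
  assert (Hturn : forall i, (i <= n)%nat ->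
            a (i mod n)%nat = rot (2 * rsum i (hangle n P O)) (a 0%nat)).
  { induction i as [|i IH]; intros Hi; simpl rsum.
    - rewrite Nat.Div0.mod_0_l, Rmult_0_r, rot_0. reflexivity.
    - rewrite <- nxt_mod, rot_hangle by lia. specialize (IH ltac:(lia)).
      rewrite Nat.mod_small in IH by lia. rewrite IH, rot_add. f_equal. ring. }
  specialize (Hturn n (le_n n)). rewrite Nat.Div0.mod_same in Hturn.
  set (t := rsum n (hangle n P O)) in *.
  assert (Hcos : cos (2 * t) = 1).
  { apply (rot_fixed _ (a 0%nat)); auto.
    rewrite radius_sqr by lia. pose proof radius_pos. nra. }
  rewrite cos_2a_sin in Hcos. apply sin_eq_0_0. nra.
Qed.

Lemma windingP_hangle : windingP n P O = rsum n (hangle n P O) / PI.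
Proof.
  unfold windingP. rewrite (rsum_ext n _ (fun i => 2 * hangle n P O i))
    by (intros; unfold hangle; ring).
  rewrite rsum_scal. pose proof PI_RGT_0. field. lra.
Qed.

End CyclicPolygon.

(** * The second variation of the area *)

(* Rotation by the angle [2 atan t]. *)
Definition tan_rot (t : R) (a : pt) : pt :=
  pscal (/ (1 + t * t)) (padd (pscal (1 - t * t) a) (pscal (2 * t) (rot90 a))).

Definition rotates_by (n : nat) (t : nat -> R) (a : nat -> pt) : Prop :=
  forall k, (k < n)%nat -> a (nxt n k) = tan_rot (t k) (a k).

Lemma one_plus_sqr_neq_0 (x : R) : 1 + x * x <> 0.
Proof. nra. Qed.

Lemma double_angle_tan (b : R) : cos b <> 0 ->
  cos (2 * b) = (1 - tan b * tan b) / (1 + tan b * tan b) /\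
  sin (2 * b) = 2 * tan b / (1 + tan b * tan b).
Proof.
  intros Hcos. pose proof (sin2_cos2 b) as Htrig. unfold Rsqr in Htrig.
  assert (Hsec : 1 + tan b * tan b = / (cos b * cos b)).
  { unfold tan. transitivity ((sin b * sin b + cos b * cos b) / (cos b * cos b)).
    - field; auto.
    - rewrite Htrig. field; auto. }
  rewrite Hsec, cos_2a, sin_2a. unfold tan. split; field; auto.
Qed.

Lemma rot_double (b : R) (a : pt) : cos b <> 0 -> rot (2 * b) a = tan_rot (tan b) a.
Proof.
  intros Hcos. destruct (double_angle_tan b Hcos) as [Hc Hs]. unfold rot, tan_rot.
  rewrite Hc, Hs. apply injective_projections; pt_simpl; field; apply one_plus_sqr_neq_0.
Qed.

(* The second variation of twice the area along one edge, [ct] being the cotangent of half of the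
   oriented central angle; [u -> u'], [v -> v'] are displacements of the end points. *)
Definition eform (ct : R) (u u' v v' : pt) : R :=
  / 2 * (cross u v' + cross v u') - / 2 * ct * dot (psub u' u) (psub v' v).

Definition Hess (n : nat) (ct : nat -> R) (U V : nat -> pt) : R :=
  rsum n (fun k => eform (ct k) (U k) (U (nxt n k)) (V k) (V (nxt n k))).

Lemma Hess_sym (n : nat) (ct : nat -> R) (U V : nat -> pt) : Hess n ct U V = Hess n ct V U.
Proof. apply rsum_ext; intros. unfold eform. pt_ring. Qed.

Lemma dot_psum (m : nat) (a : pt) (c : nat -> R) (v : nat -> pt) :
  dot a (psum m (fun j => pscal (c j) (v j))) = rsum m (fun j => c j * dot a (v j)).
Proof.
  unfold dot, psum, pscal; cbn [fst snd]. rewrite <- !rsum_scal, <- rsum_plus.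
  apply rsum_ext; intros; ring.
Qed.

Lemma eform_psum (m : nat) (ct : R) (u u' : pt) (c : nat -> R) (v v' : nat -> pt) :
  eform ct u u' (psum m (fun j => pscal (c j) (v j))) (psum m (fun j => pscal (c j) (v' j)))
  = rsum m (fun j => c j * eform ct u u' (v j) (v' j)).
Proof.
  set (f := psub u' u).
  set (g := pscal (/ 2) (psub (pscal ct f) (rot90 u'))).
  set (g' := pscal (/ 2) (psub (rot90 u) (pscal ct f))).
  assert (Hlinear : forall w w', eform ct u u' w w' = dot g w + dot g' w')
    by (intros; unfold eform, g, g', f; pt_ring).
  rewrite Hlinear, !dot_psum, <- rsum_plus. apply rsum_ext. intros. rewrite Hlinear. ring.
Qed.

Lemma Hess_psum (n m : nat) (ct : nat -> R) (U : nat -> pt) (c : nat -> R)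
  (V : nat -> nat -> pt) :
  Hess n ct U (fun i => psum m (fun j => pscal (c j) (V j i)))
  = rsum m (fun j => c j * Hess n ct U (V j)).
Proof.
  unfold Hess.
  rewrite (rsum_ext n _ _ (fun k Hk => eform_psum m (ct k) (U k) (U (nxt n k)) c _ _)).
  rewrite rsum_swap. apply rsum_ext. intros. now rewrite rsum_scal.
Qed.

Lemma Hess_zero (n : nat) (ct : nat -> R) (U V : nat -> pt) :
  (forall i, (i < n)%nat -> V i = (0, 0)) -> Hess n ct U V = 0.
Proof.
  intros HV. apply rsum_zero. intros k Hk.
  rewrite !HV by (auto; apply nxt_lt; lia). unfold eform. pt_ring.
Qed.

Definition diagonal_family (n m : nat) (ct : nat -> R) (T : nat -> nat -> pt) (lam : nat -> R)
  : Prop :=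
  forall i j, (i < m)%nat -> (j < m)%nat -> Hess n ct (T i) (T j) = lam i * unitv i j.

Lemma diagonal_family_independent (n m : nat) (ct : nat -> R) (T : nat -> nat -> pt)
  (lam : nat -> R) :
  diagonal_family n m ct T lam -> (forall i, (i < m)%nat -> lam i <> 0) -> independent n m T.
Proof.
  intros Hdiag Hlam c Hc j Hj.
  pose proof (Hess_psum n m ct (T j) c T) as Hcomb. rewrite (Hess_zero n ct _ _ Hc) in Hcomb.
  rewrite (rsum_ext m _ (fun i => c i * lam j * unitv j i)) in Hcomb
    by (intros; rewrite Hdiag by auto; ring).
  rewrite (rsum_unitv m j (fun i => c i * lam j) Hj) in Hcomb.
  destruct (Rmult_integral _ _ (eq_sym Hcomb)); auto. exfalso. apply (Hlam j Hj). auto.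
Qed.

Lemma tan_rot_chord (t : R) (a : pt) :
  psub (tan_rot t a) a = pscal t (rot90 (padd a (tan_rot t a))).
Proof.
  unfold tan_rot. apply injective_projections; pt_simpl; field; apply one_plus_sqr_neq_0.
Qed.

(* The length constraints cancel the linear part of the area at a cyclic polygon. *)
Lemma area_expansion (n : nat) (P Q : nat -> pt) (O : pt) (t : nat -> R) :
  (forall k, (k < n)%nat -> t k <> 0) ->
  rotates_by n t (fun k => psub (P k) O) ->
  (forall k, (k < n)%nat -> dot (edge n Q k) (edge n Q k) = dot (edge n P k) (edge n P k)) ->
  let W := fun k => psub (Q k) (P k) in
  area n Q = area n P + / 2 * Hess n (fun k => / t k) W W.
Proof.
  intros Ht Hrot Hlen W. set (a := fun k => psub (P k) O).
  unfold area. rewrite <- Rmult_plus_distr_l. f_equal.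
  unfold Hess. rewrite <- !rsum_plus. apply Rminus_diag_uniq. rewrite <- rsum_minus.
  apply (rsum_coboundary n (fun k => cross O (W k) - cross (a k) (W k))).
  intros k Hk. specialize (Hlen k Hk). specialize (Ht k Hk).
  assert (Hchord : edge n P k = pscal (t k) (rot90 (padd (a k) (a (nxt n k))))).
  { rewrite <- (edge_psub_const n P O). unfold edge, a. rewrite (Hrot k Hk).
    apply tan_rot_chord. }
  set (step := psub (W (nxt n k)) (W k)).
  assert (Hstep : dot step step = - 2 * t k * cross (padd (a k) (a (nxt n k))) step).
  { transitivity (- 2 * dot (edge n P k) step); [|rewrite Hchord; pt_ring].
    replace (edge n Q k) with (padd (edge n P k) step) in Hlen
      by (unfold edge, step, W; pt_ring).
    clear - Hlen. generalize dependent (edge n P k). generalize step. intros u v Huv.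
    pt_simpl. lra. }
  replace (eform (/ t k) (W k) (W (nxt n k)) (W k) (W (nxt n k)))
    with (cross (W k) (W (nxt n k)) + cross (padd (a k) (a (nxt n k))) step).
  - unfold step, W, a. pt_ring.
  - unfold eform. fold step. rewrite Hstep. field. auto.
Qed.

(** * The Hessian as a diagonal form *)

Definition diag_coeff (n : nat) (t : nat -> R) (sigma : nat -> pt) (k : nat) : R :=
  - (snd (sigma k) * snd (sigma (nxt n k)) * (1 + t k * t k) / (2 * t k)).

Section TangentForm.
Variables (n : nat) (a sigma : nat -> pt) (t : nat -> R) (R2 : R).
Hypothesis Hn : (3 <= n)%nat.
Hypothesis Ht : forall k, (k < n)%nat -> t k <> 0.
Hypothesis Ha : forall k, (k < n)%nat -> dot (a k) (a k) = R2.
Hypothesis HR2 : 0 < R2.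
Hypothesis Hrot : rotates_by n t a.
Hypothesis Hsigma : forall k, (k < n)%nat -> dot (sigma k) (sigma k) = 1.
Hypothesis Hrot_sigma : rotates_by n t sigma.
Hypothesis Hs : forall k, (k < n)%nat -> snd (sigma k) <> 0.

Let ct (k : nat) : R := / t k.
Let s (k : nat) : R := snd (sigma k).
Let s' (k : nat) : R := fst (sigma k).
Let c := diag_coeff n t sigma.

Ltac rotate k Hk :=
  rewrite ?(Hrot k Hk); unfold tan_rot; pt_simpl; field; auto using one_plus_sqr_neq_0.

Lemma Hess_rot90 (V : nat -> pt) : Hess n ct (fun k => rot90 (a k)) V = 0.
Proof.
  apply (rsum_coboundary n (fun k => / 2 * dot (a k) (V k))).
  intros k Hk. unfold eform, ct. rotate k Hk.
Qed.

Lemma Hess_const (z : pt) (V : nat -> pt) : Hess n ct (fun _ => z) V = 0.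
Proof.
  apply (rsum_coboundary n (fun k => / 2 * cross z (V k))).
  intros k Hk. unfold eform. pt_ring.
Qed.

Lemma Hess_mod_isometries (z : pt) (r : R) (U V : nat -> pt) :
  Hess n ct (fun k => psub (psub (U k) z) (pscal r (rot90 (a k)))) V = Hess n ct U V.
Proof.
  transitivity (Hess n ct U V - Hess n ct (fun _ => z) V
                - r * Hess n ct (fun k => rot90 (a k)) V).
  - unfold Hess. rewrite <- rsum_scal, <- !rsum_minus. apply rsum_ext.
    intros. unfold eform. pt_ring.
  - rewrite Hess_rot90, Hess_const. ring.
Qed.

Definition q_form (x q q' r r' : R) : R :=
  / 2 * x * (q + q') * (r + r') - (q' - q) * (r' - r) / (2 * x).

Lemma s_nxt (k : nat) : (k < n)%nat ->
  s (nxt n k) = ((1 - t k * t k) * s k + 2 * t k * s' k) / (1 + t k * t k) /\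
  s' (nxt n k) = ((1 - t k * t k) * s' k - 2 * t k * s k) / (1 + t k * t k).
Proof.
  intros Hk. unfold s, s'. rewrite (Hrot_sigma k Hk). unfold tan_rot.
  split; pt_simpl; field; apply one_plus_sqr_neq_0.
Qed.

(* Since [s] is in the kernel of the form, the substitution [q = s h] turns it into a sum of
   squares of differences of [h]. *)
Lemma q_form_diagonal (h g : nat -> R) :
  rsum n (fun k => q_form (t k) (s k * h k) (s (nxt n k) * h (nxt n k))
                      (s k * g k) (s (nxt n k) * g (nxt n k))) =
  rsum n (fun k => c k * (h (nxt n k) - h k) * (g (nxt n k) - g k)).
Proof.
  apply Rminus_diag_uniq. rewrite <- rsum_minus.
  apply (rsum_coboundary n (fun k => - (h k * g k * s k * s' k))).
  intros k Hk. destruct (s_nxt k Hk) as [Es Es'].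
  unfold q_form, c, diag_coeff. fold (s k) (s (nxt n k)). rewrite Es, Es'.
  field. auto using one_plus_sqr_neq_0.
Qed.

(* From [d = h' - h] to the tangent vector [W] with normal part [q] and tangential part [p]. *)
Let q (d : nat -> R) (k : nat) : R := s k * rsum k d.
Let dp (d : nat -> R) (k : nat) : R := t k * (q d k + q d (nxt n k)).
Let p (d : nat -> R) (k : nat) : R := rsum k (dp d).
Let W (d : nat -> R) (k : nat) : pt := psub (pscal (p d k) (rot90 (a k))) (pscal (q d k) (a k)).
Let spin (d : nat -> R) (k : nat) : R :=
  (p d (nxt n k) + p d k) / 2 + (q d (nxt n k) - q d k) / (2 * t k).

Definition admissible (d : nat -> R) : Prop := rsum n d = 0 /\ rsum n (dp d) = 0.

Lemma p_nxt (d : nat -> R) (k : nat) : admissible d -> (k < n)%nat ->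
  p d (nxt n k) = p d k + t k * (q d k + q d (nxt n k)).
Proof. intros [_ Hdp]. exact (rsum_nxt n (dp d) Hdp k). Qed.

Lemma W_edge (d : nat -> R) (k : nat) : admissible d -> (k < n)%nat ->
  edge n (W d) k = pscal (spin d k) (rot90 (edge n a k)).
Proof.
  intros Hd Hk. unfold edge, spin, W. rewrite p_nxt by auto.
  apply injective_projections; rotate k Hk.
Qed.

Lemma Hess_W (d g : nat -> R) : admissible d -> admissible g ->
  Hess n ct (W d) (W g) = R2 * dform n c d g.
Proof.
  intros Hd Hg.
  transitivity (R2 * rsum n (fun k => c k * (rsum (nxt n k) d - rsum k d)
                                          * (rsum (nxt n k) g - rsum k g))).
  - rewrite <- (q_form_diagonal (fun k => rsum k d) (fun k => rsum k g)), <- rsum_scal.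
    apply Rminus_diag_uniq. unfold Hess. rewrite <- rsum_minus.
    apply (rsum_coboundary n (fun k => - / 2 * R2 * (p d k * q g k + p g k * q d k))).
    intros k Hk. fold (q d k) (q g k) (q d (nxt n k)) (q g (nxt n k)).
    rewrite <- (Ha k Hk). unfold eform, W, ct, q_form. rewrite !p_nxt by auto. rotate k Hk.
  - f_equal. apply rsum_ext. intros k Hk.
    rewrite !rsum_nxt by (apply Hd || apply Hg || auto). ring.
Qed.

(* [admissible] is orthogonality to [1 / c] and to the differences [e] of [1 / s]. *)
Let e (k : nat) : R := / s (nxt n k) - / s k.

Lemma dform_e (d : nat -> R) : rsum n d = 0 -> dform n c e d = rsum n (dp d).
Proof.
  intros Hd.
  transitivity (rsum n (fun k => c k * (/ s (nxt n k) - / s k)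
                                     * (rsum (nxt n k) d - rsum k d))).
  - apply rsum_ext. intros k Hk. rewrite rsum_nxt by auto. unfold e. ring.
  - rewrite <- (q_form_diagonal (fun k => / s k) (fun k => rsum k d)).
    apply rsum_ext. intros k Hk.
    rewrite !Rinv_r by (apply Hs; auto; apply nxt_lt; lia).
    unfold q_form, dp, q. field. auto.
Qed.

Lemma dform_e_e : dform n c e e = 2 * rsum n t.
Proof.
  transitivity (rsum n (fun k => c k * (/ s (nxt n k) - / s k) * (/ s (nxt n k) - / s k)));
    [reflexivity|].
  rewrite <- (q_form_diagonal (fun k => / s k) (fun k => / s k)), <- rsum_scal.
  apply rsum_ext. intros k Hk. rewrite !Rinv_r by (apply Hs; auto; apply nxt_lt; lia).
  unfold q_form. field. auto.
Qed.

Lemma diag_coeff_neq_0 (k : nat) : (k < n)%nat -> c k <> 0.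
Proof.
  intros Hk. pose proof (Hs _ (nxt_lt n k ltac:(lia))).
  unfold c, diag_coeff, Rdiv. apply Ropp_neq_0_compat.
  repeat apply Rmult_integral_contrapositive_currified; auto using one_plus_sqr_neq_0.
  apply Rinv_neq_0_compat. pose proof (Ht k Hk). lra.
Qed.

(* The cotangent [s' / s] of the argument of [sigma] is a primitive of [1 / c]. *)
Lemma inv_diag_coeff_isotropic : dform n c (fun k => / c k) (fun k => / c k) = 0.
Proof.
  apply (rsum_coboundary n (fun k => s' k / s k)).
  intros k Hk. pose proof (diag_coeff_neq_0 k Hk).
  transitivity (/ c k); [field; auto|].
  pose proof (Hs k Hk) as Hsk. pose proof (Hs _ (nxt_lt n k ltac:(lia))) as Hsk'.
  fold (s k) in Hsk. fold (s (nxt n k)) in Hsk'.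
  pose proof (one_plus_sqr_neq_0 (t k)).
  assert (Hwedge : s' (nxt n k) * s k - s' k * s (nxt n k) = - (2 * t k / (1 + t k * t k))).
  { transitivity (- (2 * t k / (1 + t k * t k)) * dot (sigma k) (sigma k));
      [|rewrite Hsigma by auto; ring].
    destruct (s_nxt k Hk) as [-> ->]. unfold s, s', dot. field. auto. }
  transitivity ((s' (nxt n k) * s k - s' k * s (nxt n k)) / (s k * s (nxt n k))).
  - rewrite Hwedge. unfold c, diag_coeff. fold (s k) (s (nxt n k)). field. auto.
  - field. auto.
Qed.

Let N (d : nat -> R) (k : nat) : pt :=
  psub (psub (W d k) (psub (W d 0%nat) (pscal (spin d 0%nat) (rot90 (a 0%nat)))))
    (pscal (spin d 0%nat) (rot90 (a k))).

Lemma N_normalized (d : nat -> R) : admissible d -> normalized_tangent n a (N d).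
Proof.
  intros Hd.
  assert (HN0 : N d 0%nat = (0, 0)) by (unfold N; pt_ring).
  assert (Hedge : forall m, (m < n)%nat ->
            edge n (N d) m = pscal (spin d m - spin d 0%nat) (rot90 (edge n a m))).
  { intros m Hm.
    transitivity (psub (edge n (W d) m) (pscal (spin d 0%nat) (rot90 (edge n a m)))).
    - unfold edge, N. pt_ring.
    - rewrite W_edge by auto. pt_ring. }
  split; [exact HN0|split].
  - transitivity (padd (N d 0%nat) (edge n (N d) 0%nat)).
    + unfold edge. rewrite nxt_small by lia. pt_ring.
    + rewrite HN0, Hedge by lia. pt_ring.
  - intros m Hm. rewrite Hedge by auto. pt_ring.
Qed.

Lemma Hess_N (d g : nat -> R) : admissible d -> admissible g ->
  Hess n ct (N d) (N g) = R2 * dform n c d g.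
Proof.
  intros Hd Hg. unfold N.
  rewrite Hess_mod_isometries, Hess_sym, Hess_mod_isometries, Hess_sym. now apply Hess_W.
Qed.

Lemma tangent_diagonalization : rsum n t <> 0 ->
  exists (T : nat -> nat -> pt) (lam : nat -> R),
    (forall j, (j < n - 3)%nat -> normalized_tangent n a (T j)) /\
    diagonal_family n (n - 3) ct T lam /\
    (forall i, (i < n - 3)%nat -> lam i <> 0) /\
    ncount n (fun k => is_neg (c k)) =
      ((if is_neg (rsum n t) then 1 else 0) + 1 + num_neg (n - 3) lam)%nat.
Proof.
  intros Hsum.
  assert (Hinv : forall x, dform n c x (fun k => / c k) = rsum n x).
  { intros x. apply rsum_ext. intros k Hk. field. apply diag_coeff_neq_0; auto. }
  destruct (isotropic_reduction n c e (fun k => / c k))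
    as [b [[Horth Hne] [Hperp Hcount]]].
  - exact Hn.
  - exact diag_coeff_neq_0.
  - apply Rinv_neq_0_compat, diag_coeff_neq_0. lia.
  - exact inv_diag_coeff_isotropic.
  - rewrite Hinv. apply (rsum_coboundary n (fun k => / s k)). reflexivity.
  - rewrite dform_e_e. lra.
  - assert (Hadm : forall j, (j < n - 3)%nat -> admissible (b j)).
    { intros j Hj. destruct (Hperp j Hj) as [He Hu].
      rewrite dform_sym, Hinv in Hu. split; auto. rewrite <- dform_e by auto. auto. }
    exists (fun j => N (b j)), (fun j => R2 * dform n c (b j) (b j)). split; [|split; [|split]].
    + intros j Hj. apply N_normalized; auto.
    + intros i j Hi Hj. rewrite Hess_N by auto. destruct (Nat.eq_dec i j) as [->|Hij].
      * rewrite unitv_same. ring.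
      * rewrite Horth, unitv_diff by auto. ring.
    + intros i Hi. apply Rmult_integral_contrapositive_currified; [lra|auto].
    + rewrite Hcount, dform_e_e, is_neg_scal by lra. f_equal.
      apply ncount_ext. intros i Hi. symmetry. apply is_neg_scal, HR2.
Qed.

End TangentForm.

(** * The Hessian of the area in a chart *)

Lemma Jet_dot_0 {k : nat} {r : R} {f f1 g g1} :
  PtJet1 k r f (0, 0) f1 -> PtJet1 k r g (0, 0) g1 ->
  Jet k r (fun x => dot (f x) (g x)) 0 (fun _ => 0)
    (fun i j => dot (f1 i) (g1 j) + dot (f1 j) (g1 i)).
Proof.
  intros [[f2 Hf] [f2' Hf']] [[g2 Hg] [g2' Hg']].
  apply (Jet_val (Jet_plus (Jet_mult Hf Hg) (Jet_mult Hf' Hg')));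
    intros; unfold dot; cbn [fst snd]; ring.
Qed.

Lemma Jet_cross_0 {k : nat} {r : R} {f f1 g g1} :
  PtJet1 k r f (0, 0) f1 -> PtJet1 k r g (0, 0) g1 ->
  Jet k r (fun x => cross (f x) (g x)) 0 (fun _ => 0)
    (fun i j => cross (f1 i) (g1 j) + cross (f1 j) (g1 i)).
Proof.
  intros Hf Hg.
  replace (fun x => cross (f x) (g x)) with (fun x => dot (rot90 (f x)) (g x))
    by (apply functional_extensionality; pt_ring).
  assert (Hf' : PtJet1 k r (fun x => rot90 (f x)) (0, 0) (fun j => rot90 (f1 j)))
    by (apply (PtJet1_val (PtJet1_rot90 Hf)); pt_ring).
  apply (Jet_val (Jet_dot_0 Hf' Hg)); pt_ring.
Qed.

Lemma Jet_eform_0 {k : nat} {r : R} (ct : R) {u u1 u' u1'} :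
  PtJet1 k r u (0, 0) u1 -> PtJet1 k r u' (0, 0) u1' ->
  Jet k r (fun x => eform ct (u x) (u' x) (u x) (u' x)) 0 (fun _ => 0)
    (fun i j => 2 * eform ct (u1 i) (u1' i) (u1 j) (u1' j)).
Proof.
  intros Hu Hu'.
  assert (Hstep : PtJet1 k r (fun x => psub (u' x) (u x)) (0, 0) (fun j => psub (u1' j) (u1 j)))
    by (apply (PtJet1_val (PtJet1_psub Hu' Hu)); pt_ring).
  pose proof (Jet_minus (Jet_cross_0 Hu Hu') (Jet_scal (/ 2 * ct) (Jet_dot_0 Hstep Hstep)))
    as Hjet.
  match type of Hjet with Jet _ _ ?g _ _ _ =>
    replace (fun x => eform ct (u x) (u' x) (u x) (u' x)) with g
      by (apply functional_extensionality; intros; unfold eform; field) end.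
  apply (Jet_val Hjet); intros; unfold eform; pt_simpl; field.
Qed.

Lemma Jet_area_expansion {n k : nat} {r : R} (A0 : R) (ct : nat -> R) {P phi T} :
  (forall i, (i < n)%nat -> PtJet1 k r (fun x => phi x i) (P i) (fun j => T j i)) ->
  let W := fun x i => psub (phi x i) (P i) in
  Jet k r (fun x => A0 + / 2 * Hess n ct (W x) (W x)) A0 (fun _ => 0)
    (fun i j => Hess n ct (T i) (T j)).
Proof.
  intros Hphi W.
  assert (HW : forall i, (i < n)%nat -> PtJet1 k r (fun x => W x i) (0, 0) (fun j => T j i)).
  { intros i Hi. apply (PtJet1_val (PtJet1_psub (Hphi i Hi) (PtJet1_const (P i)))); pt_ring. }
  pose proof (Jet_rsum n (fun m Hm =>
    Jet_eform_0 (ct m) (HW m Hm) (HW (nxt n m) (nxt_lt n m ltac:(lia))))) as Hsum.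
  apply (Jet_val (Jet_plus (Jet_const A0) (Jet_scal (/ 2) Hsum))); intros; cbv beta.
  - rewrite rsum_zero by auto. ring.
  - rewrite rsum_zero by auto. ring.
  - rewrite rsum_scal. unfold Hess. field.
Qed.

Lemma SymEigenvalues_diag (k : nat) (H : nat -> nat -> R) (lam : nat -> R) :
  (forall i j, (i < k)%nat -> (j < k)%nat -> H i j = lam i * unitv i j) ->
  SymEigenvalues k H lam.
Proof.
  intros HH. exists unitv. split; intros i j Hi Hj.
  - rewrite (rsum_ext k _ (fun m => unitv i m * unitv j m))
      by (intros; f_equal; apply unitv_sym).
    rewrite rsum_unitv by auto. unfold unitv. now rewrite Nat.eqb_sym.
  - rewrite HH, <- (rsum_unitv k i (fun m => lam m * unitv m j)) by auto.
    apply rsum_ext. intros. rewrite (unitv_sym j). ring.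
Qed.

(** * Counting half turns *)

Definition in_half_turn (m : Z) (f : R) : Prop := IZR m * PI < f < (IZR m + 1) * PI.

Lemma sin_IZR_PI (m : Z) : sin (IZR m * PI) = 0.
Proof. apply sin_eq_0_1. exists m. reflexivity. Qed.

Lemma sin_add_turns (x : R) (w : Z) : sin (x + 2 * (IZR w * PI)) = sin x.
Proof. rewrite sin_plus, sin_2a, cos_2a_sin, sin_IZR_PI. ring. Qed.

Lemma cos_add_turns (x : R) (w : Z) : cos (x + 2 * (IZR w * PI)) = cos x.
Proof. rewrite cos_plus, sin_2a, cos_2a_sin, sin_IZR_PI. ring. Qed.

Lemma IZR_PI_small (w : Z) (x : R) : x = IZR w * PI -> Rabs x < PI -> x = 0.
Proof.
  intros -> Hx. apply Rabs_def2 in Hx.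
  assert (Hup : IZR w < 1) by nra. assert (Hlow : -1 < IZR w) by nra.
  apply lt_IZR in Hup, Hlow. replace w with 0%Z by lia. ring.
Qed.

Lemma half_turn_exists (f : R) : sin f <> 0 -> exists m, in_half_turn m f.
Proof.
  intros Hf. exists (Int_part (f / PI)). pose proof PI_RGT_0 as HPI.
  destruct (base_Int_part (f / PI)) as [Hle Hgt]. set (m := Int_part (f / PI)) in *.
  assert (Ef : f = f / PI * PI) by (field; lra).
  assert (Hmf : IZR m * PI <= f) by (rewrite Ef; apply Rmult_le_compat_r; lra).
  split.
  - destruct (Req_dec (IZR m * PI) f) as [Hmult|]; [|lra].
    exfalso. apply Hf. rewrite <- Hmult. apply sin_IZR_PI.
  - rewrite Ef at 1. apply Rmult_lt_compat_r; lra.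
Qed.

Lemma in_half_turn_sin (m : Z) (f : R) : in_half_turn m f -> 0 < cos (IZR m * PI) * sin f.
Proof.
  intros Hm. set (g := f - IZR m * PI).
  assert (Hg : 0 < sin g) by (unfold in_half_turn in Hm; apply sin_gt_0; unfold g; lra).
  replace f with (IZR m * PI + g) by (unfold g; ring). rewrite sin_plus, sin_IZR_PI.
  pose proof (sin2_cos2 (IZR m * PI)) as Htrig. unfold Rsqr in Htrig.
  rewrite sin_IZR_PI in Htrig.
  replace (cos (IZR m * PI) * (0 * cos g + cos (IZR m * PI) * sin g)) with
    (cos (IZR m * PI) * cos (IZR m * PI) * sin g) by ring.
  replace (cos (IZR m * PI) * cos (IZR m * PI)) with 1 by lra. lra.
Qed.

Lemma half_turn_advance (m m' : Z) (f f' : R) :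
  in_half_turn m f -> in_half_turn m' f' -> 0 < f' - f < PI ->
  m' = m /\ 0 < sin f * sin f' \/ m' = (m + 1)%Z /\ sin f * sin f' < 0.
Proof.
  intros Hm Hm' Hd.
  pose proof (in_half_turn_sin m f Hm) as Hsin. pose proof (in_half_turn_sin m' f' Hm') as Hsin'.
  unfold in_half_turn in *.
  assert (Hlow : IZR m < IZR m' + 1) by nra. assert (Hup : IZR m' < IZR m + 2) by nra.
  rewrite <- plus_IZR in Hlow, Hup. apply lt_IZR in Hlow, Hup.
  assert (Hcases : m' = m \/ m' = (m + 1)%Z) by lia. destruct Hcases as [->| ->].
  - left. split; auto. destruct (Rlt_dec 0 (cos (IZR m * PI))); nra.
  - right. split; auto. rewrite plus_IZR in Hsin'.
    replace ((IZR m + 1) * PI) with (IZR m * PI + PI) in Hsin' by ring.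
    rewrite neg_cos in Hsin'. destruct (Rlt_dec 0 (cos (IZR m * PI))); nra.
Qed.

Lemma half_turn_step (m m' : Z) (f b : R) :
  in_half_turn m f -> in_half_turn m' (f + 2 * b) -> 0 < Rabs b < PI / 2 ->
  (if is_neg (- (sin f * sin (f + 2 * b) / sin (2 * b))) then 1 else 0)
  = (if Rlt_dec 0 b then 1 else 0) - (IZR m' - IZR m).
Proof.
  intros Hm Hm' Hb. set (x := sin f * sin (f + 2 * b)).
  destruct (Rlt_dec 0 b) as [Hpos|Hneg].
  - rewrite Rabs_right in Hb by lra.
    assert (Hsin : 0 < / sin (2 * b)) by (apply Rinv_0_lt_compat, sin_gt_0; lra).
    destruct (half_turn_advance m m' _ _ Hm Hm' ltac:(lra)) as [[-> Hx]|[-> Hx]];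
      fold x in Hx.
    + rewrite is_neg_true by (unfold Rdiv; nra). lra.
    + rewrite is_neg_false by (unfold Rdiv; nra). rewrite plus_IZR. lra.
  - assert (Hb0 : b < 0) by (destruct (Req_dec b 0) as [->|]; [rewrite Rabs_R0 in Hb|]; lra).
    rewrite Rabs_left in Hb by auto.
    assert (Hsin : / sin (2 * b) < 0).
    { apply Rinv_lt_0_compat. rewrite <- (Ropp_involutive (2 * b)), sin_neg.
      assert (0 < sin (- (2 * b))) by (apply sin_gt_0; lra). lra. }
    destruct (half_turn_advance m' m _ _ Hm' Hm ltac:(lra)) as [[-> Hx]|[-> Hx]];
      rewrite Rmult_comm in Hx; fold x in Hx.
    + rewrite is_neg_false by (unfold Rdiv; nra). lra.
    + rewrite is_neg_true by (unfold Rdiv; nra). rewrite plus_IZR. lra.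
Qed.

Lemma half_turn_count (n : nat) (F b : nat -> R) (w : Z) :
  (forall k, (k <= n)%nat -> sin (F k) <> 0) ->
  (forall k, (k < n)%nat -> F (S k) = F k + 2 * b k) ->
  (forall k, (k < n)%nat -> 0 < Rabs (b k) < PI / 2) ->
  F n = F 0%nat + 2 * (IZR w * PI) ->
  INR (ncount n (fun k => is_neg (- (sin (F k) * sin (F (S k)) / sin (2 * b k))))) =
  INR (ncount n (fun k => if Rlt_dec 0 (b k) then true else false)) - 2 * IZR w.
Proof.
  intros Hsin HF Hb Hw.
  destruct (finite_choice 0%Z (S n) (fun k m => in_half_turn m (F k))) as [m Hm].
  { intros k Hk. apply half_turn_exists, Hsin. lia. }
  assert (Htotal : IZR (m n) - IZR (m 0%nat) = 2 * IZR w).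
  { pose proof (Hm n ltac:(lia)) as Hend. pose proof (Hm 0%nat ltac:(lia)) as Hstart.
    unfold in_half_turn in *. rewrite Hw in Hend.
    assert (Hup : IZR (m n) < IZR (m 0%nat) + 1 + 2 * IZR w) by nra.
    assert (Hlow : IZR (m 0%nat) + 2 * IZR w < IZR (m n) + 1) by nra.
    rewrite <- (mult_IZR 2 w), <- !plus_IZR in Hup, Hlow. apply lt_IZR in Hup, Hlow.
    rewrite <- minus_IZR, <- (mult_IZR 2 w). f_equal. lia. }
  rewrite !INR_ncount, <- Htotal, <- (rsum_telescope n (fun k => IZR (m k))), <- rsum_minus.
  apply rsum_ext. intros k Hk. pose proof (Hm (S k) ltac:(lia)) as Hnext.
  rewrite HF in Hnext |- * by auto.
  rewrite (half_turn_step (m k) (m (S k))) by auto. destruct (Rlt_dec 0 (b k)); reflexivity.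
Qed.

Lemma generic_phase (n : nat) (theta : nat -> R) :
  exists f, forall k, (k < n)%nat -> sin (f + theta k) <> 0.
Proof.
  set (slope := 1 + rsum n (fun k => Rabs (tan (theta k)))).
  exists (atan slope). intros k Hk.
  pose proof (rsum_term_le n k (fun k => Rabs (tan (theta k))) Hk (fun i _ => Rabs_pos _))
    as Hle. cbv beta in Hle.
  assert (Hcos : cos (atan slope) <> 0)
    by (destruct (atan_bound slope); apply Rgt_not_eq, cos_gt_0; lra).
  assert (Hsin : sin (atan slope) = slope * cos (atan slope)).
  { rewrite <- (tan_atan slope) at 2. unfold tan. field. auto. }
  rewrite sin_plus, Hsin.
  replace (slope * cos (atan slope) * cos (theta k) + cos (atan slope) * sin (theta k)) with
    (cos (atan slope) * (slope * cos (theta k) + sin (theta k))) by ring.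
  apply Rmult_integral_contrapositive_currified; auto.
  destruct (Req_dec (cos (theta k)) 0) as [Hc|Hc].
  - rewrite Hc, Rmult_0_r, Rplus_0_l. intros Hs.
    pose proof (sin2_cos2 (theta k)) as Htrig. rewrite Hc, Hs in Htrig.
    unfold Rsqr in Htrig. lra.
  - replace (slope * cos (theta k) + sin (theta k)) with
      ((slope + tan (theta k)) * cos (theta k)) by (unfold tan; field; auto).
    apply Rmult_integral_contrapositive_currified; auto.
    pose proof (Rle_abs (- tan (theta k))) as Habs. rewrite Rabs_Ropp in Habs.
    unfold slope. lra.
Qed.

(** * Nonparallel consecutive edges *)

Lemma cross_consecutive_edges (n : nat) (a : nat -> pt) (t : nat -> R) (R2 : R) (p : nat) :
  rotates_by n t a -> (forall k, (k < n)%nat -> dot (a k) (a k) = R2) -> (S p < n)%nat ->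
  cross (edge n a p) (edge n a (S p)) * ((1 + t p * t p) * (1 + t (S p) * t (S p)))
  = 4 * t p * t (S p) * (t p + t (S p)) * R2.
Proof.
  intros Hrot Ha Hp. unfold edge.
  rewrite <- (Ha p), (Hrot (S p)), <- (nxt_small n p), (Hrot p), (nxt_small n p) by lia.
  unfold tan_rot. pt_simpl. field. auto using one_plus_sqr_neq_0.
Qed.

Lemma alternating_rsum (n : nat) (g : nat -> R) : (1 <= n)%nat ->
  (forall p, (1 <= p)%nat -> (p + 2 <= n)%nat -> g (S p) = - g p) ->
  rsum n g = g 0%nat + (if Nat.even n then g 1%nat else 0).
Proof.
  intros Hn Halt.
  assert (Hprefix : forall i, (i < n)%nat ->
    rsum (S i) g = g 0%nat + (if Nat.even i then 0 else g 1%nat) /\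
    ((1 <= i)%nat -> g i = if Nat.even i then - g 1%nat else g 1%nat)).
  { induction i as [|i IH]; intros Hi; [simpl; split; [ring|lia]|].
    destruct IH as [IHsum IHterm]; [lia|].
    assert (Hterm : g (S i) = if Nat.even (S i) then - g 1%nat else g 1%nat).
    { destruct (Nat.eq_dec i 0) as [->|Hi0]; [reflexivity|].
      rewrite Halt, IHterm, Nat.even_succ, <- Nat.negb_even by lia.
      destruct (Nat.even i); simpl; ring. }
    split; [|auto]. change (rsum (S (S i)) g) with (rsum (S i) g + g (S i)).
    rewrite IHsum, Hterm, Nat.even_succ, <- Nat.negb_even. destruct (Nat.even i); simpl; ring. }
  destruct n as [|n]; [lia|]. destruct (Hprefix n (Nat.lt_succ_diag_r n)) as [-> _].
  rewrite Nat.even_succ, <- Nat.negb_even. destruct (Nat.even n); simpl; ring.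
Qed.

(* Otherwise the half angles alternate from the first edge on, and the polygon runs back and
   forth along one chord. *)
Lemma exists_nonparallel_edges (n : nat) (a : nat -> pt) (b : nat -> R) (R2 : R) (w : Z) :
  (3 <= n)%nat -> 0 < R2 ->
  (forall k, (k < n)%nat -> dot (a k) (a k) = R2) ->
  rotates_by n (fun k => tan (b k)) a ->
  (forall k, (k < n)%nat -> 0 < Rabs (b k) < PI / 2) ->
  (forall k, (k < n)%nat -> tan (b k) <> 0) ->
  rsum n b = IZR w * PI -> rsum n (fun k => tan (b k)) <> 0 ->
  exists p, ((1 <= p)%nat /\ (p + 2 <= n)%nat) /\ cross (edge n a p) (edge n a (S p)) <> 0.
Proof.
  intros Hn HR2 Ha Hrot Hb Ht Hw Hsum. apply NNPP. intros Hparallel.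
  assert (Hrange : forall k, (k < n)%nat -> - (PI / 2) < b k < PI / 2)
    by (intros k Hk; destruct (Hb k Hk) as [_ Hk']; apply Rabs_def2 in Hk'; lra).
  assert (Halt : forall p, (1 <= p)%nat -> (p + 2 <= n)%nat -> tan (b (S p)) = - tan (b p)).
  { intros p Hp Hp'. pose proof (Ht p ltac:(lia)). pose proof (Ht (S p) ltac:(lia)).
    pose proof (cross_consecutive_edges n a _ R2 p Hrot Ha ltac:(lia)) as Hcross.
    destruct (Req_dec (cross (edge n a p) (edge n a (S p))) 0) as [Hzero|Hne];
      [|exfalso; apply Hparallel; exists p; auto].
    rewrite Hzero, Rmult_0_l in Hcross. symmetry in Hcross.
    generalize dependent (tan (b (S p))). generalize dependent (tan (b p)).
    intros x Hx y Hy Hcross.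
    repeat (apply Rmult_integral in Hcross; destruct Hcross as [Hcross|Hcross]); lra. }
  assert (Halt' : forall p, (1 <= p)%nat -> (p + 2 <= n)%nat -> b (S p) = - b p).
  { intros p Hp Hp'. rewrite <- (atan_tan (b (S p))), Halt, atan_opp, atan_tan; auto;
      apply Hrange; lia. }
  rewrite (alternating_rsum n (fun k => tan (b k))) in Hsum by (auto; lia).
  rewrite (alternating_rsum n b) in Hw by (auto; lia).
  pose proof (Hrange 0%nat ltac:(lia)). pose proof (Hrange 1%nat ltac:(lia)).
  apply IZR_PI_small in Hw.
  - destruct (Nat.even n).
    + apply Hsum. replace (b 0%nat) with (- b 1%nat) by lra. rewrite tan_neg. ring.
    + apply (Ht 0%nat); [lia|]. replace (b 0%nat) with 0 by lra. apply tan_0.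
  - apply Rabs_def1; destruct (Nat.even n); lra.
Qed.

(** * The Morse index of a cyclic polygon *)

Section CyclicMorse.
Variables (n : nat) (l : nat -> R) (P : nat -> pt) (O : pt) (Rad : R).
Hypothesis Hn : (3 <= n)%nat.
Hypothesis Hl : positive_lengths n l.
Hypothesis HP : InL n l P.
Hypothesis HC : OnCircle n P O Rad.
Hypothesis Hacute : forall i, (i < n)%nat -> alphai n P O i < PI / 2.
Hypothesis Hsum : tanSum n P O <> 0.

Let a (k : nat) : pt := psub (P k) O.
Let b := hangle n P O.
Let t (k : nat) : R := tan (b k).

Lemma Rabs_hangle (k : nat) : (k < n)%nat -> 0 < Rabs (b k) < PI / 2.
Proof.
  intros Hk. destruct (alphai_range n l P O Rad Hl HP HC k Hk) as [Hpos _].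
  specialize (Hacute k Hk). unfold b, hangle.
  rewrite Rabs_mult, (Rabs_right (alphai n P O k)) by lra.
  destruct (epsi_cases n P O k) as [-> | ->]; [rewrite Rabs_R1|rewrite Rabs_left]; lra.
Qed.

Lemma cos_hangle_pos (k : nat) : (k < n)%nat -> 0 < cos (b k).
Proof.
  intros Hk. destruct (Rabs_hangle k Hk) as [_ Hb]. apply Rabs_def2 in Hb.
  apply cos_gt_0; lra.
Qed.

Lemma tan_hangle_neq_0 (k : nat) : (k < n)%nat -> t k <> 0.
Proof.
  intros Hk Ht. destruct (Rabs_hangle k Hk) as [Hb Hb']. apply Rabs_def2 in Hb'.
  apply (Rgt_not_eq _ _ Hb). rewrite <- (atan_tan (b k)) by lra.
  fold (t k). rewrite Ht, atan_0. apply Rabs_R0.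
Qed.

Lemma hangle_rotates : rotates_by n t a.
Proof.
  intros k Hk. unfold a, t, b. rewrite (rot_hangle n P O Rad) by auto.
  apply rot_double. pose proof (cos_hangle_pos k Hk). fold b. lra.
Qed.

Lemma rsum_tan_hangle : rsum n t = tanSum n P O.
Proof. apply rsum_ext. intros k Hk. apply tan_hangle. Qed.

Lemma eP_hangle : ncount n (fun k => if Rlt_dec 0 (b k) then true else false) = eP n P O.
Proof.
  apply ncount_ext. intros k Hk.
  destruct (alphai_range n l P O Rad Hl HP HC k Hk) as [Hpos _]. unfold b, hangle, epsi.
  destruct (Rlt_dec 0 (cross (psub (P (nxt n k)) (P k)) (psub O (P k))));
    destruct (Rlt_dec 0 _); auto; lra.
Qed.

Let phase (f : R) (k : nat) : R := f + 2 * rsum k b.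
Let sigma (f : R) (k : nat) : pt := (cos (phase f k), sin (phase f k)).

Lemma sigma_nxt (f : R) (k : nat) : (k < n)%nat -> sigma f (nxt n k) = sigma f (S k).
Proof.
  intros Hk. destruct (Nat.eq_dec (S k) n) as [Hlast|Hne]; [|now rewrite nxt_small by lia].
  rewrite nxt_mod, Hlast, Nat.Div0.mod_same. unfold sigma, phase. simpl rsum.
  destruct (rsum_hangle n P O Rad HC) as [w Hw]. fold b in Hw. rewrite Hw.
  now rewrite cos_add_turns, sin_add_turns, Rmult_0_r, Rplus_0_r.
Qed.

Lemma sigma_rotates (f : R) : rotates_by n t (sigma f).
Proof.
  intros k Hk. rewrite sigma_nxt by auto. unfold t.
  rewrite <- rot_double by (pose proof (cos_hangle_pos k Hk); lra).
  unfold sigma, phase. simpl rsum.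
  replace (f + 2 * (rsum k b + b k)) with ((f + 2 * rsum k b) + 2 * b k) by ring.
  set (x := f + 2 * rsum k b). rewrite cos_plus, sin_plus. pt_ring.
Qed.

Lemma diag_coeff_count (f : R) (w : Z) :
  (forall k, (k < n)%nat -> sin (phase f k) <> 0) -> rsum n b = IZR w * PI ->
  INR (ncount n (fun k => is_neg (diag_coeff n t (sigma f) k))) = INR (eP n P O) - 2 * IZR w.
Proof.
  intros Hphase Hw. rewrite <- eP_hangle, <- (half_turn_count n (phase f) b w).
  - f_equal. apply ncount_ext. intros k Hk. f_equal. unfold diag_coeff.
    rewrite sigma_nxt by auto. unfold sigma; cbn [snd].
    pose proof (tan_hangle_neq_0 k Hk) as Ht. pose proof (cos_hangle_pos k Hk).
    destruct (double_angle_tan (b k)) as [_ ->]; [lra|]. fold (t k).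
    field. auto using one_plus_sqr_neq_0.
  - intros k Hk. destruct (Nat.eq_dec k n) as [->|]; [|apply Hphase; lia].
    specialize (Hphase 0%nat ltac:(lia)). unfold phase in *. simpl rsum in Hphase.
    rewrite Hw, sin_add_turns. now rewrite Rmult_0_r, Rplus_0_r in Hphase.
  - intros k Hk. unfold phase. simpl. ring.
  - exact Rabs_hangle.
  - unfold phase. rewrite Hw. simpl. ring.
Qed.

Lemma area_critical_point (T : nat -> nat -> pt) (lam : nat -> R) :
  (forall j, (j < n - 3)%nat -> normalized_tangent n a (T j)) ->
  diagonal_family n (n - 3) (fun k => / t k) T lam ->
  (forall i, (i < n - 3)%nat -> lam i <> 0) ->
  NondegCritIndex n l P (num_neg (n - 3) lam).
Proof.
  intros HT Hdiag Hlam. pose proof (radius_pos n P O Rad HC) as HR.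
  destruct (rsum_hangle n P O Rad HC) as [w Hw].
  destruct (exists_nonparallel_edges n a b (Rad * Rad) w) as [p [Hp Hcross]]; auto.
  - nra.
  - apply (radius_sqr n P O Rad HC).
  - exact hangle_rotates.
  - exact Rabs_hangle.
  - exact tan_hangle_neq_0.
  - fold t. now rewrite rsum_tan_hangle.
  - unfold a in Hcross. rewrite !edge_psub_const in Hcross.
    assert (HT' : forall j, (j < n - 3)%nat -> normalized_tangent n P (T j)).
    { intros j Hj. destruct (HT j Hj) as [HT0 [HT1 Htan]]. split; [|split]; auto.
      intros m Hm. rewrite <- (edge_psub_const n P O). apply Htan, Hm. }
    destruct (chart_exists n l P p T Hl HP Hp Hcross HT'
                (diagonal_family_independent _ _ _ _ _ Hdiag Hlam)) as [r [phi [Hchart Hjet]]].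
    exists r, phi, (fun _ => 0), (fun i j => Hess n (fun k => / t k) (T i) (T j)), lam.
    pose proof Hchart as [Hr [_ [HInL _]]].
    split; [exact Hchart|]. split; [|split; [auto|split; [|auto]]].
    + eapply (Jet_GradHess (r := r) Hr), (Jet_ext _ _ Hr); [|apply (Jet_area_expansion _ _ Hjet)].
      intros x Hx. cbv beta. apply (area_expansion n P (phi x) O t).
      * exact tan_hangle_neq_0.
      * exact hangle_rotates.
      * intros k Hk. rewrite !(InL_edge_sqr n l) by auto. reflexivity.
    + apply SymEigenvalues_diag, Hdiag.
Qed.

Lemma cyclic_index : exists mu, NondegCritIndex n l P mu /\
  INR mu = INR (eP n P O) - 1 - 2 * windingP n P O
           - (if Rlt_dec 0 (tanSum n P O) then 0 else 1).
Proof.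
  pose proof (radius_pos n P O Rad HC) as HR. pose proof PI_RGT_0.
  destruct (rsum_hangle n P O Rad HC) as [w Hw].
  destruct (generic_phase n (fun k => 2 * rsum k b)) as [f Hf].
  destruct (tangent_diagonalization n a (sigma f) t (Rad * Rad))
    as [T [lam [HT [Hdiag [Hlam Hcount]]]]]; auto.
  - exact tan_hangle_neq_0.
  - apply (radius_sqr n P O Rad HC).
  - nra.
  - exact hangle_rotates.
  - intros k _. unfold sigma, dot; cbn [fst snd].
    pose proof (sin2_cos2 (phase f k)) as Htrig. unfold Rsqr in Htrig. lra.
  - apply sigma_rotates.
  - now rewrite rsum_tan_hangle.
  - exists (num_neg (n - 3) lam). split; [apply (area_critical_point T lam); auto|].
    pose proof (diag_coeff_count f w Hf Hw) as Hdiag_count.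
    rewrite Hcount, !plus_INR, rsum_tan_hangle in Hdiag_count.
    rewrite windingP_hangle, Hw.
    replace (IZR w * PI / PI) with (IZR w) by (field; lra).
    unfold is_neg in Hdiag_count.
    destruct (Rlt_dec (tanSum n P O) 0); destruct (Rlt_dec 0 (tanSum n P O));
      simpl in Hdiag_count; lra.
Qed.

End CyclicMorse.

(** * Open dense sets of lengths *)

Definition adherent (n : nat) (V : (nat -> R) -> Prop) (l : nat -> R) : Prop :=
  forall A, coord_nbhd n l A -> exists l', A l' /\ V l'.

Lemma coord_nbhd_nbhd (n : nat) (l : nat -> R) (A : (nat -> R) -> Prop) :
  coord_nbhd n l A -> coord_nbhd n l (fun l' => coord_nbhd n l' A).
Proof.
  intros [d [Hd HA]]. exists (d / 2). split; [lra|]. intros l' Hl'.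
  exists (d / 2). split; [lra|]. intros l'' Hl''. apply HA.
  replace d with (d / 2 + d / 2) by field. apply (close_trans n _ _ l'' l' l); auto.
Qed.

Lemma positive_lengths_near (n : nat) (l : nat -> R) :
  positive_lengths n l -> coord_nbhd n l (positive_lengths n).
Proof.
  intros Hl. apply (filter_forall_lt n (fun i l' => 0 < l' i)). intros i Hi.
  exact (filterlim_eventually_gt _ _ _ (filterlim_coord n i l Hi) (Hl i Hi)).
Qed.

Lemma OpenDensePos_intro (n : nat) (V : (nat -> R) -> Prop) :
  (forall l, V l -> coord_nbhd n l V) ->
  (forall l, positive_lengths n l -> adherent n V l) -> OpenDensePos n V.
Proof.
  intros Hopen Hdense. split; [exact Hopen|]. intros l Hl eps Heps.
  destruct (Hdense l Hl (fun l' => close n eps l' l)) as [l' [Hclose HV]]; eauto.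
  exists eps. auto.
Qed.

Lemma OpenDensePos_adherent (n : nat) (V : (nat -> R) -> Prop) (l : nat -> R) :
  OpenDensePos n V -> positive_lengths n l -> adherent n V l.
Proof.
  intros [_ Hdense] Hl A [d [Hd HA]]. destruct (Hdense l Hl d Hd) as [l' [HV Hclose]].
  exists l'. auto.
Qed.

Lemma OpenDensePos_and (n : nat) (V W : (nat -> R) -> Prop) :
  OpenDensePos n V -> OpenDensePos n W -> OpenDensePos n (fun l => V l /\ W l).
Proof.
  intros HV HW. apply OpenDensePos_intro.
  - intros l [Vl Wl]. exact (filter_and V W (proj1 HV l Vl) (proj1 HW l Wl)).
  - intros l Hl A HA.
    destruct (OpenDensePos_adherent n V l HV Hl _
      (filter_and _ _ (coord_nbhd_nbhd n l A HA) (positive_lengths_near n l Hl)))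
      as [l1 [[HA1 Hl1] Vl1]].
    destruct (OpenDensePos_adherent n W l1 HW Hl1 _ (filter_and _ _ HA1 (proj1 HV l1 Vl1)))
      as [l2 [[Al2 Vl2] Wl2]].
    exists l2. auto.
Qed.

Lemma OpenDensePos_forall_In (n : nat) {I : Type} (V : I -> (nat -> R) -> Prop) (J : list I) :
  (forall i, In i J -> OpenDensePos n (V i)) ->
  OpenDensePos n (fun l => forall i, In i J -> V i l).
Proof.
  induction J as [|j J IH]; intros HV.
  - apply OpenDensePos_intro.
    + intros l _. apply filter_forall. intros l' i [].
    + intros l _ A HA. exists l. split; [exact (coord_nbhd_self n l A HA)|intros i []].
  - destruct (OpenDensePos_and n _ _ (HV j (or_introl eq_refl))
                (IH (fun i Hi => HV i (or_intror Hi)))) as [Hopen Hdense]. split.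
    + intros l Hl. destruct (Hopen l) as [d [Hd Hball]].
      * split; [apply Hl; left; auto|intros i Hi; apply Hl; right; auto].
      * exists d. split; auto. intros l' Hclose. destruct (Hball l' Hclose).
        intros i [<-|Hi]; auto.
    + intros l Hl eps Heps. destruct (Hdense l Hl eps Heps) as [l' [[Hj HJ] Hclose]].
      exists l'. split; auto. intros i [<-|Hi]; auto.
Qed.

Lemma OpenDensePos_interior (n : nat) (W : (nat -> R) -> Prop) :
  (forall l, positive_lengths n l -> adherent n (fun l' => coord_nbhd n l' W) l) ->
  OpenDensePos n (fun l => coord_nbhd n l W).
Proof. intros Hdense. apply OpenDensePos_intro; auto. intros l. apply coord_nbhd_nbhd. Qed.

Lemma OpenDensePos_interior_refine (n : nat) (V W : (nat -> R) -> Prop) :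
  OpenDensePos n V ->
  (forall l, positive_lengths n l -> V l -> adherent n (fun l' => coord_nbhd n l' W) l) ->
  OpenDensePos n (fun l => coord_nbhd n l W).
Proof.
  intros HV HW. apply OpenDensePos_interior. intros l Hl A HA.
  destruct (OpenDensePos_adherent n V l HV Hl _
    (filter_and _ _ (coord_nbhd_nbhd n l A HA) (positive_lengths_near n l Hl)))
    as [l' [[HA' Hl'] Vl']].
  apply (HW l' Hl' Vl' A HA').
Qed.

Definition bump (l : nat -> R) (m : nat) (tau : R) : nat -> R := fun k => l k + tau * unitv m k.

Lemma bump_near (n : nat) (l : nat -> R) (m : nat) (A : (nat -> R) -> Prop) :
  coord_nbhd n l A -> exists d, 0 < d /\ forall tau, Rabs tau < d -> A (bump l m tau).
Proof.
  intros [d [Hd HA]]. exists d. split; auto. intros tau Htau. apply HA. intros i Hi.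
  unfold bump. replace (l i + tau * unitv m i - l i) with (tau * unitv m i) by ring.
  unfold unitv. destruct (Nat.eqb i m).
  - now rewrite Rmult_1_r.
  - rewrite Rmult_0_r, Rabs_R0. exact Hd.
Qed.

(** * Inequalities for the sine and its inverse *)

Lemma asin_lt (c y : R) : - (PI / 2) < c <= PI / 2 -> y < sin c -> asin y < c.
Proof.
  intros Hc Hy. apply Rnot_le_lt. intros Hle.
  pose proof (SIN_bound c). destruct (asin_bound y) as [_ Hup].
  destruct (Rle_dec y (-1)) as [Hlow|Hlow].
  - unfold asin in Hle. destruct (Rle_dec y (-1)); [lra|contradiction].
  - assert (Hsin : sin c <= sin (asin y)) by (apply sin_incr_1; lra).
    rewrite sin_asin in Hsin; lra.
Qed.

Lemma asin_upper_semicontinuous (x eps : R) : 0 < eps ->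
  exists d, 0 < d /\ forall y, y < x + d -> asin y < asin x + eps.
Proof.
  intros Heps. destruct (asin_bound x) as [Hlow Hup]. set (c := asin x + eps).
  destruct (Rle_dec c (PI / 2)) as [Hc|Hc].
  - assert (Hx : x < sin c).
    { destruct (Rle_dec x (-1)) as [Hx|Hx].
      - assert (sin (- (PI / 2)) < sin c) by (apply sin_increasing_1; unfold c in *; lra).
        rewrite sin_neg, sin_PI2 in *. lra.
      - destruct (Rle_dec 1 x) as [Hx'|Hx'].
        + unfold c, asin in Hc. destruct (Rle_dec x (-1)), (Rle_dec 1 x); lra.
        + rewrite <- (sin_asin x) by lra. apply sin_increasing_1; unfold c in *; lra. }
    exists (sin c - x). split; [lra|]. intros y Hy. apply asin_lt; unfold c in *; lra.
  - exists 1. split; [lra|]. intros y _. destruct (asin_bound y). lra.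
Qed.

Lemma continuity_pt_asin (x : R) : continuity_pt asin x.
Proof.
  apply continuity_pt_filterlim, filterlim_locally. intros eps.
  destruct (asin_upper_semicontinuous x eps (cond_pos eps)) as [d [Hd Hup]].
  destruct (asin_upper_semicontinuous (- x) eps (cond_pos eps)) as [d' [Hd' Hlow]].
  assert (Hm : 0 < Rmin d d') by (apply Rmin_pos; auto).
  exists (mkposreal _ Hm). intros y Hy. change (Rabs (y - x) < Rmin d d') in Hy.
  pose proof (Rmin_l d d'). pose proof (Rmin_r d d'). apply Rabs_def2 in Hy.
  specialize (Hup y ltac:(lra)). specialize (Hlow (- y) ltac:(lra)).
  rewrite !asin_opp in Hlow. apply Rabs_def1; unfold minus, plus, opp; simpl; lra.
Qed.

Lemma asin_range (x : R) : 0 < x <= 1 -> 0 < asin x <= PI / 2.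
Proof.
  intros Hx. destruct (asin_bound x) as [_ Hup]. split; auto.
  apply Ropp_lt_cancel. rewrite Ropp_0, <- asin_opp. pose proof PI_RGT_0.
  apply asin_lt; [lra|]. rewrite sin_0. lra.
Qed.

Lemma le_cos_asin (x d : R) : 0 <= x <= 1 - d -> 0 < d -> d <= cos (asin x).
Proof.
  intros Hx Hd. pose proof (asin_bound x).
  assert (0 <= cos (asin x)) by (apply cos_ge_0; lra).
  pose proof (sin2_cos2 (asin x)) as Htrig. rewrite sin_asin in Htrig by lra.
  unfold Rsqr in Htrig. nra.
Qed.

Lemma sin_MVT (a b : R) : exists c, sin b - sin a = cos c * (b - a) /\ Rmin a b <= c <= Rmax a b.
Proof.
  destruct (MVT_gen sin a b cos) as [c [Hc Heq]].
  - intros x _. apply is_derive_Reals, derivable_pt_lim_sin.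
  - intros x _. apply continuity_sin.
  - exists c. auto.
Qed.

Lemma cos_lipschitz (a b : R) : Rabs (cos b - cos a) <= Rabs (b - a).
Proof.
  rewrite !cos_sin. destruct (sin_MVT (PI / 2 + a) (PI / 2 + b)) as [c [-> _]].
  replace (PI / 2 + b - (PI / 2 + a)) with (b - a) by ring. rewrite Rabs_mult.
  assert (Rabs (cos c) <= 1) by (apply Rabs_le, COS_bound).
  pose proof (Rabs_pos (b - a)). nra.
Qed.

Lemma sin_expansive (a b kap : R) :
  - (PI / 2) <= a <= PI / 2 -> - (PI / 2) <= b <= PI / 2 -> 0 <= kap ->
  kap <= cos a -> kap <= cos b -> Rabs (b - a) * kap <= Rabs (sin b - sin a).
Proof.
  intros Ha Hb Hk Hka Hkb. destruct (sin_MVT a b) as [c [-> Hc]].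
  assert (Hkc : kap <= cos c).
  { destruct (Rle_dec 0 c).
    - assert (Hcmp : c <= a \/ c <= b) by (unfold Rmax in Hc; destruct (Rle_dec a b); lra).
      destruct Hcmp; [apply (Rle_trans _ (cos a))|apply (Rle_trans _ (cos b))]; auto;
        apply cos_decr_1; lra.
    - assert (Hcmp : a <= c \/ b <= c) by (unfold Rmin in Hc; destruct (Rle_dec a b); lra).
      rewrite <- (cos_neg c).
      destruct Hcmp; [apply (Rle_trans _ (cos a))|apply (Rle_trans _ (cos b))]; auto;
        [rewrite <- (cos_neg a)|rewrite <- (cos_neg b)]; apply cos_decr_1; lra. }
  rewrite Rabs_mult, (Rabs_right (cos c)) by lra. pose proof (Rabs_pos (b - a)). nra.
Qed.

Lemma sin_taylor (a b : R) : Rabs (sin b - sin a - cos a * (b - a)) <= (b - a) * (b - a).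
Proof.
  destruct (sin_MVT a b) as [c [-> Hc]].
  replace (cos c * (b - a) - cos a * (b - a)) with ((cos c - cos a) * (b - a)) by ring.
  replace ((b - a) * (b - a)) with (Rabs (b - a) * Rabs (b - a))
    by (rewrite <- Rabs_mult; apply Rabs_right, Rle_ge, Rle_0_sqr).
  rewrite Rabs_mult. apply Rmult_le_compat_r; [apply Rabs_pos|].
  eapply Rle_trans; [apply cos_lipschitz|].
  unfold Rmin, Rmax in Hc. destruct (Rle_dec a b).
  - rewrite !Rabs_right; lra.
  - rewrite !Rabs_left1; lra.
Qed.

(** * Generic lengths *)

Fixpoint boolseqs (n : nat) : list (list bool) :=
  match n with
  | O => [[]]
  | S n => map (cons true) (boolseqs n) ++ map (cons false) (boolseqs n)
  end.

Lemma In_boolseqs (L : list bool) : In L (boolseqs (length L)).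
Proof.
  induction L as [|b L IH]; simpl; auto.
  apply in_or_app. destruct b; [left|right]; apply in_map; auto.
Qed.

Definition sgn (L : list bool) (k : nat) : R := if nth k L true then 1 else -1.

Lemma sgn_cases (L : list bool) (k : nat) : sgn L k = 1 \/ sgn L k = -1.
Proof. unfold sgn. destruct (nth k L true); auto. Qed.

Lemma Rabs_sgn_mult (L : list bool) (k : nat) (x : R) : Rabs (sgn L k * x) = Rabs x.
Proof.
  destruct (sgn_cases L k) as [-> | ->].
  - now rewrite Rmult_1_l.
  - replace (-1 * x) with (- x) by ring. apply Rabs_Ropp.
Qed.

(* [s] stands for the inverse of the diameter, so that the half central angles are
   [asin (s * l k)]; the second sum is the derivative of the first one in [s]. *)
Definition angle_sum (n : nat) (L : list bool) (s : R) (l : nat -> R) : R :=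
  rsum n (fun k => sgn L k * asin (s * l k)).
Definition secant_sum (n : nat) (L : list bool) (s : R) (l : nat -> R) : R :=
  rsum n (fun k => sgn L k * (l k / cos (asin (s * l k)))).

Definition regular_at (n : nat) (L : list bool) (s : R) (l : nat -> R) : Prop :=
  (exists k, (k < n)%nat /\ 1 < s * l k) \/ sin (angle_sum n L s l) <> 0 \/
  ((forall k, (k < n)%nat -> s * l k < 1) /\ secant_sum n L s l <> 0).

Definition generic_lengths (n : nat) (L : list bool) (l : nat -> R) : Prop :=
  forall s, 0 <= s -> regular_at n L s l.

Section Limits.
Context {T : Type} {F : (T -> Prop) -> Prop} {FF : Filter F}.
Variables (n : nat) (L : list bool) (u : T -> R) (v : T -> nat -> R) (s : R) (l : nat -> R).
Hypothesis Hu : filterlim u F (locally s).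
Hypothesis Hv : forall k, (k < n)%nat -> filterlim (fun q => v q k) F (locally (l k)).

Lemma filterlim_asin_mult (k : nat) : (k < n)%nat ->
  filterlim (fun q => asin (u q * v q k)) F (locally (asin (s * l k))).
Proof.
  intros Hk. apply (filterlim_Rcomp asin); [|apply continuity_pt_asin].
  apply filterlim_Rmult; auto.
Qed.

Lemma filterlim_angle_sum :
  filterlim (fun q => angle_sum n L (u q) (v q)) F (locally (angle_sum n L s l)).
Proof.
  apply filterlim_rsum. intros k Hk. apply filterlim_Rmult; [apply filterlim_const|].
  apply filterlim_asin_mult, Hk.
Qed.

Lemma sin_angle_sum_near : sin (angle_sum n L s l) <> 0 ->
  F (fun q => sin (angle_sum n L (u q) (v q)) <> 0).
Proof.
  apply filterlim_eventually_neq, (filterlim_Rcomp sin); [|apply continuity_sin].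
  apply filterlim_angle_sum.
Qed.

Lemma filterlim_secant_sum : (forall k, (k < n)%nat -> -1 < s * l k < 1) ->
  filterlim (fun q => secant_sum n L (u q) (v q)) F (locally (secant_sum n L s l)).
Proof.
  intros Hsl. apply filterlim_rsum. intros k Hk.
  apply filterlim_Rmult; [apply filterlim_const|]. apply filterlim_Rmult; auto.
  apply (filterlim_Rcomp Rinv).
  - apply (filterlim_Rcomp cos); [|apply continuity_cos]. apply filterlim_asin_mult, Hk.
  - apply (continuity_pt_inv id); [apply derivable_continuous_pt, derivable_pt_id|].
    apply Rgt_not_eq, cos_gt_0; apply asin_bound_lt, Hsl, Hk.
Qed.

Lemma regular_at_near : 0 <= s -> positive_lengths n l -> regular_at n L s l ->
  F (fun q => regular_at n L (u q) (v q)).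
Proof.
  intros Hs Hl [[k [Hk Hlong]]|[Hsin|[Hshort Hsec]]].
  - generalize (filterlim_eventually_gt _ _ _ (filterlim_Rmult _ _ _ _ Hu (Hv k Hk)) Hlong).
    apply filter_imp. intros q Hq. left. eauto.
  - generalize (sin_angle_sum_near Hsin). apply filter_imp. intros q Hq. right; left. exact Hq.
  - assert (Hshort_near : F (fun q => forall k, (k < n)%nat -> u q * v q k < 1)).
    { apply (filter_forall_lt n (fun k q => u q * v q k < 1)). intros k Hk.
      exact (filterlim_eventually_lt _ _ _ (filterlim_Rmult _ _ _ _ Hu (Hv k Hk))
               (Hshort k Hk)). }
    assert (Hsec_near : F (fun q => secant_sum n L (u q) (v q) <> 0)).
    { apply (filterlim_eventually_neq _ (secant_sum n L s l)); auto. apply filterlim_secant_sum.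
      intros k Hk. specialize (Hshort k Hk). specialize (Hl k Hk). nra. }
    generalize (filter_and _ _ Hshort_near Hsec_near). apply filter_imp.
    intros q Hq. right; right. exact Hq.
Qed.

End Limits.

Lemma filter_prod_ball (n : nat) (s : R) (l : nat -> R) (A : R * (nat -> R) -> Prop) :
  filter_prod (locally s) (coord_nbhd n l) A ->
  exists d, 0 < d /\ forall s' l', Rabs (s' - s) < d -> close n d l' l -> A (s', l').
Proof.
  intros [B C [d Hd] [d' [Hd' Hball]] HA]. exists (Rmin d d').
  split; [apply Rmin_pos; auto; apply cond_pos|].
  intros s' l' Hs' Hl'. pose proof (Rmin_l d d'). pose proof (Rmin_r d d'). apply HA.
  - apply Hd. change (Rabs (s' - s) < d). lra.
  - apply Hball, (close_le n (Rmin d d')); auto.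
Qed.

Lemma regular_at_ball (n : nat) (L : list bool) (s : R) (l : nat -> R) :
  0 <= s -> positive_lengths n l -> regular_at n L s l ->
  exists d, 0 < d /\
    forall s' l', Rabs (s' - s) < d -> close n d l' l -> regular_at n L s' l'.
Proof.
  intros Hs Hl Hreg.
  apply (filter_prod_ball n s l (fun q => regular_at n L (fst q) (snd q))).
  apply (regular_at_near n L fst snd s l); auto; [apply filterlim_fst|].
  intros k Hk. apply (filterlim_comp _ _ _ snd (fun y => y k) _ (coord_nbhd n l)).
  - apply filterlim_snd.
  - apply filterlim_coord, Hk.
Qed.

Lemma segment_uniform (n : nat) (a b : R) (l : nat -> R) (Q : R -> R -> (nat -> R) -> Prop) :
  (forall d d' s l', d' <= d -> Q d s l' -> Q d' s l') ->
  (forall t, a <= t <= b -> exists d, 0 < d /\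
     forall s l', Rabs (s - t) < d -> close n d l' l -> Q d s l') ->
  exists d, 0 < d /\ forall s l', a <= s <= b -> close n d l' l -> Q d s l'.
Proof.
  intros Hmono Hlocal.
  destruct (choice (fun t (d : posreal) => a <= t <= b ->
              forall s l', Rabs (s - t) < d -> close n d l' l -> Q d s l')) as [delta Hdelta].
  { intros t. destruct (classic (a <= t <= b)) as [Ht|Ht].
    - destruct (Hlocal t Ht) as [d [Hd HQ]]. exists (mkposreal d Hd). auto.
    - exists (mkposreal 1 Rlt_0_1). contradiction. }
  destruct (compactness_value_1d a b delta) as [d Hcover].
  exists d. split; [apply cond_pos|]. intros s l' Hs Hl'. apply NNPP. intros HQ.
  apply (Hcover s Hs). intros [t [Ht [Hst Hd]]]. apply HQ.
  apply (Hmono (delta t)); auto. apply (Hdelta t); auto. apply (close_le n d); auto.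
Qed.

Lemma long_edge_regular (n : nat) (L : list bool) (s : R) (l l' : nat -> R) :
  (0 < n)%nat -> 0 < l 0%nat -> close n (l 0%nat / 2) l' l -> 2 / l 0%nat < s ->
  regular_at n L s l'.
Proof.
  intros Hn Hl Hclose Hs. left. exists 0%nat. split; auto.
  specialize (Hclose 0%nat Hn). apply Rabs_def2 in Hclose.
  assert (0 < 2 / l 0%nat) by (apply Rdiv_lt_0_compat; lra).
  replace 1 with (2 / l 0%nat * (l 0%nat / 2)) by (field; lra).
  apply Rmult_le_0_lt_compat; lra.
Qed.

Lemma generic_lengths_near (n : nat) (L : list bool) (l : nat -> R) : (0 < n)%nat ->
  positive_lengths n l -> generic_lengths n L l -> coord_nbhd n l (generic_lengths n L).
Proof.
  intros Hn Hl Hgen. pose proof (Hl 0%nat Hn) as Hl0.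
  destruct (segment_uniform n 0 (2 / l 0%nat) l (fun _ => regular_at n L)) as [d [Hd Hreg]].
  - auto.
  - intros t Ht. apply regular_at_ball; auto; [|apply Hgen]; lra.
  - exists (Rmin d (l 0%nat / 2)). split; [apply Rmin_pos; lra|]. intros l' Hl' s Hs.
    destruct (Rle_dec s (2 / l 0%nat)).
    + apply Hreg; [lra|]. apply (close_le n (Rmin d (l 0%nat / 2))); auto using Rmin_l.
    + apply (long_edge_regular n L s l l'); auto; [|lra].
      apply (close_le n (Rmin d (l 0%nat / 2))); auto using Rmin_r.
Qed.

(** * No diameters *)

Definition diameter_regular (n : nat) (L : list bool) (M : nat) (l : nat -> R) : Prop :=
  (exists k, (k < n)%nat /\ l M < l k) \/ sin (angle_sum n L (/ l M) l) <> 0.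

Lemma diameter_regular_near (n : nat) (L : list bool) (M : nat) (l : nat -> R) : (M < n)%nat ->
  positive_lengths n l -> diameter_regular n L M l -> coord_nbhd n l (diameter_regular n L M).
Proof.
  intros HM Hl [[k [Hk Hlonger]]|Hsin].
  - assert (Hlim : filterlim (fun l' => l' k - l' M) (coord_nbhd n l) (locally (l k - l M)))
      by (apply filterlim_Rminus; apply filterlim_coord; auto).
    generalize (filterlim_eventually_gt _ _ 0 Hlim ltac:(lra)).
    apply filter_imp. intros l' Hl'. left. exists k. split; auto. lra.
  - assert (Hnear : coord_nbhd n l (fun l' => sin (angle_sum n L (/ l' M) l') <> 0)).
    { apply (sin_angle_sum_near n L (fun l' => / l' M) (fun l' => l') (/ l M) l); auto.
      - apply (filterlim_Rcomp Rinv); [apply filterlim_coord, HM|].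
        apply (continuity_pt_inv id); [apply derivable_continuous_pt, derivable_pt_id|].
        apply Rgt_not_eq, Hl, HM.
      - intros k Hk. apply filterlim_coord, Hk. }
    generalize Hnear. apply filter_imp. intros l' Hl'. right. exact Hl'.
Qed.

Lemma angle_sum_bump (n : nat) (L : list bool) (s : R) (l : nat -> R) (m : nat) (tau : R) :
  (m < n)%nat ->
  angle_sum n L s (bump l m tau)
  = angle_sum n L s l + sgn L m * (asin (s * (l m + tau)) - asin (s * l m)).
Proof.
  intros Hm. unfold angle_sum.
  rewrite <- (rsum_unitv n m (fun k => sgn L k * (asin (s * (l k + tau)) - asin (s * l k))))
    by auto.
  rewrite <- rsum_plus. apply rsum_ext. intros k Hk. unfold bump, unitv.
  destruct (Nat.eqb k m).
  - rewrite !Rmult_1_r. ring.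
  - rewrite !Rmult_0_r, !Rplus_0_r. reflexivity.
Qed.

Lemma sin_add_neq_0 (x y : R) : sin x = 0 -> sin y <> 0 -> sin (x + y) <> 0.
Proof.
  intros Hx Hy. rewrite sin_plus, Hx, Rmult_0_l, Rplus_0_l.
  apply Rmult_integral_contrapositive_currified; auto.
  pose proof (sin2_cos2 x) as Htrig. rewrite Hx in Htrig. unfold Rsqr in Htrig. nra.
Qed.

(* Shortening an edge other than the diameter [M] changes one summand by a nonzero amount of less
   than a half turn. *)
Lemma diameter_regular_shorten (n : nat) (L : list bool) (M m : nat) (l : nat -> R) (tau : R) :
  (M < n)%nat -> (m < n)%nat -> m <> M -> positive_lengths n l -> ~ diameter_regular n L M l ->
  0 < tau < l m -> diameter_regular n L M (bump l m (- tau)).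
Proof.
  intros HM Hm HmM Hl Hnot Htau. right.
  assert (Hsin : sin (angle_sum n L (/ l M) l) = 0).
  { destruct (Req_dec (sin (angle_sum n L (/ l M) l)) 0); auto.
    exfalso. apply Hnot. right. auto. }
  assert (Hle : l m <= l M) by (apply Rnot_lt_le; intros Hlt; apply Hnot; left; eauto).
  replace (bump l m (- tau) M) with (l M)
    by (unfold bump; rewrite unitv_diff by auto; ring).
  rewrite angle_sum_bump by auto. apply sin_add_neq_0; auto.
  pose proof (Hl M HM) as HlM. set (s := / l M).
  assert (Hs : 0 < s) by (apply Rinv_0_lt_compat; auto).
  assert (HsM : s * l M = 1) by (unfold s; field; lra).
  assert (Hshort : 0 < asin (s * (l m + - tau)) <= PI / 2) by (apply asin_range; nra).
  assert (Hlong : 0 < asin (s * l m) <= PI / 2) by (apply asin_range; nra).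
  assert (Hlt : asin (s * (l m + - tau)) < asin (s * l m))
    by (apply asin_lt; [lra|]; rewrite sin_asin; nra).
  assert (Hgap : 0 < sin (asin (s * l m) - asin (s * (l m + - tau))))
    by (apply sin_gt_0; lra).
  destruct (sgn_cases L m) as [-> | ->].
  - rewrite Rmult_1_l. rewrite <- (Ropp_involutive (_ - _)), sin_neg, Ropp_minus_distr. lra.
  - replace (-1 * (asin (s * (l m + - tau)) - asin (s * l m)))
      with (asin (s * l m) - asin (s * (l m + - tau))) by ring. lra.
Qed.

Lemma diameter_regular_OpenDensePos (n : nat) (L : list bool) (M : nat) :
  (2 <= n)%nat -> (M < n)%nat ->
  OpenDensePos n (fun l => coord_nbhd n l (diameter_regular n L M)).
Proof.
  intros Hn HM. apply OpenDensePos_interior. intros l Hl A HA.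
  destruct (classic (diameter_regular n L M l)) as [Hreg|Hnot].
  - exists l. split; [apply (coord_nbhd_self n l A HA)|apply diameter_regular_near; auto].
  - assert (Hm : exists m, (m < n)%nat /\ m <> M)
      by (destruct (Nat.eq_dec M 0); [exists 1%nat|exists 0%nat]; lia).
    destruct Hm as [m [Hm HmM]]. pose proof (Hl m Hm).
    destruct (bump_near n l m _ (filter_and _ _ HA (positive_lengths_near n l Hl)))
      as [d [Hd Hball]].
    set (tau := Rmin (d / 2) (l m / 2)).
    assert (Htau : 0 < tau) by (apply Rmin_pos; lra).
    assert (Hd' : tau <= d / 2) by apply Rmin_l. assert (Hlm : tau <= l m / 2) by apply Rmin_r.
    destruct (Hball (- tau)) as [HA' Hpos]; [rewrite Rabs_Ropp, Rabs_right; lra|].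
    exists (bump l m (- tau)). split; auto. apply diameter_regular_near; auto.
    apply diameter_regular_shorten; auto. lra.
Qed.

Lemma signed_sum_OpenDensePos (n : nat) (L : list bool) : (0 < n)%nat ->
  OpenDensePos n (fun l => coord_nbhd n l (fun l' => rsum n (fun k => sgn L k * l' k) <> 0)).
Proof.
  intros Hn.
  assert (Hnear : forall l, rsum n (fun k => sgn L k * l k) <> 0 ->
            coord_nbhd n l (fun l' => rsum n (fun k => sgn L k * l' k) <> 0)).
  { intros l. apply filterlim_eventually_neq.
    apply (filterlim_rsum n (fun k l' => sgn L k * l' k)). intros k Hk.
    apply filterlim_Rmult; [apply filterlim_const|apply filterlim_coord, Hk]. }
  apply OpenDensePos_interior. intros l Hl A HA.
  destruct (Req_dec (rsum n (fun k => sgn L k * l k)) 0) as [Hzero|Hne].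
  - destruct (bump_near n l 0 A HA) as [d [Hd Hball]]. exists (bump l 0 (d / 2)).
    split; [apply Hball; rewrite Rabs_right; lra|]. apply Hnear.
    rewrite (rsum_ext n _ (fun k => sgn L k * l k + sgn L k * (d / 2) * unitv 0 k))
      by (intros; unfold bump; ring).
    rewrite rsum_plus, Hzero, (rsum_unitv n 0 (fun k => sgn L k * (d / 2))) by auto.
    destruct (sgn_cases L 0) as [-> | ->]; lra.
  - exists l. split; [exact (coord_nbhd_self n l A HA)|apply Hnear, Hne].
Qed.

(** * Vanishing tangent sums *)

Lemma pigeonhole (m k : nat) (f : nat -> nat) :
  (k < m)%nat -> (forall i, (i < m)%nat -> (f i < k)%nat) ->
  exists i j, (i < j < m)%nat /\ f i = f j.
Proof.
  intros Hkm Hf. apply NNPP. intros Hinj.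
  assert (Hnodup : NoDup (map f (seq 0 m))).
  { apply NoDup_map_NoDup_ForallPairs; [|apply seq_NoDup].
    intros i j Hi Hj Hij. apply in_seq in Hi, Hj.
    destruct (Nat.lt_trichotomy i j) as [Hlt|[Heq|Hlt]]; auto; exfalso; apply Hinj.
    - exists i, j. split; [lia|auto].
    - exists j, i. split; [lia|auto]. }
  assert (Hincl : incl (map f (seq 0 m)) (seq 0 k)).
  { intros x Hx. apply in_map_iff in Hx. destruct Hx as [i [<- Hi]]. apply in_seq in Hi.
    apply in_seq. specialize (Hf i). lia. }
  pose proof (NoDup_incl_length Hnodup Hincl) as Hlength.
  rewrite length_map, !length_seq in Hlength. lia.
Qed.

Lemma two_close_values (N : nat) (B : R) (s : nat -> R) : (0 < N)%nat -> 0 < B ->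
  (forall i, (i < N + 2)%nat -> 0 <= s i <= B) ->
  exists i j, (i < j < N + 2)%nat /\ Rabs (s j - s i) <= B / INR N.
Proof.
  intros HN HB Hs.
  assert (HNR : 0 < INR N) by (apply lt_0_INR; auto).
  set (g := B / INR N). assert (Hg : 0 < g) by (apply Rdiv_lt_0_compat; auto).
  set (bucket := fun i => Z.to_nat (Int_part (s i / g))).
  assert (Hbucket : forall i, (i < N + 2)%nat ->
            INR (bucket i) * g <= s i < (INR (bucket i) + 1) * g).
  { intros i Hi. specialize (Hs i Hi).
    destruct (base_Int_part (s i / g)) as [Hle Hgt].
    assert (Hq : 0 <= s i / g) by (apply Rle_mult_inv_pos; lra).
    assert (Hz : (0 <= Int_part (s i / g))%Z).
    { assert (Hz : -1 < IZR (Int_part (s i / g))) by lra. apply lt_IZR in Hz. lia. }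
    assert (Hb : INR (bucket i) = IZR (Int_part (s i / g)))
      by (unfold bucket; rewrite INR_IZR_INZ, Z2Nat.id; auto).
    assert (Es : s i = s i / g * g) by (field; lra).
    rewrite Hb. split.
    - apply (Rle_trans _ (s i / g * g)); [apply Rmult_le_compat_r|]; lra.
    - apply (Rle_lt_trans _ (s i / g * g)); [|apply Rmult_lt_compat_r]; lra. }
  destruct (pigeonhole (N + 2) (N + 1) bucket) as [i [j [Hij Hsame]]]; [lia| |].
  - intros i Hi. destruct (Hbucket i Hi) as [Hlow _]. specialize (Hs i Hi).
    apply INR_lt. rewrite plus_INR. simpl (INR 1).
    apply (Rle_lt_trans _ (INR N)); [|lra]. apply (Rmult_le_reg_r g); auto.
    replace (INR N * g) with B by (unfold g; field; lra). lra.
  - exists i, j. split; auto. pose proof (Hbucket i ltac:(lia)) as Hi.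
    pose proof (Hbucket j ltac:(lia)) as Hj. rewrite Hsame in Hi.
    apply Rabs_le. fold g. lra.
Qed.

(* One-dimensional Sard: critical values differ at most quadratically in the critical points, so
   they do not fill an interval. *)
Lemma quadratic_relation_not_total (C : R -> R -> Prop) (B T K : R) : 0 < B -> 0 < T ->
  (forall tau, 0 <= tau <= T -> exists s, 0 <= s <= B /\ C tau s) ->
  (forall tau tau' s s', 0 <= tau <= T -> 0 <= tau' <= T -> C tau s -> C tau' s' ->
     Rabs (tau' - tau) <= K * ((s' - s) * (s' - s))) -> False.
Proof.
  intros HB HT Htotal Hquad.
  destruct (INR_unbounded (2 * Rabs K * (B * B) / T)) as [N0 HN0].
  set (N := S N0).
  assert (HN : 1 <= INR N) by (unfold N; rewrite S_INR; pose proof (pos_INR N0); lra).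
  assert (HNK : 2 * Rabs K * (B * B) < T * INR N).
  { apply (Rlt_trans _ (T * INR N0)); [|unfold N; rewrite S_INR; nra].
    replace (2 * Rabs K * (B * B)) with (T * (2 * Rabs K * (B * B) / T)) by (field; lra).
    apply Rmult_lt_compat_l; auto. }
  set (g := T / (INR N + 1)). assert (Hg : 0 < g) by (apply Rdiv_lt_0_compat; lra).
  assert (Hgrid : forall i, (i < N + 2)%nat -> 0 <= INR i * g <= T).
  { intros i Hi. assert (Hi' : INR i <= INR N + 1)
      by (rewrite <- S_INR; apply le_INR; lia).
    pose proof (pos_INR i). split; [nra|].
    replace T with ((INR N + 1) * g) by (unfold g; field; lra). nra. }
  destruct (finite_choice 0 (N + 2) (fun i s => 0 <= s <= B /\ C (INR i * g) s)) as [s Hs].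
  { intros i Hi. apply Htotal, Hgrid, Hi. }
  destruct (two_close_values N B s) as [i [j [Hij Hclose]]]; auto.
  { unfold N. lia. }
  { intros i Hi. apply Hs, Hi. }
  pose proof (Hquad _ _ (s i) (s j) (Hgrid i ltac:(lia)) (Hgrid j ltac:(lia))
                (proj2 (Hs i ltac:(lia))) (proj2 (Hs j ltac:(lia)))) as Hbound.
  assert (Hgap : g <= Rabs (INR j * g - INR i * g)).
  { assert (INR i + 1 <= INR j) by (rewrite <- S_INR; apply le_INR; lia).
    rewrite Rabs_right; nra. }
  assert (Hsqr : (s j - s i) * (s j - s i) <= B / INR N * (B / INR N)).
  { rewrite <- (Rabs_right ((s j - s i) * _)) by (apply Rle_ge, Rle_0_sqr).
    rewrite Rabs_mult. apply Rmult_le_compat; auto; apply Rabs_pos. }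
  assert (Hg' : g * (INR N * INR N) <= Rabs K * (B * B)).
  { replace (Rabs K * (B * B)) with (Rabs K * (B / INR N * (B / INR N)) * (INR N * INR N))
      by (field; lra).
    apply Rmult_le_compat_r; [nra|]. pose proof (Rle_abs K). pose proof (Rabs_pos K).
    pose proof (Rle_0_sqr (s j - s i)). unfold Rsqr in *. nra. }
  assert (HTN : T * INR N <= 2 * (g * (INR N * INR N))).
  { replace (T * INR N) with ((INR N + 1) * (g * INR N)) by (unfold g; field; lra).
    assert (0 <= g * INR N) by nra. nra. }
  lra.
Qed.

(* The witnesses [s] of a failure of genericity, kept away from [0] and from diameters. *)
Definition critical_at (n : nat) (L : list bool) (d B s : R) (l : nat -> R) : Prop :=
  d <= s <= B /\ (forall k, (k < n)%nat -> 0 < s * l k <= 1 - d) /\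
  sin (angle_sum n L s l) = 0 /\ secant_sum n L s l = 0.

Lemma positive_lower_bound (n : nat) (f : nat -> R) :
  (forall k, (k < n)%nat -> 0 < f k) -> exists g, 0 < g /\ forall k, (k < n)%nat -> g <= f k.
Proof.
  induction n as [|n IH]; intros Hf.
  - exists 1. split; [lra|]. intros; lia.
  - destruct IH as [g [Hg Hlow]]; [auto with arith|]. exists (Rmin g (f n)).
    split; [apply Rmin_pos; auto|]. intros k Hk. destruct (Nat.eq_dec k n) as [->|].
    + apply Rmin_r.
    + apply (Rle_trans _ g); [apply Rmin_l|apply Hlow; lia].
Qed.

Lemma regular_or_margin (n : nat) (L : list bool) (l : nat -> R) (t : R) : 0 <= t ->
  positive_lengths n l -> (forall M, (M < n)%nat -> diameter_regular n L M l) ->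
  rsum n (fun k => sgn L k * l k) <> 0 ->
  exists d, 0 < d /\ forall s l', Rabs (s - t) < d -> close n d l' l ->
    regular_at n L s l' \/ (d <= s /\ forall k, (k < n)%nat -> s * l' k <= 1 - d).
Proof.
  intros Ht Hl Hdiam Hsum. destruct (classic (regular_at n L t l)) as [Hreg|Hnot].
  { destruct (regular_at_ball n L t l Ht Hl Hreg) as [d [Hd Hball]]. exists d. auto. }
  assert (Hle : forall k, (k < n)%nat -> t * l k <= 1)
    by (intros k Hk; apply Rnot_lt_le; intros Hlong; apply Hnot; left; eauto).
  assert (Hlt : forall k, (k < n)%nat -> t * l k < 1).
  { intros M HM. destruct (Req_dec (t * l M) 1) as [Heq|]; [|specialize (Hle M HM); lra].
    pose proof (Hl M HM).
    assert (Et : t = / l M) by (apply (Rmult_eq_reg_r (l M)); [rewrite Heq; field|]; lra).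
    exfalso. destruct (Hdiam M HM) as [[k [Hk Hlonger]]|Hsin].
    - specialize (Hle k Hk). nra.
    - apply Hnot. right; left. rewrite Et. exact Hsin. }
  assert (Htpos : 0 < t).
  { destruct (Req_dec t 0) as [->|]; [|lra]. exfalso. apply Hnot. right; right. split; auto.
    intros Hzero. apply Hsum. rewrite <- Hzero. apply rsum_ext. intros k Hk.
    rewrite Rmult_0_l, asin_0, cos_0. field. }
  destruct (positive_lower_bound n (fun k => 1 - t * l k)) as [g [Hg Hgap]].
  { intros k Hk. specialize (Hlt k Hk). lra. }
  destruct (filter_prod_ball n t l (fun q => t / 2 < fst q /\
    forall k, (k < n)%nat -> fst q * snd q k < 1 - g / 2)) as [d [Hd Hball]].
  { apply filter_and.
    - apply (filterlim_eventually_gt _ t); [apply filterlim_fst|lra].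
    - apply (filter_forall_lt n (fun k q => fst q * snd q k < 1 - g / 2)). intros k Hk.
      apply (filterlim_eventually_lt _ (t * l k)); [|specialize (Hgap k Hk); lra].
      apply filterlim_Rmult; [apply filterlim_fst|].
      apply (filterlim_comp _ _ _ snd (fun y => y k) _ (coord_nbhd n l));
        [apply filterlim_snd|apply filterlim_coord, Hk]. }
  set (d' := Rmin d (Rmin (t / 2) (g / 2))). exists d'.
  assert (Hmin : d' <= d /\ d' <= t / 2 /\ d' <= g / 2).
  { unfold d'. pose proof (Rmin_l d (Rmin (t / 2) (g / 2))).
    pose proof (Rmin_r d (Rmin (t / 2) (g / 2))).
    pose proof (Rmin_l (t / 2) (g / 2)). pose proof (Rmin_r (t / 2) (g / 2)). lra. }
  split; [repeat apply Rmin_pos; lra|]. intros s l' Hs Hl'. right.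
  destruct (Hball s l') as [Hlow Hshort]; [lra|apply (close_le n d'); auto; lra|].
  cbn [fst snd] in *. split; [lra|]. intros k Hk. specialize (Hshort k Hk). lra.
Qed.

Lemma not_generic_critical (n : nat) (L : list bool) (l : nat -> R) : (0 < n)%nat ->
  positive_lengths n l -> (forall M, (M < n)%nat -> diameter_regular n L M l) ->
  rsum n (fun k => sgn L k * l k) <> 0 ->
  exists d B, 0 < d /\ 0 < B /\ forall l', close n d l' l -> positive_lengths n l' ->
    ~ generic_lengths n L l' -> exists s, critical_at n L d B s l'.
Proof.
  intros Hn Hl Hdiam Hsum. pose proof (Hl 0%nat Hn) as Hl0.
  destruct (segment_uniform n 0 (2 / l 0%nat) l (fun d s l' => regular_at n L s l' \/
    (d <= s /\ forall k, (k < n)%nat -> s * l' k <= 1 - d))) as [d [Hd Huniform]].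
  { intros d d' s l' Hd [Hreg|[Hs Hshort]]; [left; auto|right]. split; [lra|].
    intros k Hk. specialize (Hshort k Hk). lra. }
  { intros t Ht. apply regular_or_margin; auto. lra. }
  set (d' := Rmin d (l 0%nat / 2)).
  assert (Hmin : d' <= d /\ d' <= l 0%nat / 2) by (split; [apply Rmin_l|apply Rmin_r]).
  assert (Hd' : 0 < d') by (apply Rmin_pos; lra).
  exists d', (2 / l 0%nat). split; auto. split; [apply Rdiv_lt_0_compat; lra|].
  intros l' Hclose Hl' Hnot. apply not_all_ex_not in Hnot. destruct Hnot as [s Hs].
  apply imply_to_and in Hs. destruct Hs as [Hs Hcrit]. exists s.
  assert (HsB : s <= 2 / l 0%nat).
  { apply Rnot_lt_le. intros Hlong. apply Hcrit, (long_edge_regular n L s l); auto.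
    apply (close_le n d'); auto. lra. }
  destruct (Huniform s l') as [Hreg|[Hds Hshort]]; [lra| |contradiction|].
  { apply (close_le n d'); auto. lra. }
  split; [lra|]. split; [|split].
  - intros k Hk. specialize (Hshort k Hk). specialize (Hl' k Hk). nra.
  - apply NNPP. intros Hsin. apply Hcrit. right; left. exact Hsin.
  - apply NNPP. intros Hsec. apply Hcrit. right; right. split; [|exact Hsec].
    intros k Hk. specialize (Hshort k Hk). lra.
Qed.

Section CriticalPair.
Variables (n : nat) (L : list bool) (d B e : R) (m : nat) (l l' : nat -> R) (s s' tau : R).
Hypothesis Hm : (m < n)%nat.
Hypothesis Hd : 0 < d.
Hypothesis Hcrit : critical_at n L d B s l.
Hypothesis Hcrit' : critical_at n L d B s' l'.
Hypothesis Hbump : forall k, l' k = l k + tau * unitv m k.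
Hypothesis He : forall k, (k < n)%nat -> Rabs (s' * l' k - s * l k) <= e.
Hypothesis Hsmall : INR n * (e / d) <= 3.

Let al (k : nat) : R := asin (s * l k).
Let al' (k : nat) : R := asin (s' * l' k).

Lemma critical_sin (k : nat) : (k < n)%nat ->
  sin (al k) = s * l k /\ sin (al' k) = s' * l' k /\ d <= cos (al k) /\ d <= cos (al' k).
Proof.
  intros Hk. destruct Hcrit as [_ [Hshort _]]. destruct Hcrit' as [_ [Hshort' _]].
  specialize (Hshort k Hk). specialize (Hshort' k Hk).
  unfold al, al'. rewrite !sin_asin by lra. repeat split; apply le_cos_asin; lra.
Qed.

Lemma critical_angle_bound (k : nat) : (k < n)%nat -> Rabs (al' k - al k) <= e / d.
Proof.
  intros Hk. destruct (critical_sin k Hk) as [Hsin [Hsin' [Hcos Hcos']]].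
  apply (Rmult_le_reg_r d); auto. replace (e / d * d) with e by (field; lra).
  eapply Rle_trans; [apply sin_expansive; auto; [apply asin_bound|apply asin_bound|lra]|].
  rewrite Hsin, Hsin'. auto.
Qed.

Lemma critical_angle_sum_eq : rsum n (fun k => sgn L k * (al' k - al k)) = 0.
Proof.
  destruct Hcrit as [_ [_ [Hsin _]]]. destruct Hcrit' as [_ [_ [Hsin' _]]].
  apply sin_eq_0_0 in Hsin, Hsin'. destruct Hsin as [w Hw], Hsin' as [w' Hw'].
  apply (IZR_PI_small (w' - w)).
  - rewrite minus_IZR, Rmult_minus_distr_r, <- Hw, <- Hw'. unfold angle_sum.
    rewrite <- rsum_minus. apply rsum_ext. intros. unfold al, al'. ring.
  - apply (Rle_lt_trans _ 3); [|pose proof PI2_3_2; lra].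
    eapply Rle_trans; [apply (Rabs_rsum_le n _ (e / d))|exact Hsmall].
    intros k Hk. rewrite Rabs_sgn_mult. apply critical_angle_bound, Hk.
Qed.

(* Both first order terms, in the angles and in [s], drop out. *)
Lemma critical_linearization :
  s' * (sgn L m * (tau / cos (al m)))
  = rsum n (fun k => sgn L k *
      ((sin (al' k) - sin (al k) - cos (al k) * (al' k - al k)) / cos (al k))).
Proof.
  destruct Hcrit as [_ [_ [_ Hsec]]].
  rewrite <- (Rminus_0_r (rsum n _)), <- (Rmult_0_r (s' - s)), <- Hsec.
  rewrite <- (Rplus_0_r (rsum n _)), <- critical_angle_sum_eq.
  rewrite <- (rsum_unitv n m (fun k => sgn L k * (tau / cos (al k)))) by auto.
  unfold secant_sum. rewrite <- !rsum_scal, <- rsum_plus, <- rsum_minus.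
  apply rsum_ext. intros k Hk. destruct (critical_sin k Hk) as [-> [-> [Hcos _]]].
  fold (al k). rewrite Hbump. field. lra.
Qed.

Lemma critical_pair_bound : d * Rabs tau <= INR n * (e / d * (e / d) / d).
Proof.
  destruct (critical_sin m Hm) as [_ [_ [Hcos _]]]. pose proof (COS_bound (al m)).
  destruct Hcrit' as [[Hs' _] _].
  apply (Rle_trans _ (Rabs (s' * (sgn L m * (tau / cos (al m)))))).
  - rewrite Rabs_mult, Rabs_sgn_mult, (Rabs_right s') by lra.
    apply Rmult_le_compat; [lra|apply Rabs_pos|lra|].
    apply (Rmult_le_reg_r (cos (al m))); [lra|].
    rewrite Rabs_div, (Rabs_right (cos (al m))) by lra.
    replace (Rabs tau / cos (al m) * cos (al m)) with (Rabs tau) by (field; lra).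
    pose proof (Rabs_pos tau). nra.
  - rewrite critical_linearization. apply Rabs_rsum_le. intros k Hk.
    rewrite Rabs_sgn_mult. unfold Rdiv at 1 3. rewrite Rabs_mult.
    destruct (critical_sin k Hk) as [_ [_ [Hcosk _]]].
    apply Rmult_le_compat; try apply Rabs_pos.
    + eapply Rle_trans; [apply sin_taylor|].
      rewrite <- (Rabs_right ((al' k - al k) * _)) by (apply Rle_ge, Rle_0_sqr).
      rewrite Rabs_mult. pose proof (critical_angle_bound k Hk).
      apply Rmult_le_compat; auto using Rabs_pos.
    + rewrite Rabs_right by (apply Rle_ge; left; apply Rinv_0_lt_compat; lra).
      apply Rinv_le_contravar; lra.
Qed.

End CriticalPair.

Lemma bump_mult_increment (l : nat -> R) (m k : nat) (h B s s' tau tau' : R) :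
  Rabs (bump l m tau k) <= h -> Rabs s' <= B ->
  Rabs (s' * bump l m tau' k - s * bump l m tau k) <= Rabs (s' - s) * h + B * Rabs (tau' - tau).
Proof.
  intros Hh HB.
  replace (s' * bump l m tau' k - s * bump l m tau k) with
    ((s' - s) * bump l m tau k + s' * ((tau' - tau) * unitv m k)) by (unfold bump; ring).
  eapply Rle_trans; [apply Rabs_triang|]. rewrite !Rabs_mult.
  assert (Hu : 0 <= Rabs (unitv m k) <= 1)
    by (unfold unitv; destruct (Nat.eqb k m); [rewrite Rabs_R1|rewrite Rabs_R0]; lra).
  pose proof (Rabs_pos (tau' - tau)).
  apply Rplus_le_compat; apply Rmult_le_compat; auto using Rabs_pos; [lra| |nra].
  apply Rmult_le_pos; lra.
Qed.

Lemma exists_small_scale (p q : R) : 0 <= p -> 0 <= q ->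
  exists T, 0 < T <= 1 /\ p * T <= 1 /\ q * T <= 1.
Proof.
  intros Hp Hq. exists (/ (1 + p + q)). assert (Hinv : 0 < / (1 + p + q))
    by (apply Rinv_0_lt_compat; lra).
  assert (Hone : (1 + p + q) * / (1 + p + q) = 1) by (field; lra).
  repeat split; auto; nra.
Qed.

Lemma absorb_quadratic (c h B T x y : R) : 0 < c -> 0 <= y <= T -> 4 * c * (B * B) * T <= 1 ->
  y <= c * ((x * h + B * y) * (x * h + B * y)) -> y <= 4 * c * (h * h) * (x * x).
Proof.
  intros Hc Hy HT Hquad.
  assert (Hsqr : (x * h + B * y) * (x * h + B * y)
                 <= 2 * (h * h) * (x * x) + 2 * (B * B) * (y * y))
    by (pose proof (Rle_0_sqr (x * h - B * y)); unfold Rsqr in *; lra).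
  assert (Hyy : 4 * c * (B * B) * (y * y) <= y).
  { assert (0 <= 4 * c * (B * B)) by (pose proof (Rle_0_sqr B); unfold Rsqr in *; nra).
    assert (4 * c * (B * B) * y <= 1) by nra. nra. }
  assert (c * ((x * h + B * y) * (x * h + B * y))
          <= c * (2 * (h * h) * (x * x) + 2 * (B * B) * (y * y)))
    by (apply Rmult_le_compat_l; lra).
  lra.
Qed.

Lemma critical_quadratic (n : nat) (L : list bool) (l : nat -> R) (d B : R) (m : nat) :
  (m < n)%nat -> positive_lengths n l -> 0 < d -> 0 < B ->
  exists T K, 0 < T /\ forall tau tau' s s', 0 <= tau <= T -> 0 <= tau' <= T ->
    critical_at n L d B s (bump l m tau) -> critical_at n L d B s' (bump l m tau') ->
    Rabs (tau' - tau) <= K * ((s' - s) * (s' - s)).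
Proof.
  intros Hm Hl Hd HB. assert (Hn : 0 < INR n) by (apply lt_0_INR; lia).
  set (h := rsum n l + 1). set (c := INR n / (d * d * d * d)). set (r := INR n * h / d).
  assert (Hc : 0 < c) by (apply Rdiv_lt_0_compat; repeat apply Rmult_lt_0_compat; auto).
  destruct (exists_small_scale (4 * c * (B * B)) (INR n * B / d)) as [T [HT [HTc HTn]]].
  { apply Rmult_le_pos; nra. }
  { apply Rle_mult_inv_pos; nra. }
  exists T, (4 * c * (h * h) + r * r). split; [lra|].
  intros tau tau' s s' Htau Htau' Hcrit Hcrit'.
  set (x := Rabs (s' - s)). set (y := Rabs (tau' - tau)).
  assert (Hy : 0 <= y <= T) by (split; [apply Rabs_pos|apply Rabs_le; lra]).
  replace ((s' - s) * (s' - s)) with (x * x)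
    by (unfold x; rewrite <- Rabs_mult; apply Rabs_right, Rle_ge, Rle_0_sqr).
  destruct (Rle_dec (r * x) 1) as [Hnear|Hfar].
  - apply (Rle_trans _ (4 * c * (h * h) * (x * x)));
      [|pose proof (Rle_0_sqr (r * x)); unfold Rsqr in *; lra].
    apply (absorb_quadratic c h B T x y); auto. set (e := x * h + B * y).
    apply (Rmult_le_reg_l d); auto.
    replace (d * (c * (e * e))) with (INR n * (e / d * (e / d) / d)) by (unfold c; field; lra).
    apply (critical_pair_bound n L d B e m (bump l m tau) (bump l m tau') s s'); auto.
    + intros k. unfold bump. ring.
    + intros k Hk. apply bump_mult_increment.
      * pose proof (Hl k Hk).
        pose proof (rsum_term_le n k l Hk (fun i Hi => Rlt_le _ _ (Hl i Hi))).
        unfold bump, h, unitv. destruct (Nat.eqb k m); rewrite Rabs_right; lra.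
      * destruct Hcrit' as [Hs' _]. rewrite Rabs_right; lra.
    + replace (INR n * (e / d)) with (r * x + INR n * B / d * y) by (unfold e, r; field; lra).
      assert (INR n * B / d * y <= INR n * B / d * T); [|lra].
      apply Rmult_le_compat_l; [apply Rle_mult_inv_pos; nra|apply Hy].
  - assert (1 <= r * x * (r * x)) by nra.
    assert (0 <= 4 * c * (h * x * (h * x)))
      by (apply Rmult_le_pos; [lra|apply Rle_0_sqr]).
    lra.
Qed.

Lemma generic_lengths_OpenDensePos (n : nat) (L : list bool) : (2 <= n)%nat ->
  OpenDensePos n (fun l => coord_nbhd n l (generic_lengths n L)).
Proof.
  intros Hn.
  apply (OpenDensePos_interior_refine n _ _ (OpenDensePos_and n _ _
    (OpenDensePos_forall_In n (fun M l => coord_nbhd n l (diameter_regular n L M)) (seq 0 n)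
       (fun M HM => diameter_regular_OpenDensePos n L M Hn (proj2 (proj1 (in_seq n 0 M) HM))))
    (signed_sum_OpenDensePos n L ltac:(lia)))).
  intros l Hl [Hdiam Hsum] A HA. apply NNPP. intros Hnone.
  destruct (not_generic_critical n L l) as [d [B [Hd [HB Hcrit]]]]; auto; [lia| | |].
  { intros M HM. apply (coord_nbhd_self n l), Hdiam, in_seq. lia. }
  { exact (coord_nbhd_self n l _ Hsum). }
  destruct (critical_quadratic n L l d B 0 ltac:(lia) Hl Hd HB) as [T [K [HT Hquad]]].
  assert (Hnear : coord_nbhd n l (fun l' => A l' /\ positive_lengths n l' /\ close n d l' l)).
  { apply filter_and; [exact HA|]. apply filter_and; [apply positive_lengths_near, Hl|].
    exists d. auto. }
  destruct (bump_near n l 0 _ Hnear) as [d' [Hd' Hbump]].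
  assert (HTd : 0 < Rmin T (d' / 2)) by (apply Rmin_pos; lra).
  pose proof (Rmin_l T (d' / 2)). pose proof (Rmin_r T (d' / 2)).
  apply (quadratic_relation_not_total (fun tau s => critical_at n L d B s (bump l 0 tau))
           B (Rmin T (d' / 2)) K); auto.
  - intros tau Htau. destruct (Hbump tau) as [HA' [Hl' Hclose]]; [rewrite Rabs_right; lra|].
    destruct (Hcrit _ Hclose Hl') as [s Hs].
    + intros Hgen. apply Hnone. exists (bump l 0 tau). split; auto.
      apply generic_lengths_near; auto. lia.
    + exists s. split; auto. destruct Hs as [Hs _]. lra.
  - intros tau tau' s s' Htau Htau'. apply Hquad; lra.
Qed.

(** * Cyclic polygons with generic lengths *)

Definition sign_list (n : nat) (P : nat -> pt) (O : pt) : list bool :=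
  map (fun i => if Rlt_dec 0 (cross (psub (P (nxt n i)) (P i)) (psub O (P i)))
                then true else false) (seq 0 n).

Lemma sgn_sign_list (n : nat) (P : nat -> pt) (O : pt) (k : nat) : (k < n)%nat ->
  sgn (sign_list n P O) k = epsi n P O k.
Proof.
  intros Hk. unfold sgn, sign_list, epsi.
  set (left_of := fun i => if Rlt_dec 0 (cross (psub (P (nxt n i)) (P i)) (psub O (P i)))
                           then true else false).
  rewrite (nth_indep _ true (left_of 0%nat)) by (rewrite length_map, length_seq; auto).
  rewrite map_nth, seq_nth by auto. unfold left_of. simpl.
  destruct (Rlt_dec _ _); reflexivity.
Qed.

Lemma In_sign_list (n : nat) (P : nat -> pt) (O : pt) : In (sign_list n P O) (boolseqs n).
Proof.
  pose proof (In_boolseqs (sign_list n P O)) as HIn.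
  unfold sign_list at 2 in HIn. now rewrite length_map, length_seq in HIn.
Qed.

Lemma generic_cyclic (n : nat) (l : nat -> R) (P : nat -> pt) (O : pt) (Rad : R) :
  positive_lengths n l -> InL n l P -> OnCircle n P O Rad ->
  generic_lengths n (sign_list n P O) l ->
  (forall i, (i < n)%nat -> alphai n P O i < PI / 2) /\ tanSum n P O <> 0.
Proof.
  intros Hl HP HC Hgen. pose proof (radius_pos n P O Rad HC) as HR.
  set (s := / (2 * Rad)).
  assert (Hs : 0 < s) by (apply Rinv_0_lt_compat; lra).
  assert (Hrange := alphai_range n l P O Rad Hl HP HC).
  assert (Hsin : forall k, (k < n)%nat -> s * l k = sin (alphai n P O k)).
  { intros k Hk. rewrite (sin_alphai n l P O Rad) by auto. unfold s. field. lra. }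
  assert (Hasin : forall k, (k < n)%nat -> asin (s * l k) = alphai n P O k).
  { intros k Hk. rewrite Hsin by auto. specialize (Hrange k Hk). apply asin_sin. lra. }
  destruct (Hgen s ltac:(lra)) as [[k [Hk Hlong]]|[Hangle|[Hshort Hsec]]].
  - exfalso. rewrite Hsin in Hlong by auto. pose proof (SIN_bound (alphai n P O k)). lra.
  - exfalso. apply Hangle. destruct (rsum_hangle n P O Rad HC) as [w Hw].
    rewrite <- (sin_IZR_PI w), <- Hw. f_equal. apply rsum_ext. intros k Hk.
    now rewrite sgn_sign_list, Hasin.
  - split.
    + intros k Hk. specialize (Hshort k Hk). specialize (Hrange k Hk).
      rewrite Hsin in Hshort by auto.
      destruct (Req_dec (alphai n P O k) (PI / 2)) as [Hright|]; [|lra].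
      rewrite Hright, sin_PI2 in Hshort. lra.
    + intros Htan. apply Hsec. apply (Rmult_eq_reg_l s); [|lra].
      rewrite Rmult_0_r, <- Htan. unfold secant_sum. rewrite <- rsum_scal.
      apply rsum_ext. intros k Hk. rewrite sgn_sign_list, Hasin by auto.
      unfold tan. rewrite <- Hsin by auto. unfold Rdiv. ring.
Qed.

Theorem mainTheorem8 (n : nat) (Hn : (3 <= n)%nat) :
  exists U : (nat -> R) -> Prop,
    OpenDensePos n U /\
    forall l : nat -> R,
      (forall i, (i < n)%nat -> 0 < l i) -> U l ->
      forall (P : nat -> pt) (O : pt) (Rad : R),
        InL n l P -> OnCircle n P O Rad ->
        exists mu : nat,
          NondegCritIndex n l P mu /\
          INR mu = INR (eP n P O) - 1 - 2 * windingP n P O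
                   - (if Rlt_dec 0 (tanSum n P O) then 0 else 1).
Proof.
  exists (fun l => forall L, In L (boolseqs n) -> coord_nbhd n l (generic_lengths n L)). split.
  - apply (OpenDensePos_forall_In n (fun L l => coord_nbhd n l (generic_lengths n L))).
    intros L _. apply generic_lengths_OpenDensePos. lia.
  - intros l Hl Hgen P O Rad HP HC.
    destruct (generic_cyclic n l P O Rad Hl HP HC) as [Hacute Htan].
    { exact (coord_nbhd_self n l _ (Hgen _ (In_sign_list n P O))). }
    exact (cyclic_index n l P O Rad Hn Hl HP HC Hacute Htan).
Qed.
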